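(* Let $(P_t)_{t\ge0}$ be the transition semigroup on $\mathfrak N(\mathbb R_+)$ of the $(\alpha,g,\psi)$-age-structured branching process with immigration. Suppose that $c_0:=\sup_{y\ge0}\alpha(y)[g'(y,1-)-1]<0$. Then $P_t(\sigma,\cdot)$ converges (weakly) to a probability measure $\eta$ on $\mathfrak N(\mathbb R_+)$ as $t\to\infty$ for every $\sigma\in\mathfrak N(\mathbb R_+)$ if and only if $$\int_{\mathfrak N(\mathbb R_+)}1_{\{\langle\nu,1\rangle\ge1\}}\log\langle\nu,1\rangle\,L(d\nu)<\infty.$$ In this case, the Laplace transform of $\eta$ is given by $$\int_{\mathfrak N(\mathbb R_+)}e^{-\langle\nu,f\rangle}\eta(d\nu)=\exp\Big\{-\int_0^\infty\psi(u_sf)\,ds\Big\},\qquad f\in B(\mathbb R_+)^+.$$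
   Context: $\mathbb R_+=[0,\infty)$. $\mathfrak N(\mathbb R_+)$ is the set of integer-valued finite Borel measures on $\mathbb R_+$ with the weak convergence topology, and $\mathfrak N(\mathbb R_+)^\circ=\mathfrak N(\mathbb R_+)\setminus\{0\}$. $B(\mathbb R_+)^+$ is the set of positive (nonnegative) bounded Borel functions on $\mathbb R_+$; $\langle\nu,f\rangle=\int f\,d\nu$. The limit $\eta$ is the same for all $\sigma$. Parameters: $\alpha\in B(\mathbb R_+)^+$ is bounded away from zero; $g(x,z)=\sum_{i=0}^\infty p(x,i)z^i$ is a Borel function on $\mathbb R_+\times[0,1]$ with $p(x,i)\ge0$, $\sum_i p(x,i)=1$, and $\sup_{x\ge0}g'(x,1-)<\infty$, where $g'(x,1-)=\sum_{i\ge1}i\,p(x,i)$. $L$ is a finite positive measure on $\mathfrak N(\mathbb R_+)^\circ$ and $\psi(f)=\int_{\mathfrak N(\mathbb R_+)^\circ}(1-e^{-\langle\nu,f\rangle})L(d\nu)$ for $f\in B(\mathbb R_+)^+$. The semigroup $(P_t)_{t\ge0}$ of the $(\alpha,g,\psi)$-age-structured branching process with immigration is defined by $$\int_{\mathfrak N(\mathbb R_+)}e^{-\langle\nu,f\rangle}P_t(\sigma,d\nu)=\exp\Big\{-\langle\sigma,u_tf\rangle-\int_0^t\psi(u_sf)\,ds\Big\},\qquad \sigma\in\mathfrak N(\mathbb R_+),\ f\in B(\mathbb R_+)^+,$$ where $u_tf(x)\ge0$ is the unique solution of $$e^{-u_tf(x)}=e^{-f(x+t)}+\int_0^t\alpha(x+s)\big[g(x+s,e^{-u_{t-s}f(0)})-e^{-u_{t-s}f(x+s)}\big]ds,\qquad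 t,x\ge 0.$$ *)

(* Defs.v *)
From HB Require Import structures.
From mathcomp Require Import all_boot all_order all_algebra.
From mathcomp Require Import all_classical all_reals all_analysis.
From mathcomp Require Import measurable_realfun.

Set Implicit Arguments.
Unset Strict Implicit.
Unset Printing Implicit Defensive.

Import Order.TTheory GRing.Theory Num.Theory.
Import numFieldNormedType.Exports.

Local Open Scope classical_set_scope.
Local Open Scope ring_scope.
Local Open Scope ereal_scope.

(* The half-line is the subset [Rplus] of [R]: functions on it are functions
   on [R] whose values at negative reals are never used, and measures on it
   are measures on [R] that do not charge the negative reals. *)
Definition Rplus (R : realType) : set R :=
  [set x : R | (0 <= x)%R].
Arguments Rplus : clear implicits.

(* Library measures are functions on all subsets and their axioms say nothing
   about non-measurable ones; the last condition fixes the values there, so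
   that two elements of [intmeas R] are equal iff they agree on Borel sets.
   Finiteness follows from integer-valuedness. *)
Definition is_intmeas (R : realType)
    (m : {measure set R -> \bar R}) : Prop :=
  [/\ (forall A, measurable A -> exists n : nat, m A = n%:R%:E),
      m (~` Rplus R) = 0
    & (forall A, ~ measurable A -> m A = 0)].

Record intmeas (R : realType) := IntMeas {
  intmeas_measure :> {measure set R -> \bar R} ;
  intmeasP : is_intmeas intmeas_measure }.

Lemma intmeas0_subproof (R : realType) : @is_intmeas R mzero.
Proof. by split=> // A _; exists 0%N. Qed.

Definition intmeas0 (R : realType) : intmeas R :=
  IntMeas (@intmeas0_subproof R).
Arguments intmeas0 : clear implicits.

Definition pairing (R : realType) (nu : intmeas R) (f : R -> R) : \bar R :=
  \int[intmeas_measure nu]_(x in Rplus R) (f x)%:E.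

Record Cb_Rplus (R : realType) := CbRplus {
  Cb_fun :> R -> R ;
  Cb_cont : {within Rplus R, continuous Cb_fun} ;
  Cb_bounded : exists M : R, forall x : R, (0 <= x)%R -> (`|Cb_fun x| <= M)%R }.

HB.instance Definition _ (R : realType) := gen_eqMixin (intmeas R).
HB.instance Definition _ (R : realType) := gen_choiceMixin (intmeas R).
HB.instance Definition _ (R : realType) :=
  isPointed.Build (intmeas R) (intmeas0 R).

(* The topology of weak convergence is the coarsest one making
   [nu |-> pairing nu h] continuous for all bounded continuous [h]. *)
HB.instance Definition _ (R : realType) := Topological.copy (intmeas R)
  (sup_topology (fun h : Cb_Rplus R => Topological.class
     (initial_topology (fun nu : intmeas R => pairing nu h)))).

(* [intmeas R] carries its Borel sigma-algebra. *)
HB.instance Definition _ (R : realType) := Measurable.copy (intmeas R)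
  (g_sigma_algebraType (@open (intmeas R))).

Definition Bplus (R : realType) (f : R -> R) : Prop :=
  [/\ measurable_fun (Rplus R) f,
      (forall x : R, (0 <= x)%R -> (0 <= f x)%R)
    & exists M : R, forall x : R, (0 <= x)%R -> (f x <= M)%R].

Definition bounded_away_from_zero (R : realType) (f : R -> R) : Prop :=
  exists2 c : R, (0 < c)%R & forall x : R, (0 <= x)%R -> (c <= f x)%R.

Definition gen_fun (R : realType) (p : R -> nat -> R) (x z : R) : \bar R :=
  \sum_(i <oo) (p x i * z ^+ i)%:E.

(* the left derivative g'(x,1-), i.e. the mean number of offspring *)
Definition gen_mean (R : realType) (p : R -> nat -> R) (x : R) : \bar R :=
  \sum_(i <oo) (i%:R * p x i)%:E.

Definition offspring_law (R : realType) (p : R -> nat -> R) : Prop :=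
  [/\ (forall (x : R) i, (0 <= x)%R -> (0 <= p x i)%R),
      (forall x : R, (0 <= x)%R -> \sum_(i <oo) (p x i)%:E = 1),
      measurable_fun (Rplus R `*` (`[0%R, 1%R] : set R))
        (fun xz : R * R => gen_fun p xz.1 xz.2)
    & ereal_sup [set gen_mean p x | x in Rplus R] < +oo].

(* Measurability in [(t, x)] gives a meaning to the integrals; among the
   measurable nonnegative functions the solution is unique on [t, x >= 0]. *)
Definition cumulant_semigroup (R : realType) (alpha : R -> R)
    (p : R -> nat -> R) (u : R -> (R -> R) -> R -> R) : Prop :=
  forall f : R -> R, Bplus f ->
  [/\ measurable_fun (Rplus R `*` Rplus R)
        (fun tx : R * R => u tx.1 f tx.2),
      (forall t x : R, (0 <= t)%R -> (0 <= x)%R -> (0 <= u t f x)%R)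
    & (forall t x : R, (0 <= t)%R -> (0 <= x)%R ->
        (expR (- u t f x))%:E =
        (expR (- f (x + t)%R))%:E +
        \int[lebesgue_measure]_(s in `[0%R, t])
          ((alpha (x + s)%R)%:E *
           (gen_fun p (x + s) (expR (- u (t - s)%R f 0%R)) -
            (expR (- u (t - s)%R f (x + s)%R))%:E)))].

Definition psi (R : realType) (L : {measure set (intmeas R) -> \bar R})
    (f : R -> R) : \bar R :=
  \int[L]_(nu in [set nu | nu <> intmeas0 R]) (1 - expeR (- pairing nu f)).

Definition immigration_semigroup (R : realType)
    (L : {measure set (intmeas R) -> \bar R})
    (u : R -> (R -> R) -> R -> R)
    (P : R -> R.-pker (intmeas R) ~> (intmeas R)) : Prop :=
  forall (t : R) (sigma : intmeas R) (f : R -> R), (0 <= t)%R -> Bplus f ->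
    \int[P t sigma]_nu expeR (- pairing nu f) =
    expeR (- pairing sigma (u t f) -
           \int[lebesgue_measure]_(s in `[0%R, t]) psi L (u s f)).

Definition weakly_converges (R : realType)
    (mu : R -> {measure set (intmeas R) -> \bar R})
    (eta : {measure set (intmeas R) -> \bar R}) : Prop :=
  forall F : intmeas R -> R, continuous F ->
    (exists M : R, forall nu, (`|F nu| <= M)%R) ->
    \int[mu t]_nu (F nu)%:E @[t --> +oo%R] --> \int[eta]_nu (F nu)%:E.

(* Main.v *)
From HB Require Import structures.
Require Import Defs.
From mathcomp Require Import all_boot all_order all_algebra.
From mathcomp Require Import all_classical all_reals all_analysis.
From mathcomp Require Import measurable_realfun ring lra zify.

Set Implicit Arguments.
Unset Strict Implicit.
Unset Printing Implicit Defensive.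

Import Order.TTheory GRing.Theory Num.Theory.
Import numFieldNormedType.Exports.

Local Open Scope classical_set_scope.
Local Open Scope ring_scope.

(** Fix c > 0 with alpha (g'(.,1-) - 1) <= -c, and K > c bounding alpha. The
    function phi_t(x) = e^{-u_t f(x)}, the Laplace functional of the population
    issued from one ancestor of age x, solves an equation that contracts by
    the factor 1 - c/K once it is put in mild form ([branching_mild]). Bounds
    and signs thus propagate from the initial datum ([contraction_le0]). In
    particular 1 - phi_t <= sup(1 - e^{-f}) e^{-ct} ([mild_decay]), while
    1 - phi_t >= e^{-Kt} (1 - e^{-f}) ([mild_upper]): a group of N particles
    stays alive for a time of order log N, between (log N)/K and (log N)/c.

    Necessity of the logarithmic moment. Convergence from the empty
    configuration, tested on nu |-> e^{-nu(1)}, makes the integral of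
    psi(u_s 1) over the half-line finite. A group of N immigrants contributes
    at least a constant times log N to it ([weak_limit_log_moment]).

    Sufficiency. Convergence even holds in total variation. At time t + r the
    population consists of the immigrants of the last t units of time with
    their offspring, distributed according to P_t(0, .), and of the independent
    descendants of the population at time r. The latter is extinct with
    probability at least kappa = (1 - e^{-c(t+r)})^{sigma(1)} e^{-J(t)}, where
    J(t) is a bound on the alive time left, at age t, of the immigrating
    groups; it tends to 0 under the logarithmic moment condition
    ([mean_alive_time_cvg0]). Therefore
    P_{t+r}(sigma, .) >= kappa P_t(0, .) ([minorization]), with kappa close to
    1, and the P_n(0, .) are Cauchy uniformly over all Borel sets
    ([dominating_limit]). Their limit eta attracts every P_t(sigma, .), on all
    bounded measurable functions ([limit_law]). The Laplace transform of eta
    is read off from that of P_n(0, .), and a weak limit is unique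
    ([law_unique]).

    The kernels are only known through their Laplace functionals, so the
    minorization cannot be obtained by constructing the two independent
    populations. For a weight w with values in the natural numbers,
    the Laplace functional at -(ln z) w is the generating function of the
    count <nu, w>. Those of P_{t+r}(sigma, .) are a product of those of
    P_t(0, .) and of a factor R(z) >= kappa, and R - kappa is absolutely
    monotone because finite differences in z stay nonnegative along the
    branching equation ([mild_fdiff]). Coefficients of absolutely monotone
    power series are nonnegative ([coef_ge0]), which gives the minorization
    for events that depend on one count. These events approximate every Borel
    set in measure ([approx_measurable]): two counts can be packed into one by
    division with remainder, and the Borel sets are generated by finitely many
    inequalities on pairings with continuous functions, as there are only
    countably many boxes with rational endpoints around lists of atoms
    ([open_sigma_basic]). *)

(** * Finite differences and absolutely monotone functions *)

Section Differences.
Variable R : realType.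
Implicit Types (a b : nat -> R) (n i j k : nat).

Fixpoint fdiff n a j : R :=
  if n is m.+1 then fdiff m a j.+1 - fdiff m a j else a j.

Lemma fdiffS n a j : fdiff n.+1 a j = fdiff n a j.+1 - fdiff n a j.
Proof. by []. Qed.

Lemma eq_fdiff n a b j :
  (forall i, (j <= i <= j + n)%N -> a i = b i) -> fdiff n a j = fdiff n b j.
Proof.
elim: n j => [|n IHn] j eqab /=; first by apply: eqab; lia.
by rewrite !IHn// => i hi; apply: eqab; lia.
Qed.

Lemma fdiffB n a b j : fdiff n (fun i => a i - b i) j = fdiff n a j - fdiff n b j.
Proof. by elim: n j => //= n IHn j; rewrite !IHn; ring. Qed.

Lemma fdiffZ n (c : R) a j : fdiff n (fun i => c * a i) j = c * fdiff n a j.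
Proof. by elim: n j => //= n IHn j; rewrite !IHn; ring. Qed.

Lemma fdiffD n a b j : fdiff n (fun i => a i + b i) j = fdiff n a j + fdiff n b j.
Proof. by elim: n j => //= n IHn j; rewrite !IHn; ring. Qed.

Lemma fdiff_sum n (F : nat -> nat -> R) N j :
  fdiff n (fun i => \sum_(k < N) F k i) j = \sum_(k < N) fdiff n (F k) j.
Proof.
elim: n j => //= n IHn j; rewrite !IHn -sumrB; exact: eq_bigr.
Qed.

Lemma fdiff_cst n (c : R) j : fdiff n.+1 (fun=> c) j = 0.
Proof.
by elim: n j => [|n IHn] j; [rewrite /= subrr | rewrite /= in IHn *; rewrite !IHn subrr].
Qed.

Lemma fdiff_cvg n (F : nat -> nat -> R) a j :
  (forall i, (j <= i <= j + n)%N -> F ^~ i @ \oo --> a i) ->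
  (fun k => fdiff n (F k) j) @ \oo --> fdiff n a j.
Proof.
elim: n j => [|n IHn] j h /=; first by apply: h; lia.
by apply: cvgB; apply: IHn => i hi; apply: h; lia.
Qed.

Lemma fdiffSE n a j : fdiff n.+1 a j = fdiff n (fun i => a i.+1 - a i) j.
Proof. by elim: n j => //= n IHn j; rewrite -!IHn. Qed.

Lemma fdiffM n a b j : fdiff n (fun i => a i * b i) j =
  \sum_(i < n.+1) 'C(n, i)%:R * (fdiff i a j * fdiff (n - i) b (j + i)).
Proof.
elim: n j => [|n IHn] j.
  by rewrite big_ord_recr big_ord0 /= add0r bin0 mul1r addn0.
rewrite /= !IHn.
pose A i := fdiff i a j.
pose B i k := fdiff i b k.
transitivity (\sum_(i < n.+1) 'C(n, i)%:R * (A i.+1 * B (n - i)%N (j + i.+1)%N)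
   + \sum_(i < n.+1) 'C(n, i)%:R * (A i * B (n.+1 - i)%N (j + i)%N)).
  rewrite -sumrB -big_split /=; apply: eq_bigr => i _.
  have hi : (i <= n)%N by have := ltn_ord i; lia.
  rewrite subSn// /A /B addSn addnS /=; ring.
rewrite big_ord_recr /= binn [in X in _ + X]big_ord_recl /= bin0.
rewrite [RHS]big_ord_recl [X in _ = _ + X]big_ord_recr /= bin0 binn.
have -> : \sum_(i < n) 'C(n.+1, bump 0 i)%:R * (fdiff (bump 0 i) a j
    * fdiff (n.+1 - bump 0 i) b (j + bump 0 i)) =
  \sum_(i < n) 'C(n, i)%:R * (A i.+1 * B (n - i)%N (j + i.+1)%N) +
  \sum_(i < n) 'C(n, bump 0 i)%:R * (A (bump 0 i) * B (n.+1 - bump 0 i)%N (j + bump 0 i)%N).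
  rewrite -big_split /=; apply: eq_bigr => i _.
  rewrite /bump !leq0n !add1n binS subSS natrD /A /B ?add0n /=; ring.
rewrite /bump !leq0n ?add1n ?add0n /A /B !subSS !subnn !subn0 !addn0 /=; ring.
Qed.

End Differences.
Arguments fdiff : simpl never.

Section AbsMono.
Variable R : realType.
Implicit Types (f g : R -> R) (n i j k : nat) (h d e : R).

Definition grid h j : R := j.+1%:R * h.

Lemma grid_itv h j : 0 < h -> grid h j < 1 -> 0 < grid h j < 1.
Proof. by move=> h0 h1; rewrite /grid mulr_gt0//=. Qed.

Lemma grid_le h i j : 0 < h -> (i <= j)%N -> grid h i <= grid h j.
Proof. by move=> h0 ij; rewrite /grid ler_pM2r// ler_nat. Qed.

(** Absolute monotonicity on the open unit interval, in terms of differences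
    on the grids h, 2h, 3h, ... rather than of derivatives: no smoothness has
    to be carried along, and the condition passes through products, integrals
    and limits because differences do. *)
Definition absmono f := forall n h j,
  0 < h -> grid h (j + n) < 1 -> 0 <= fdiff n (f \o grid h) j.

Lemma absmono_cst (c : R) : 0 <= c -> absmono (cst c).
Proof. by move=> c0 [|n] h j h0 hj; [|rewrite fdiff_cst]. Qed.

Lemma absmono_ext f g : (forall z, 0 < z < 1 -> f z = g z) -> absmono f -> absmono g.
Proof.
move=> fg af n h j h0 hj.
rewrite -(@eq_fdiff _ _ (f \o grid h)); first exact: af.
move=> i hi /=; apply: fg; apply: grid_itv => //.
by apply: le_lt_trans hj; apply: grid_le => //; lia.
Qed.

Lemma absmonoM f g : absmono f -> absmono g -> absmono (fun z => f z * g z).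
Proof.
move=> af ag n h j h0 hj.
rewrite (@fdiffM R n (f \o grid h) (g \o grid h) j).
apply: sumr_ge0 => i _; rewrite mulr_ge0//.
have hi : (i <= n)%N by have := ltn_ord i; lia.
apply: mulr_ge0; last by apply: ag => //; rewrite -addnA subnKC.
by apply: af => //; apply: le_lt_trans hj; apply: grid_le => //; lia.
Qed.

Lemma absmono_id : absmono id.
Proof.
move=> [|[|n]] h j h0 hj /=; rewrite /grid.
- by rewrite mulr_ge0// ltW.
- by rewrite /fdiff /= -mulrBl -natrB// subSnn mul1r ltW.
- rewrite -[leRHS]/(fdiff n.+2 (id \o grid h) j) fdiffSE.
  rewrite (@eq_fdiff _ _ _ (fun=> h)) ?fdiff_cst// => i _ /=.
  by rewrite /grid -mulrBl -natrB// subSnn mul1r.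
Qed.

Lemma absmono_exp k : absmono (fun z => z ^+ k).
Proof.
elim: k => [|k IHk].
  by apply: (@absmono_ext (cst 1)) => [z _|]; [rewrite expr0|exact: absmono_cst].
apply: (@absmono_ext (fun z => z * z ^+ k)); first by move=> z _; rewrite exprS.
by apply: absmonoM => //; exact: absmono_id.
Qed.

Lemma absmono_prod (T : Type) (s : seq T) (F : T -> R -> R) :
  (forall x, List.In x s -> absmono (F x)) -> absmono (fun z => \prod_(x <- s) F x z).
Proof.
elim: s => [|x s IHs] hF.
  by apply: (@absmono_ext (cst 1)) => [z _|]; [rewrite big_nil|exact: absmono_cst].
apply: (@absmono_ext (fun z => F x z * \prod_(y <- s) F y z)).
  by move=> z _; rewrite big_cons.
apply: absmonoM; first by apply: hF; left.
by apply: IHs => y ys; apply: hF; right.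
Qed.

(** A constant only affects the differences of order zero. *)
Lemma absmonoBc f (c : R) : absmono f -> (forall z, 0 < z < 1 -> c <= f z) ->
  absmono (fun z => f z - c).
Proof.
move=> af fc [|n] h j h0 hj.
  rewrite /= subr_ge0; apply: fc; apply: grid_itv => //.
  by rewrite addn0 in hj.
rewrite (@fdiffB _ _ (f \o grid h) (fun=> c)) fdiff_cst subr0; exact: af.
Qed.

(** In the Leibniz formula every middle term is a product of differences of
    lower order, hence nonnegative; the differences of order n+1 occur only in
    the two extreme terms, multiplied by a value in [0,1]. *)
Lemma fdiffM_lower n (a b : nat -> R) j d e :
  0 <= d -> 0 <= e ->
  (forall i, (j <= i <= j + n.+1)%N -> 0 <= a i <= 1) ->
  (forall i, (j <= i <= j + n.+1)%N -> 0 <= b i <= 1) ->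
  (forall k i, (k <= n)%N -> (j <= i)%N -> (i + k <= j + n.+1)%N -> 0 <= fdiff k a i) ->
  (forall k i, (k <= n)%N -> (j <= i)%N -> (i + k <= j + n.+1)%N -> 0 <= fdiff k b i) ->
  - d <= fdiff n.+1 a j -> - e <= fdiff n.+1 b j ->
  - (d + e) <= fdiff n.+1 (fun i => a i * b i) j.
Proof.
move=> d0 e0 a01 b01 da db hd he.
rewrite fdiffM big_ord_recl big_ord_recr /= bin0 /bump /= add1n binn subnn !mul1r addn0 ?subn0.
have mid : 0 <= \sum_(i < n) 'C(n.+1, bump 0 i)%:R *
   (fdiff (bump 0 i) a j * fdiff (n.+1 - bump 0 i) b (j + bump 0 i)).
  apply: sumr_ge0 => i _; rewrite mulr_ge0// /bump leq0n add1n.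
  have hi := ltn_ord i.
  by rewrite mulr_ge0//; [apply: da; lia|apply: db; lia].
have aj := a01 j; have bj := b01 (j + n.+1)%N.
have /andP[aj0 aj1] : 0 <= a j <= 1 by apply: aj; lia.
have /andP[bj0 bj1] : 0 <= b (j + n.+1)%N <= 1 by apply: bj; lia.
have h1 : - e <= a j * fdiff n.+1 b j.
  have [h|h] := leP 0 (fdiff n.+1 b j).
    by rewrite (@le_trans _ _ 0)// ?oppr_le0// mulr_ge0.
  apply: le_trans he _; rewrite -subr_ge0.
  rewrite (_ : _ - _ = (1 - a j) * (- fdiff n.+1 b j)); last by ring.
  by rewrite mulr_ge0// ?subr_ge0// oppr_ge0 ltW.
have h2 : - d <= fdiff n.+1 a j * b (j + n.+1)%N.
  have [h|h] := leP 0 (fdiff n.+1 a j).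
    by rewrite (@le_trans _ _ 0)// ?oppr_le0// mulr_ge0.
  apply: le_trans hd _; rewrite -subr_ge0.
  rewrite (_ : _ - _ = (1 - b (j + n.+1)%N) * (- fdiff n.+1 a j)); last by ring.
  by rewrite mulr_ge0// ?subr_ge0// oppr_ge0 ltW.
move: mid h1 h2; rewrite /bump /=.
rewrite -[fdiff 0 a j]/(a j) -[fdiff 0 b _]/(b (j + n.+1)%N).
set X := \sum_(i < n) _ => mid h1 h2; lra.
Qed.

Lemma fdiffX_nonneg n N (a : nat -> R) m :
  (forall k i, (k <= n)%N -> (i + k <= N)%N -> 0 <= fdiff k a i) ->
  forall k i, (k <= n)%N -> (i + k <= N)%N -> 0 <= fdiff k (fun i => a i ^+ m) i.
Proof.
move=> da; elim: m => [|m IHm] k i kn ikN.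
  rewrite (@eq_fdiff _ _ _ (fun=> 1)); last by move=> ? _; rewrite expr0.
  by case: k {kn ikN} => [|k]; rewrite ?fdiff_cst//=.
rewrite (@eq_fdiff _ _ _ (fun i => a i * a i ^+ m)); last by move=> ? _; rewrite exprS.
rewrite fdiffM; apply: sumr_ge0 => l _; rewrite mulr_ge0//.
have hl := ltn_ord l.
by rewrite mulr_ge0//; [apply: da; lia|apply: IHm; lia].
Qed.

(** The factor m is the derivative of z^m at 1. Averaged over an offspring law
    it becomes the mean number of offspring. *)
Lemma fdiffX_lower n N (a : nat -> R) d m :
  0 <= d ->
  (forall i, (i <= N)%N -> 0 <= a i <= 1) ->
  (forall k i, (k <= n)%N -> (i + k <= N)%N -> 0 <= fdiff k a i) ->
  (forall i, (i + n.+1 <= N)%N -> - d <= fdiff n.+1 a i) ->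
  forall i, (i + n.+1 <= N)%N -> - (m%:R * d) <= fdiff n.+1 (fun i => a i ^+ m) i.
Proof.
move=> d0 a01 da hd; elim: m => [|m IHm] i iN.
  rewrite (@eq_fdiff _ _ _ (fun=> 1)); last by move=> ? _; rewrite expr0.
  by rewrite fdiff_cst mul0r oppr0.
rewrite (@eq_fdiff _ _ _ (fun i => a i * a i ^+ m)); last by move=> ? _; rewrite exprS.
rewrite -[m.+1]add1n natrD mulrDl mul1r.
apply: fdiffM_lower => //; rewrite ?mulr_ge0//.
- by move=> l hl; apply: a01; lia.
- move=> l hl; have /andP[h0 h1] : 0 <= a l <= 1 by apply: a01; lia.
  by rewrite exprn_ge0// exprn_ile1.
- by move=> k l kn jl lk; apply: da; lia.
- by move=> k l kn jl lk; apply: (@fdiffX_nonneg n N); [exact: da|lia|lia].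
- exact: hd.
- exact: IHm.
Qed.

End AbsMono.

Section Coefficients.
Variable R : realType.
Implicit Types (n i j k : nat) (h : R).

Lemma fdiff_powS n k j : fdiff n (fun j => j.+1%:R ^+ k.+1 : R) j =
  (j + n).+1%:R * fdiff n (fun j => j.+1%:R ^+ k) j +
  n%:R * fdiff n.-1 (fun j => j.+1%:R ^+ k) j.
Proof.
elim: n j => [|n IHn] j; first by rewrite /fdiff /= mul0r addr0 addn0 exprS.
rewrite [LHS]fdiffS !IHn fdiffS /=.
case: n IHn => [|n] IHn /=; rewrite ?[in RHS]fdiffS ?mul0r ?addr0 !addnS ?addSn ?addn0.
  by rewrite -!natr1; ring.
rewrite !fdiffS -!natr1 !natrD; ring.
Qed.

(** With [fdiff_pow_diag], this is how a difference of order n isolates the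
    n-th coefficient of a power series when the mesh of the grid tends to 0.
    *)
Lemma fdiff_pow_small n k j : (k < n)%N -> fdiff n (fun j => j.+1%:R ^+ k : R) j = 0.
Proof.
elim: k n j => [|k IHk] n j kn.
  case: n kn => // n _; rewrite (@eq_fdiff _ _ _ (fun=> 1)) ?fdiff_cst//.
rewrite fdiff_powS !IHk ?mulr0 ?addr0//; lia.
Qed.

Lemma fdiff_pow_diag n j : fdiff n (fun j => j.+1%:R ^+ n : R) j = n`!%:R.
Proof.
elim: n j => [|n IHn] j; first by rewrite /fdiff /= expr0.
by rewrite fdiff_powS fdiff_pow_small// mulr0 add0r /= IHn factS natrM.
Qed.

Lemma fdiff_pow_bound n k j :
  `|fdiff n (fun j => j.+1%:R ^+ k : R) j| <= 2 ^+ n * (j + n).+1%:R ^+ k.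
Proof.
elim: n j => [|n IHn] j.
  by rewrite /fdiff /= mul1r addn0 ger0_norm// exprn_ge0.
rewrite fdiffS; apply: le_trans (ler_normB _ _) _.
rewrite exprS -mulrA mulr2n mulrDl !mul1r.
apply: lerD; first by have := IHn j.+1; rewrite addSn addnS.
apply: le_trans (IHn j) _; rewrite ler_pM2l ?exprn_gt0//.
by apply: lerXn2r; rewrite ?nnegrE// ler_nat addnS.
Qed.

Lemma geom_tail_bound (q : R) n M : 0 <= q <= 2^-1 ->
  \sum_(n <= k < M) q ^+ k <= 2 * q ^+ n.
Proof.
move=> /andP[q0 q1].
have [nM|nM] := leqP n M; last by rewrite big_geq ?mulr_ge0 ?exprn_ge0// ltnW.
suff h : (1 - q) * \sum_(n <= k < M) q ^+ k <= q ^+ n.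
  have q2 : 1 <= 2 * (1 - q) by lra.
  apply: (@le_trans _ _ (2 * (1 - q) * \sum_(n <= k < M) q ^+ k)).
    by rewrite ler_peMl// sumr_ge0// => i _; exact: exprn_ge0.
  by rewrite -mulrA ler_pM2l.
rewrite mulr_sumr (@telescope_sumr_eq _ n M (fun k => - q ^+ k)) //.
  by rewrite opprK addrC gerBl exprn_ge0.
by move=> k _; rewrite exprS; ring.
Qed.

(** If d n were negative, the n-th difference of D on a grid of small mesh h
    would be negative as well: it equals n! d_n h^n up to O(h^(n+1)), because
    it annihilates the lower powers and the higher ones contribute a geometric
    tail. *)
Theorem coef_ge0 (d : nat -> R) (D : R -> R) :
  (forall n, `|d n| <= 1) ->
  (forall z, 0 < z < 1 -> series (fun k => d k * z ^+ k) @ \oo --> D z) ->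
  absmono D -> forall n, 0 <= d n.
Proof.
move=> d1 hD aD n; rewrite leNgt; apply/negP => dn0.
pose C : R := 2 ^+ n * (2 * n.+1%:R ^+ n.+1).
have C0 : 0 < C by rewrite !mulr_gt0 ?exprn_gt0.
(* The first bound gives the tail a ratio of at most 1/2, the second makes the
   tail smaller than the main term. *)
pose h : R := Num.min (2^-1 / n.+1%:R) (- d n / (2 * C)).
have h0 : 0 < h by rewrite lt_min !divr_gt0 ?oppr_gt0// mulr_gt0.
have hq : n.+1%:R * h <= 2^-1.
  by rewrite mulrC -ler_pdivlMr// ge_min lexx.
have hC : C * h < - d n.
  have : h <= - d n / (2 * C) by rewrite ge_min lexx orbT.
  rewrite ler_pdivlMr ?mulr_gt0//; nra.
have gn1 : grid h n < 1 by apply: le_lt_trans hq _; rewrite invf_lt1// ltr1n.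
have key : 0 <= n`!%:R * d n * h ^+ n + C * h ^+ n.+1.
  have lim : (fun M => fdiff n (fun j => series (fun k => d k * grid h j ^+ k) M) 0%N)
       @ \oo --> fdiff n (D \o grid h) 0%N.
    apply: fdiff_cvg => i hi; apply: hD; apply: grid_itv => //.
    by apply: le_lt_trans gn1; apply: grid_le => //; lia.
  have Dge0 : 0 <= fdiff n (D \o grid h) 0%N by apply: aD.
  apply: le_trans Dge0 _; rewrite -(cvg_lim _ lim)//.
  apply: limr_le; first by apply/cvg_ex; eexists; exact: lim.
  near=> M.
  have nM : (n < M)%N by near: M; exact: nbhs_infty_gt.
  rewrite (@eq_fdiff _ _ _ (fun j => \sum_(k < M) (d k * h ^+ k) * j.+1%:R ^+ k)); last first.
    move=> i _; rewrite /series /= big_mkord; apply: eq_bigr => k _.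
    by rewrite /grid exprMn; ring.
  rewrite (fdiff_sum n (fun k j => (d k * h ^+ k) * j.+1%:R ^+ k)).
  under eq_bigr do rewrite fdiffZ.
  rewrite -(big_mkord xpredT (fun k => d k * h ^+ k * fdiff n (fun i => i.+1%:R ^+ k) 0)).
  rewrite (@big_cat_nat _ _ _ n.+1)//= big_nat_recr//= big_nat_cond big1 ?add0r; last first.
    by move=> k /andP[/andP[_ kn] _]; rewrite fdiff_pow_small// mulr0.
  rewrite fdiff_pow_diag.
  apply: lerD; first by rewrite le_eqVlt; apply/orP; left; apply/eqP; ring.
  apply: (@le_trans _ _ (\sum_(n.+1 <= k < M) 2 ^+ n * (n.+1%:R * h) ^+ k)).
    apply: ler_sum => k _; apply: le_trans (ler_norm _) _.
    rewrite !normrM (ger0_norm (exprn_ge0 _ (ltW h0))).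
    have hb := fdiff_pow_bound n k 0%N; rewrite add0n in hb.
    apply: (@le_trans _ _ (1 * h ^+ k * (2 ^+ n * n.+1%:R ^+ k))).
      by rewrite ler_pM ?mulr_ge0 ?exprn_ge0 ?(ltW h0)// ler_wpM2r ?exprn_ge0 ?(ltW h0).
    by rewrite exprMn le_eqVlt; apply/orP; left; apply/eqP; ring.
  rewrite -mulr_sumr /C -!mulrA ler_pM2l ?exprn_gt0//.
  apply: le_trans (geom_tail_bound _ _ _) _; last by rewrite exprMn.
  by rewrite hq mulr_ge0// ltW.
have hn0 : 0 < h ^+ n by rewrite exprn_gt0.
have : 0 <= h ^+ n * (n`!%:R * d n + C * h).
  by apply: le_trans key _; rewrite exprS le_eqVlt; apply/orP; left; apply/eqP; ring.
rewrite pmulr_rge0// => k1.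
have f1 : 1 <= n`!%:R :> R by rewrite ler1n fact_gt0.
nra.
Unshelve. all: end_near. Qed.

End Coefficients.

(** * Integral equations in the time variable *)

Lemma bounded_integrable d (T : measurableType d) (R : realType)
    (mu : {measure set T -> \bar R}) (D : set T) (k : T -> R) (M : R) :
  measurable D -> (mu D < +oo)%E -> measurable_fun D k ->
  (forall s, D s -> `|k s| <= M) -> mu.-integrable D (EFin \o k).
Proof.
move=> mD Doo mk kM; apply: measurable_bounded_integrable => //.
exists M; split; first exact: num_real.
by move=> x Mx s Ds; apply: le_trans (kM _ Ds) (ltW Mx).
Qed.

Section Calculus.
Variable R : realType.
Notation mu := (@lebesgue_measure R).
Implicit Types (k y f : R -> R) (a b r s t K M : R).

Lemma integral_shift (r : R) (D : set R) (f : R -> \bar R) :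
  measurable D -> measurable_fun D f -> (forall x, D x -> (0 <= f x)%E) ->
  (\int[mu]_(s in (fun s => (r + s)%R) @^-1` D) f (r + s)%R = \int[mu]_(s in D) f s)%E.
Proof.
move=> mD mf f0.
have mphi : measurable_fun [set: measurableTypeR R] (fun s : R => (r + s)%R : measurableTypeR R).
  by apply: measurable_funD.
rewrite [LHS](_ : _ = \int[mu]_(s in (fun s => (r + s)%R) @^-1` D) (f \o (fun s => (r + s)%R)) s)%E//.
rewrite -(ge0_integral_pushforward mphi mu)//; last first.
  by move=> x; rewrite inE; exact: f0.
apply: eq_measure_integral => A mA _ /=; apply/esym.
pose mf' : {measure set (measurableTypeR R) -> \bar R} := pushforward mu (fun s : R => (r + s)%R : measurableTypeR R).
apply: (@lebesgue_measure_unique _ (mf' mphi)) => // X [[a b] _ <-].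
rewrite /mf' /= /pushforward lebesgue_measure_itv/= lte_fin.
rewrite (_ : _ @^-1` _ = `]a - r, b - r]%classic); last first.
  by apply/seteqP; split => x /=; rewrite !in_itv/= ltrBlDl lerBrDl.
by rewrite lebesgue_measure_itv/= lte_fin ltrD2r -!EFinB opprB addrA subrK.
Qed.

Lemma Rintegral_shift (r : R) (D : set R) f :
  measurable D -> measurable_fun D f ->
  \int[mu]_(s in (fun s => (r + s)%R) @^-1` D) f (r + s)%R = \int[mu]_(s in D) f s.
Proof.
move=> mD mf; rewrite /Rintegral; congr fine.
rewrite [LHS]integralE [RHS]integralE.
have mf' : measurable_fun D (EFin \o f) by exact/measurable_EFinP.
rewrite -(@integral_shift r D (fun s => ((EFin \o f)^\+ s)%E))//; last exact: measurable_funepos.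
rewrite -(@integral_shift r D (fun s => ((EFin \o f)^\- s)%E))//; last exact: measurable_funeneg.
by congr (_ - _)%E; apply: eq_integral => s _; rewrite ?funeposE ?funenegE.
Qed.

Lemma integral_expR_0t K t : 0 <= t ->
  (\int[mu]_(s in `[0%R, t]) (K * expR (- (K * s)))%:E = (1 - expR (- (K * t)))%:E)%E.
Proof.
rewrite le_eqVlt => /predU1P[<-|t0].
  by rewrite set_itv1 integral_set1 mulr0 oppr0 expR0 subrr.
have := @exponential_prob_itv0c R K t t0.
rewrite /exponential_prob -EFinB mulNr => <-.
apply: eq_integral => s; rewrite inE/= in_itv/= => /andP[s0 _].
by rewrite exponential_pdfE // mulNr.
Qed.

Lemma mu_itv a b : (mu `[a, b] < +oo)%E.
Proof. by rewrite lebesgue_measure_itv/=; case: ifP => _; rewrite ?ltry// -EFinB ltry. Qed.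

Lemma measurable_expN K (D : set R) : measurable_fun D (fun s : R => expR (- (K * s))).
Proof.
apply: measurable_funTS; apply: measurableT_comp; first exact: measurable_expR.
by apply: measurableT_comp => //; apply: measurable_funM.
Qed.

Lemma triangle_integral K M t k : 0 <= K -> 0 <= t ->
  measurable_fun [set: R] k -> (forall s, `|k s| <= M) ->
  \int[mu]_(s in `[0%R, t]) ((K * expR (- (K * s))) * \int[mu]_(v in `[s, t]) k v) =
  \int[mu]_(v in `[0%R, t]) (k v * (1 - expR (- (K * v)))).
Proof.
move=> K0 t0 mk kM.
have M0 : 0 <= M by apply: le_trans (kM 0).
have ik (D : set R) : measurable D -> (mu D < +oo)%E -> mu.-integrable D (EFin \o k).
  move=> mD Dfin; apply: (bounded_integrable (M := M)) => //; exact: measurable_funTS.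
(* the double integral over the triangle 0 <= s <= v <= t *)
pose F (z : R * R) : R := (K * expR (- (K * z.1))) * k z.2 *
   \1_[set z : R * R | 0 <= z.1 /\ z.1 <= z.2 /\ z.2 <= t] z.
have mT : measurable [set z : R * R | 0 <= z.1 /\ z.1 <= z.2 /\ z.2 <= t].
  have -> : [set z : R * R | 0 <= z.1 /\ z.1 <= z.2 /\ z.2 <= t] =
    (fst @^-1` `[0%R, +oo[%classic) `&` ((fun z => z.2 - z.1) @^-1` `[0%R, +oo[%classic) `&`
     (snd @^-1` `]-oo, t]%classic).
    apply/seteqP; split => z /=; rewrite !in_itv/= !andbT subr_ge0.
      by move=> [? [? ?]].
    by move=> [[? ?] ?].
  apply: measurableI; first apply: measurableI.
  - by rewrite -[X in measurable X]setTI; exact: measurable_fst.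
  - rewrite -[X in measurable X]setTI.
    have h : measurable_fun setT (fun z : R * R => z.2 - z.1) by apply: measurable_funB.
    exact: h.
  - by rewrite -[X in measurable X]setTI; exact: measurable_snd.
have FE s v : F (s, v) = ((fun s => K * expR (- (K * s))) \_ `[0%R, t]) s *
                         (k \_ `[s, t]) v.
  rewrite /F /= indicE !patchE /=.
  case: (boolP (s \in `[0%R, t]%classic)) => hs; last first.
    rewrite mul0r (_ : _ \in _ = false) ?mulr0//; apply/negbTE.
    apply: contra hs; rewrite !inE/= in_itv/= => -[s0 [sv vt]].
    by rewrite s0 (le_trans sv).
  case: (boolP (v \in `[s, t]%classic)) => hv; last first.
    rewrite mulr0 (_ : _ \in _ = false) ?mulr0//; apply/negbTE.
    by apply: contra hv; rewrite !inE/= in_itv/= => -[s0 [sv vt]]; rewrite sv.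
  rewrite (_ : _ \in _ = true) ?mulr1//; move: hs hv; rewrite !inE/= !in_itv/=.
  by move=> /andP[? ?] /andP[? ?]; apply: mem_set.
have lhs : (\int[mu]_x \int[mu]_y0 (EFin \o F) (x, y0) =
   \int[mu]_(s in `[0%R, t]) ((K * expR (- (K * s))) * \int[mu]_(v in `[s, t]) k v)%:E)%E.
  rewrite [RHS]integral_mkcond; apply: eq_integral => s _; rewrite patchE /=.
  under eq_integral do rewrite FE EFinM.
  rewrite integralZl//; last first.
    rewrite (_ : (fun x => _) = (EFin \o k) \_ `[s, t]); last by rewrite restrict_EFin.
    apply: (proj1 (integrable_mkcond _ _)) => //.
    apply: ik => //; exact: mu_itv.
  rewrite patchE; case: ifPn => hs; last by rewrite mul0e.
  rewrite [RHS]EFinM; congr (_ * _)%E.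
  rewrite /Rintegral fineK; last by apply: integrable_fin_num => //; apply: ik => //; exact: mu_itv.
  by rewrite [RHS]integral_mkcond; apply: eq_integral => v _; rewrite !patchE; case: ifP.
have rhs : (\int[mu]_y0 \int[mu]_x (EFin \o F) (x, y0) =
   \int[mu]_(v in `[0%R, t]) (k v * (1 - expR (- (K * v))))%:E)%E.
  rewrite [RHS]integral_mkcond; apply: eq_integral => v _; rewrite patchE /=.
  case: ifPn => hv; last first.
    apply: integral0_eq => s _; rewrite FE !patchE.
    case: ifPn => hs; last by rewrite mul0r.
    rewrite memNset ?mulr0//; apply: contra_not (elimN idP hv).
    rewrite inE/= !in_itv/=  => /andP[sv ->]; rewrite andbT.
    by move: hs; rewrite inE/= in_itv/= => /andP[s0 _]; exact: le_trans sv.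
  move: hv; rewrite inE/= in_itv/= => /andP[v0 vt].
  rewrite EFinM -integral_expR_0t// -integralZl//; last first.
    apply: (bounded_integrable (M := `|K|)) => //; first exact: mu_itv.
      by apply: measurable_funM => //; exact: measurable_expN.
    move=> s; rewrite /= in_itv/= => /andP[s0 _]; rewrite normrM ler_piMr//.
    by rewrite ger0_norm ?expR_ge0// expR_le1 oppr_le0 mulr_ge0.
  rewrite [RHS]integral_mkcond; apply: eq_integral => s _; rewrite !patchE FE.
  rewrite !patchE /=; case: ifPn => hs.
    case: ifPn => hsv.
      rewrite mem_set/= ?EFinM 1?muleC//.
      by move: hs hsv; rewrite !inE/= !in_itv/= => /andP[a1 _] /andP[a2 _]; apply/andP; split.
    rewrite memNset/= ?mulr0//; apply: contra_not (elimN idP hsv).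
    by rewrite inE/= !in_itv/= => /andP[s0 ->].
  rewrite mul0r memNset//; apply: contra_not (elimN idP hs).
  by rewrite inE/= !in_itv/= => /andP[-> sv]; exact: le_trans vt.
have mF : measurable_fun setT (EFin \o F).
  apply/measurable_EFinP; apply: measurable_funM; last exact: measurable_indic.
  apply: measurable_funM; last exact: measurableT_comp.
  apply: measurable_funM => //.
  by apply: (@measurableT_comp _ _ _ _ _ _ (fun s : R => expR (- (K * s)))) => //; exact: measurable_expN.
have iF : (mu \x mu)%E.-integrable setT (EFin \o F).
  apply/integrable12ltyP => //=.
  apply: (@le_lt_trans _ _ (\int[mu]_(x in `[0%R, t]) (cst (K * M * t)%:E x))%E).
    rewrite [leRHS]integral_mkcond; apply: ge0_le_integral => //.
    - by move=> x _; apply: integral_ge0.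
    - apply: (@measurable_fun_fubini_tonelli_F _ _ _ _ R mu (abse \o (EFin \o F))) => //.
      by apply: measurableT_comp => //.
      by move=> x; exact: abse_ge0.
    - by apply/(measurable_restrictT _ _).1 => //; exact: measurable_cst.
    - move=> x _; rewrite patchE; case: ifPn => hx; last first.
        rewrite le_eqVlt; apply/orP; left; apply/eqP; apply: integral0_eq => v _.
        by rewrite FE patchE (negbTE hx) mul0r normr0.
      apply: (@le_trans _ _ (\int[mu]_(v in `[0%R, t]) (cst (K * M)%:E v))%E); last first.
        rewrite integral_cst//= lebesgue_measure_itv/= lte_fin; case: ifP => [|] h.
          by rewrite oppr0 adde0.
        by rewrite mule0 lee_fin !mulr_ge0.
      rewrite [leRHS]integral_mkcond; apply: ge0_le_integral => //.
      - by do 2 apply: measurableT_comp => //;  apply: (@measurableT_comp _ _ _ _ _ _ F) => //; exact/measurable_EFinP.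
      - by apply/(measurable_restrictT _ _).1 => //; exact: measurable_cst.
      - move=> v _; rewrite FE patchE hx !patchE.
        have [hv|hv] := boolP (v \in `[x, t]%classic); last first.
          by rewrite mulr0 normr0; case: ifP => // _; rewrite lee_fin mulr_ge0.
        rewrite mem_set/=; last first.
          move: hv hx; rewrite !inE/= !in_itv/= => /andP[xv vt] /andP[x0 _].
          by apply/andP; split; [exact: le_trans xv|exact: vt].
        rewrite lee_fin !normrM (ger0_norm K0) ger0_norm ?expR_ge0//.
        rewrite ler_pM ?mulr_ge0 ?expR_ge0// ler_piMr//.
        rewrite expR_le1 oppr_le0 mulr_ge0//.
        by move: hx; rewrite inE/= in_itv/= => /andP[].
  rewrite integral_cst//= lebesgue_measure_itv/= lte_fin.
  by case: ifP => h; rewrite ?mule0 ?ltry// oppr0 adde0 -EFinM ltry.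
by have := Fubini iF; rewrite lhs rhs /Rintegral => ->.
Qed.

(** Variation of constants for a backward equation in integral form. As k is
    only measurable, y cannot be differentiated; instead the equation is
    integrated against K e^{-Ks}, and the two time integrals are exchanged. *)
Lemma duhamel K M t y k (ye : R) : 0 <= K -> 0 <= t ->
  measurable_fun [set: R] k -> (forall s, `|k s| <= M) ->
  measurable_fun `[0%R, t] y ->
  (forall r, 0 <= r <= t -> y r = ye + \int[mu]_(s in `[r, t]) k s) ->
  y 0 = expR (- (K * t)) * ye
        + \int[mu]_(s in `[0%R, t]) (expR (- (K * s)) * (k s + K * y s)).
Proof.
move=> K0 t0 mk kM my yE.
have M0 : 0 <= M by apply: le_trans (kM 0).
have ik (D : set R) : measurable D -> (mu D < +oo)%E -> mu.-integrable D (EFin \o k).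
  move=> mD Dfin; apply: (bounded_integrable (M := M)) => //; exact: measurable_funTS.
have iE (L : R) : mu.-integrable `[0%R, t] (EFin \o (fun s => L * expR (- (K * s)))).
  apply: (bounded_integrable (M := `|L|)) => //; first exact: mu_itv.
    by apply: measurable_funM => //; exact: measurable_expN.
  move=> s; rewrite /= in_itv/= => /andP[s0 _]; rewrite normrM ler_piMr//.
  by rewrite ger0_norm ?expR_ge0// expR_le1 oppr_le0 mulr_ge0.
pose Iv (g : R -> R) := \int[mu]_(s in `[0%R, t]) g s.
have fub' : Iv (fun s => (K * expR (- (K * s))) * \int[mu]_(v in `[s, t]) k v) =
            Iv (fun v => k v * (1 - expR (- (K * v)))) by exact: triangle_integral kM.
have i1 : mu.-integrable `[0%R, t] (EFin \o (fun s => k s * expR (- (K * s)))).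
  apply: (bounded_integrable (M := M)) => //; first exact: mu_itv.
    by apply: measurable_funM; [exact: measurable_funTS|exact: measurable_expN].
  move=> s; rewrite /= in_itv/= => /andP[s0 _]; rewrite normrM -[leRHS]mulr1 ler_pM//.
  by rewrite ger0_norm ?expR_ge0// expR_le1 oppr_le0 mulr_ge0.
have yb s : s \in `[0%R, t] -> `|y s| <= `|ye| + M * t.
  rewrite in_itv/= => /andP[s0 st]; rewrite yE ?s0//.
  apply: le_trans (ler_normD _ _) _; rewrite lerD2l.
  apply: le_trans (le_normr_Rintegral _ _) _ => //; first by apply: ik => //; exact: mu_itv.
  apply: (@le_trans _ _ (\int[mu]_(s in `[s, t]) (cst M) s)).
    apply: le_Rintegral => //.
    - by apply: integrable_norm; apply: ik => //; exact: mu_itv.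
    - by apply: (bounded_integrable (M := M)) => //; [exact: mu_itv|move=> ? _ /=; rewrite ger0_norm].
  rewrite Rintegral_cst; last exact: measurable_itv.
  rewrite ler_wpM2l ?M0//.
  have E : fine (mu `[s, t]) = t - s.
    by rewrite lebesgue_measure_itv/= lte_fin; case: ifP => /= h //;
      move: st; rewrite le_eqVlt h orbF => /eqP ->; rewrite subrr.
  apply: (@le_trans _ _ (t - s)); last by rewrite lerBlDr lerDl.
  by rewrite le_eqVlt; apply/orP; left; apply/eqP; exact: E.
have i2 : mu.-integrable `[0%R, t] (EFin \o (fun s => (K * expR (- (K * s))) * y s)).
  apply: (bounded_integrable (M := K * (`|ye| + M * t))) => //; first exact: mu_itv.
    by apply: measurable_funM => //; apply: measurable_funM => //; exact: measurable_expN.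
  move=> s hs; rewrite normrM ler_pM//; last exact: yb.
  move: hs; rewrite /= in_itv/= => /andP[s0 _].
  rewrite normrM (ger0_norm K0) ler_piMr//.
  by rewrite ger0_norm ?expR_ge0// expR_le1 oppr_le0 mulr_ge0.
have i3 := iE (ye * K).
transitivity (expR (- (K * t)) * ye + (Iv (fun s => k s * expR (- (K * s)))
   + Iv (fun s => (K * expR (- (K * s))) * y s))); last first.
  congr (_ + _); rewrite /Iv -RintegralD//; apply: eq_Rintegral => s _; ring.
have -> : Iv (fun s => K * expR (- (K * s)) * y s) =
   Iv (fun s => ye * K * expR (- (K * s))) + Iv (fun v => k v * (1 - expR (- (K * v)))).
  rewrite -fub'.
  have -> : Iv (fun s => K * expR (- (K * s)) * \int[mu]_(v in `[s, t]) k v) =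
       Iv (fun s => (K * expR (- (K * s))) * y s - ye * K * expR (- (K * s))).
    apply: eq_Rintegral => s; rewrite inE/= in_itv/= => hs; rewrite yE//; ring.
  rewrite /Iv RintegralB//; ring.
have -> : Iv (fun s => ye * K * expR (- (K * s))) = ye * (1 - expR (- (K * t))).
  rewrite -[RHS]/(fine (ye * (1 - expR (- (K * t))))%:E) EFinM -integral_expR_0t//.
  rewrite /Iv /Rintegral -integralZl//; last exact: (iE K).
  by congr fine; apply: eq_integral => s _; rewrite -EFinM; congr EFin; ring.
have -> : Iv (fun v => k v * (1 - expR (- (K * v)))) = Iv k - Iv (fun s => k s * expR (- (K * s))).
  rewrite /Iv -RintegralB//; last by apply: ik => //; exact: mu_itv.
  by apply: eq_Rintegral => s _; ring.
rewrite yE ?lexx//= -/(Iv k); ring.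
Qed.

End Calculus.

(** * Offspring generating functions *)

Lemma cvg_nneseries_EFin (R : realType) (a : nat -> R) (l : R) :
  (forall i, 0 <= a i) -> (\sum_(i <oo) (a i)%:E = l%:E)%E ->
  series a @ \oo --> l.
Proof.
move=> a0 al.
have h : (fun n => \sum_(0 <= i < n) (a i)%:E)%E @ \oo --> l%:E.
  rewrite -al; apply: (@is_cvg_nneseries R (EFin \o a) xpredT 0%N) => i _ _.
  by rewrite lee_fin.
rewrite (_ : series a = fun n => fine (\sum_(0 <= i < n) (a i)%:E)%E).
  exact: fine_cvg h.
by apply/funext => n; rewrite sumEFin.
Qed.

Lemma measurable_fun_pair_on d (T : measurableType d) (R : realType) (D : set T)
    (f g : T -> R) : measurable D -> measurable_fun D f -> measurable_fun D g ->
  measurable_fun D (fun x => (f x, g x)).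
Proof.
move=> mD /(measurable_restrictT _ mD) mf /(measurable_restrictT _ mD) mg.
have h : measurable_fun D (fun x => ((f \_ D) x, (g \_ D) x)).
  by apply: measurable_funTS; exact: measurable_fun_pair.
by apply: eq_measurable_fun h => x xD; rewrite !patchE xD.
Qed.

Section GeneratingFunction.
Variables (R : realType) (p : R -> nat -> R).
Hypothesis hp : offspring_law p.
Implicit Types (x z d : R) (a : nat -> R).

Definition genf x z : R := fine (gen_fun p x z).
Definition gmean x : R := fine (gen_mean p x).

Let p_ge0 x i : 0 <= x -> 0 <= p x i.
Proof. by case: hp => + _ _ _; apply. Qed.

Lemma gmeanE x : 0 <= x -> gen_mean p x = (gmean x)%:E.
Proof.
move=> x0; rewrite fineK// ge0_fin_numE; last first.
  by apply: nneseries_ge0 => i _ _; rewrite lee_fin mulr_ge0// p_ge0.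
case: hp => _ _ _; apply: le_lt_trans; apply: ereal_sup_ubound.
by exists x.
Qed.

Lemma gmean_ge0 x : 0 <= x -> 0 <= gmean x.
Proof.
move=> x0; apply: fine_ge0; apply: nneseries_ge0 => i _ _.
by rewrite lee_fin mulr_ge0// p_ge0.
Qed.

Lemma gen_funE x z : 0 <= x -> 0 <= z <= 1 -> gen_fun p x z = (genf x z)%:E.
Proof.
move=> x0 /andP[z0 z1]; rewrite fineK// ge0_fin_numE; last first.
  by apply: nneseries_ge0 => i _ _; rewrite lee_fin mulr_ge0 ?exprn_ge0// p_ge0.
apply: (@le_lt_trans _ _ (\sum_(i <oo) (p x i)%:E)%E); last first.
  by case: hp => _ -> // _ _; rewrite ltry.
apply: lee_nneseries => i _; first by rewrite lee_fin mulr_ge0 ?exprn_ge0// p_ge0.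
by rewrite lee_fin ler_piMr ?p_ge0// exprn_ile1.
Qed.

Lemma genf_cvg x z : 0 <= x -> 0 <= z <= 1 ->
  series (fun i => p x i * z ^+ i) @ \oo --> genf x z.
Proof.
move=> x0 /[dup] hz /andP[z0 z1]; apply: cvg_nneseries_EFin.
  by move=> i; rewrite mulr_ge0 ?exprn_ge0// p_ge0.
exact: gen_funE.
Qed.

Lemma gmean_series x n : 0 <= x -> series (fun i => i%:R * p x i) n <= gmean x.
Proof.
move=> x0; have t0 i : 0 <= i%:R * p x i by rewrite mulr_ge0// p_ge0.
have h := cvg_nneseries_EFin t0 (gmeanE x0).
rewrite -(cvg_lim _ h)//; apply: nondecreasing_cvgn_le.
  by apply/nondecreasing_seqP => k; rewrite seriesSr lerDl.
by apply/cvg_ex; exists (gmean x).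
Qed.

Lemma genf1 x : 0 <= x -> genf x 1 = 1.
Proof.
move=> x0; rewrite /genf /gen_fun; under eq_eseriesr do rewrite expr1n mulr1.
by case: hp => _ -> // _ _.
Qed.

Lemma expr_lip (z z' : R) i : 0 <= z <= 1 -> 0 <= z' <= 1 ->
  `|z ^+ i - z' ^+ i| <= i%:R * `|z - z'|.
Proof.
move=> /andP[z0 z1] /andP[z'0 z'1]; elim: i => [|i IHi].
  by rewrite !expr0 subrr normr0 mul0r.
have -> : z ^+ i.+1 - z' ^+ i.+1 = z * (z ^+ i - z' ^+ i) + (z - z') * z' ^+ i.
  by rewrite !exprS; ring.
apply: le_trans (ler_normD _ _) _; rewrite -natr1 [leRHS]mulrDl mul1r !normrM.
apply: lerD.
  by apply: le_trans IHi; rewrite ler_piMl// ger0_norm.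
by rewrite ler_piMr// ger0_norm ?exprn_ge0// exprn_ile1.
Qed.

Lemma genf_lip x z z' : 0 <= x -> 0 <= z <= 1 -> 0 <= z' <= 1 ->
  `|genf x z - genf x z'| <= gmean x * `|z - z'|.
Proof.
move=> x0 hz hz'.
have h' : (fun n => `|series (fun i => p x i * z ^+ i) n - series (fun i => p x i * z' ^+ i) n|)
    @ \oo --> `|genf x z - genf x z'|.
  by apply: cvg_norm; apply: cvgB; exact: genf_cvg.
rewrite -(cvg_lim _ h')//; apply: limr_le; first by apply/cvg_ex; eexists; exact: h'.
apply: nearW => n /=.
rewrite /series /= -sumrB; apply: le_trans (ler_norm_sum _ _ _) _.
apply: (@le_trans _ _ (series (fun i => i%:R * p x i) n * `|z - z'|)); last first.
  by rewrite ler_wpM2r// gmean_series.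
rewrite /series /= mulr_suml; apply: ler_sum => i _.
rewrite -mulrBr normrM (ger0_norm (p_ge0 _ _))//.
by rewrite (mulrC i%:R) -mulrA ler_wpM2l ?p_ge0// expr_lip.
Qed.

Lemma genf_ge0 x z : 0 <= x -> 0 <= z <= 1 -> 0 <= genf x z.
Proof.
move=> x0 /andP[z0 z1]; apply: fine_ge0; apply: nneseries_ge0 => i _ _.
by rewrite lee_fin mulr_ge0 ?exprn_ge0// p_ge0.
Qed.

Lemma genf_le1 x z : 0 <= x -> 0 <= z <= 1 -> genf x z <= 1.
Proof.
move=> x0 hz; have h := genf_cvg x0 hz.
have h1 : series (fun i => p x i * 1 ^+ i) @ \oo --> genf x 1.
  by apply: genf_cvg => //; rewrite ler01 lexx.
rewrite -(genf1 x0) -(cvg_lim _ h)// -(cvg_lim _ h1)//.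
apply: ler_lim; [by apply/cvg_ex; eexists; exact: h|by apply/cvg_ex; eexists; exact: h1|].
apply: nearW => n; apply: ler_sum => i _; case/andP: hz => z0 z1.
by rewrite ler_wpM2l ?p_ge0// expr1n exprn_ile1.
Qed.

Lemma measurable_genf (D : set R) (X Z : R -> R) :
  measurable D -> measurable_fun D X -> measurable_fun D Z ->
  (forall s, D s -> 0 <= X s) -> (forall s, D s -> 0 <= Z s <= 1) ->
  measurable_fun D (fun s => genf (X s) (Z s)).
Proof.
move=> mD mX mZ X0 Z01.
case: hp => _ _ mg _.
have mc : measurable_fun D ((fun xz : R * R => gen_fun p xz.1 xz.2) \o (fun s => (X s, Z s))).
  apply: (measurable_comp _ _ mg); last exact: measurable_fun_pair_on.
    apply: measurableX => //.
    rewrite (_ : Rplus R = `[0, +oo[%classic)//.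
    by apply/seteqP; split => x; rewrite /Rplus/= in_itv/= andbT.
  by move=> _ [s Ds <-]; split=> /=; [exact: X0|rewrite in_itv/=; exact: Z01].
exact: measurableT_comp.
Qed.

(** The bound for powers, averaged over the offspring law; the resulting
    constant gmean x is the quantity that subcriticality controls. *)
Lemma fdiff_genf_lower x n N a d : 0 <= x -> 0 <= d ->
  (forall i, (i <= N)%N -> 0 <= a i <= 1) ->
  (forall k i, (k <= n)%N -> (i + k <= N)%N -> 0 <= fdiff k a i) ->
  (forall i, (i + n.+1 <= N)%N -> - d <= fdiff n.+1 a i) ->
  forall i, (i + n.+1 <= N)%N ->
  - (gmean x * d) <= fdiff n.+1 (fun j => genf x (a j)) i.
Proof.
move=> x0 d0 a01 da hd i iN.
have h : (fun M => fdiff n.+1 (fun j => series (fun k => p x k * a j ^+ k) M) i)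
    @ \oo --> fdiff n.+1 (fun j => genf x (a j)) i.
  by apply: fdiff_cvg => j hj; apply: genf_cvg => //; apply: a01; lia.
rewrite -(cvg_lim _ h)//; apply: limr_ge; first by apply/cvg_ex; eexists; exact: h.
apply: nearW => M.
rewrite (@eq_fdiff _ _ _ (fun j => \sum_(k < M) p x k * a j ^+ k)); last first.
  by move=> j _; rewrite /series /= big_mkord.
rewrite (fdiff_sum n.+1 (fun k j => p x k * a j ^+ k)).
apply: (@le_trans _ _ (- (series (fun k => k%:R * p x k) M * d))).
  by rewrite lerN2 ler_wpM2r// gmean_series.
have -> : series (fun k => k%:R * p x k) M = \sum_(k < M) k%:R * p x k.
  by rewrite /series /= big_mkord.
rewrite mulr_suml -sumrN; apply: ler_sum => k _.
rewrite fdiffZ (mulrC k%:R) -mulrA -mulrN ler_wpM2l ?p_ge0//.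
exact: (@fdiffX_lower _ n N).
Qed.

End GeneratingFunction.

Section Contraction.
Variables (R : realType) (T : Type) (A : set T).

(** Takes the place of Gronwall's lemma: signs and bounds are propagated along
    the branching equation on the whole half-line at once, because the
    equation contracts by a factor that does not depend on the time horizon.
    *)
Lemma contraction_le0 (q : T -> R) (rho D : R) : 0 <= rho < 1 ->
  (forall x, A x -> q x <= D) ->
  (forall d, 0 <= d -> (forall x, A x -> q x <= d) ->
     forall x, A x -> q x <= rho * d) ->
  forall x, A x -> q x <= 0.
Proof.
move=> /andP[r0 r1] hD hc x Ax.
have D0 : 0 <= `|D| by [].
have h n : 0 <= rho ^+ n * `|D| /\ forall x, A x -> q x <= rho ^+ n * `|D|.
  elim: n => [|n [IH0 IHn]].
    by rewrite mul1r; split => // y Ay; exact: le_trans (hD _ Ay) (ler_norm _).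
  by split => [|y Ay]; rewrite ?mulr_ge0 ?exprn_ge0// exprS -mulrA; exact: hc.
have lim : (fun n => rho ^+ n * `|D|) @ \oo --> (0 : R).
  rewrite -[X in _ --> X](mul0r `|D|); apply: cvgMl.
  by apply: cvg_expr; rewrite ger0_norm.
rewrite -(cvg_lim _ lim)//; apply: limr_ge; first by apply/cvg_ex; eexists; exact: lim.
by apply: nearW => n; have [_] := h n; apply.
Qed.

End Contraction.

(** * The branching equation *)

(** Here c is a rate of decay of the mean number of descendants and K a bound
    of the branching rate. The strict inequality c < K makes 1 - c/K a
    contraction factor. *)
Record subcritical_branching (R : realType) (alpha : R -> R) (p : R -> nat -> R)
    (K c : R) : Prop := SubcriticalBranching {
  sb_measurable : measurable_fun (Rplus R) alpha ;
  sb_offspring : offspring_law p ;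
  sb_rate_gt0 : 0 < c ;
  sb_rate_lt : c < K ;
  sb_ge0 : forall y, 0 <= y -> 0 <= alpha y ;
  sb_leK : forall y, 0 <= y -> alpha y <= K ;
  sb_subcritical : forall y, 0 <= y -> alpha y * gmean p y <= alpha y - c }.

Section BranchingEquation.
Variables (R : realType) (alpha : R -> R) (p : R -> nat -> R) (K c : R).
Notation mu := (@lebesgue_measure R).
Hypothesis H : subcritical_branching alpha p K c.
Let malpha := sb_measurable H.
Let hp := sb_offspring H.
Let c_gt0 := sb_rate_gt0 H.
Let cK := sb_rate_lt H.
Let alpha_ge0 := sb_ge0 H.
Let alphaK := sb_leK H.
Let subcritical := sb_subcritical H.
Implicit Types (phi : R -> R -> R) (F q : R -> R) (t x s A B d : R).

Let K_gt0 : 0 < K. Proof. exact: lt_trans cK. Qed.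

Definition unit_valued phi :=
  measurable_fun (Rplus R `*` Rplus R) (fun tx : R * R => phi tx.1 tx.2) /\
  forall t x, 0 <= t -> 0 <= x -> 0 <= phi t x <= 1.

Definition branch_rate phi t x s :=
  alpha (x + s) * (genf p (x + s) (phi (t - s) 0) - phi (t - s) (x + s)).

(** Uniformization: events occur at the constant rate K, and an event at age y
    is a branching with probability alpha y / K, and fictitious otherwise.
    Both weights are nonnegative, so the equation in this form preserves
    inequalities. *)
Definition mild_rate phi t x s :=
  alpha (x + s) * genf p (x + s) (phi (t - s) 0) +
  (K - alpha (x + s)) * phi (t - s) (x + s).

Definition branching_eq F phi := forall t x, 0 <= t -> 0 <= x ->
  phi t x = F (x + t) + \int[mu]_(s in `[0%R, t]) branch_rate phi t x s.

Definition mild_eq F phi := forall t x, 0 <= t -> 0 <= x ->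
  phi t x = expR (- (K * t)) * F (x + t) +
    \int[mu]_(s in `[0%R, t]) (expR (- (K * s)) * mild_rate phi t x s).

Lemma measurable_Rplus : measurable (Rplus R : set R).
Proof.
rewrite (_ : Rplus R = `[0, +oo[%classic)//.
by apply/seteqP; split => x; rewrite /Rplus/= in_itv/= andbT.
Qed.

Section Regularity.
Variables (phi : R -> R -> R) (t x : R).
Hypothesis uphi : unit_valued phi.
Hypotheses (t0 : 0 <= t) (x0 : 0 <= x).

Lemma measurable_along (X : R -> R) : measurable_fun `[0%R, t] X ->
  (forall s, 0 <= s <= t -> 0 <= X s) ->
  measurable_fun `[0%R, t] (fun s => phi (t - s) (X s)).
Proof.
move=> mX X0.
have mc : measurable_fun `[0%R, t] ((fun tx : R * R => phi tx.1 tx.2) \o (fun s => (t - s, X s))).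
  apply: (measurable_comp _ _ uphi.1).
  - by apply: measurableX; exact: measurable_Rplus.
  - move=> _ [s /= + <-]; rewrite in_itv/= => /andP[s0 st]; split => /=.
      by rewrite /Rplus/= subr_ge0.
    by apply: X0; rewrite s0.
  - by apply: measurable_fun_pair_on => //; apply: measurable_funB.
exact: mc.
Qed.

Lemma measurable_char : measurable_fun `[0%R, t] (fun s => phi (t - s) (x + s)).
Proof.
apply: measurable_along; first exact: measurable_funD.
by move=> s /andP[s0 _]; rewrite addr_ge0.
Qed.

Lemma measurable_orig : measurable_fun `[0%R, t] (fun s => phi (t - s) 0).
Proof. by apply: (@measurable_along (cst 0)). Qed.

Lemma measurable_alpha_shift : measurable_fun `[0%R, t] (fun s => alpha (x + s)).
Proof.
have mc : measurable_fun `[0%R, t] (alpha \o (fun s => x + s)).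
  apply: (measurable_comp _ _ malpha); first exact: measurable_Rplus.
    by move=> _ [s /= + <-]; rewrite in_itv/= => /andP[s0 st]; rewrite /Rplus/= addr_ge0.
  exact: measurable_funD.
exact: mc.
Qed.

Lemma phi_char01 s : 0 <= s <= t -> 0 <= phi (t - s) (x + s) <= 1.
Proof. by move=> /andP[s0 st]; apply: uphi.2; rewrite ?subr_ge0// addr_ge0. Qed.

Lemma phi_orig01 s : 0 <= s <= t -> 0 <= phi (t - s) 0 <= 1.
Proof. by move=> /andP[s0 st]; apply: uphi.2; rewrite ?subr_ge0. Qed.

Lemma measurable_genf_orig :
  measurable_fun `[0%R, t] (fun s => genf p (x + s) (phi (t - s) 0)).
Proof.
apply: measurable_genf => //.
- exact: measurable_funD.
- exact: measurable_orig.
- by move=> s; rewrite /= in_itv/= => /andP[s0 _]; rewrite addr_ge0.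
- by move=> s; rewrite /= in_itv/=; exact: phi_orig01.
Qed.

Lemma measurable_branch_rate : measurable_fun `[0%R, t] (branch_rate phi t x).
Proof.
apply: measurable_funM; first exact: measurable_alpha_shift.
by apply: measurable_funB; [exact: measurable_genf_orig|exact: measurable_char].
Qed.

Lemma measurable_mild_rate : measurable_fun `[0%R, t] (mild_rate phi t x).
Proof.
apply: measurable_funD.
  by apply: measurable_funM; [exact: measurable_alpha_shift|exact: measurable_genf_orig].
apply: measurable_funM; last exact: measurable_char.
by apply: measurable_funB => //; exact: measurable_alpha_shift.
Qed.

Let genf01 s : 0 <= s <= t -> 0 <= genf p (x + s) (phi (t - s) 0) <= 1.
Proof.
move=> hs; have /andP[s0 _] := hs.
by rewrite genf_ge0 ?genf_le1 ?phi_orig01// addr_ge0.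
Qed.

Lemma branch_rate_bound s : 0 <= s <= t -> `|branch_rate phi t x s| <= K.
Proof.
move=> hs; have /andP[s0 _] := hs.
have := genf01 hs; have := phi_char01 hs.
have a0 : 0 <= alpha (x + s) by rewrite alpha_ge0 ?addr_ge0.
have aK : alpha (x + s) <= K by rewrite alphaK ?addr_ge0.
move=> /andP[h1 h2] /andP[h3 h4].
rewrite /branch_rate normrM (ger0_norm a0) -[leRHS]mulr1 ler_pM//.
by rewrite ler_norml; apply/andP; split; lra.
Qed.

Lemma mild_rate_itv s : 0 <= s <= t -> 0 <= mild_rate phi t x s <= K.
Proof.
move=> hs; have /andP[s0 _] := hs.
have := genf01 hs; have := phi_char01 hs.
have a0 : 0 <= alpha (x + s) by rewrite alpha_ge0 ?addr_ge0.
have aK : alpha (x + s) <= K by rewrite alphaK ?addr_ge0.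
move=> /andP[h1 h2] /andP[h3 h4]; rewrite /mild_rate; apply/andP; split; nra.
Qed.

End Regularity.

Lemma integrable_expM t q B : measurable_fun `[0%R, t] q ->
  (forall s, 0 <= s <= t -> `|q s| <= B) ->
  mu.-integrable `[0%R, t] (EFin \o (fun s => expR (- (K * s)) * q s)).
Proof.
move=> mq qB; apply: (bounded_integrable (M := B)) => //; first exact: mu_itv.
  by apply: measurable_funM => //; exact: measurable_expN.
move=> s; rewrite /= in_itv/= => /[dup] hs /andP[s0 st].
rewrite normrM -[leRHS]mul1r ler_pM//; last exact: qB.
by rewrite ger0_norm ?expR_ge0// expR_le1 oppr_le0 mulr_ge0// ltW.
Qed.

Lemma integrable_mild phi t x : unit_valued phi -> 0 <= t -> 0 <= x ->
  mu.-integrable `[0%R, t] (EFin \o (fun s => expR (- (K * s)) * mild_rate phi t x s)).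
Proof.
move=> uphi t0 x0; apply: (@integrable_expM _ _ K); first exact: measurable_mild_rate.
by move=> s hs; have /andP[h1 h2] := mild_rate_itv uphi x0 hs; rewrite ger0_norm.
Qed.

(** Variation of constants along the characteristic line s |-> (t - s, x + s).
    *)
Lemma branching_mild F phi : unit_valued phi -> branching_eq F phi -> mild_eq F phi.
Proof.
move=> uphi eqphi t x t0 x0.
pose k := branch_rate phi t x \_ `[0%R, t].
have kE s : 0 <= s <= t -> k s = branch_rate phi t x s.
  by move=> hs; rewrite /k patchE mem_set//= in_itv.
have := @duhamel R K K t (fun r => phi (t - r) (x + r)) k (F (x + t)) (ltW K_gt0) t0.
rewrite subr0 addr0 => ->.
- congr (_ + _); apply: eq_Rintegral => s; rewrite inE/= in_itv/= => hs.
  by rewrite kE// /branch_rate /mild_rate; congr (_ * _); ring.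
- by apply/(measurable_restrictT _ _).1 => //; exact: measurable_branch_rate.
- move=> s; rewrite /k patchE; case: ifPn => [|_]; last by rewrite normr0 ltW.
  by rewrite inE/= in_itv/= => hs; exact: branch_rate_bound.
- exact: measurable_char.
- move=> r /[dup] hr /andP[r0 rt].
  rewrite eqphi ?subr_ge0 ?addr_ge0// (_ : x + r + (t - r) = x + t); last by ring.
  congr (_ + _).
  have -> : `[0, t - r]%classic = (fun s => (r + s)%R) @^-1` `[r, t]%classic.
    by apply/seteqP; split => s /=; rewrite !in_itv/= lerDl lerBrDl.
  rewrite -(@Rintegral_shift R r `[r, t]%classic k)//; last first.
    apply: (@measurable_funS _ _ _ _ `[0%R, t]) => //.
      by apply: subset_itvr; rewrite bnd_simp.
    apply: (eq_measurable_fun (branch_rate phi t x)); last exact: measurable_branch_rate.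
    by move=> s; rewrite inE/= in_itv/= => hs; rewrite kE.
  apply: eq_Rintegral => s; rewrite inE/= in_itv/= => /andP[h1 h2].
  rewrite kE ?h2 ?(le_trans r0)// /branch_rate !opprD !addrA; congr (_ * (_ - _)).
Qed.

(** The estimate shared by uniqueness, decay and absolute monotonicity.
    Integrated against e^{-Ks}, the factor K - c turns the constant d into at
    most (1 - c/K) d, whereas the profile A e^{-ct} is reproduced up to the
    term that the initial datum contributes. *)
Lemma mild_integral_le t q A B d : 0 <= t -> 0 <= A -> 0 <= d ->
  measurable_fun `[0%R, t] q -> (forall s, 0 <= s <= t -> `|q s| <= B) ->
  (forall s, 0 <= s <= t -> q s <= (K - c) * (A * expR (- (c * (t - s))) + d)) ->
  \int[mu]_(s in `[0%R, t]) (expR (- (K * s)) * q s) <=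
  A * (expR (- (c * t)) - expR (- (K * t))) + (1 - c / K) * d.
Proof.
move=> t0 A0 d0 mq qB qle.
pose L := K - c.
have L0 : 0 < L by rewrite subr_gt0.
pose e1 s := (A * expR (- (c * t))) * (L * expR (- (L * s))).
pose e2 s := (L / K * d) * (K * expR (- (K * s))).
have ie (a b : R) : 0 <= a -> mu.-integrable `[0%R, t] (EFin \o (fun s => b * (a * expR (- (a * s))))).
  move=> a0; apply: (bounded_integrable (M := `|b| * a)) => //; first exact: mu_itv.
    by do 2 apply: measurable_funM => //; exact: measurable_expN.
  move=> s; rewrite /= in_itv/= => /andP[s0 st].
  rewrite !normrM (ger0_norm a0) ler_wpM2l// ler_piMr//.
  by rewrite ger0_norm ?expR_ge0// expR_le1 oppr_le0 mulr_ge0.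
have ie1 : mu.-integrable `[0%R, t] (EFin \o e1) by apply: ie; exact: ltW.
have ie2 : mu.-integrable `[0%R, t] (EFin \o e2) by apply: ie; exact: ltW.
apply: (@le_trans _ _ (\int[mu]_(s in `[0%R, t]) (e1 s + e2 s))).
  apply: le_Rintegral => //; first exact: (@integrable_expM _ _ B).
    by apply: (@eq_integrable _ _ _ mu _ _ ((EFin \o e1) \+ (EFin \o e2))) => //; exact: integrableD.
  move=> s; rewrite /= in_itv/= => hs; have /andP[s0 st] := hs.
  apply: (@le_trans _ _ (expR (- (K * s)) * ((K - c) * (A * expR (- (c * (t - s))) + d)))).
    by rewrite ler_wpM2l ?expR_ge0// qle.
  rewrite /e1 /e2 le_eqVlt; apply/orP; left; apply/eqP.
  have -> : - (c * (t - s)) = - (c * t) + c * s by ring.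
  have -> : - (L * s) = - (K * s) + c * s by rewrite /L; ring.
  rewrite !expRD /L; field; exact: lt0r_neq0.
have hI (a b : R) : 0 <= a ->
    \int[mu]_(s in `[0%R, t]) (b * (a * expR (- (a * s)))) = b * (1 - expR (- (a * t))).
  move=> a0; rewrite RintegralZl//.
    by congr (_ * _); rewrite /Rintegral integral_expR_0t.
  have := @ie a 1 a0; apply: eq_integrable => // s _; rewrite /= mul1r//.
rewrite RintegralD// (hI L _ (ltW L0)) (hI K _ (ltW K_gt0)).
have -> : A * expR (- (c * t)) * (1 - expR (- (L * t))) = A * (expR (- (c * t)) - expR (- (K * t))).
  rewrite (_ : - (K * t) = - (c * t) + - (L * t)); last by rewrite /L; ring.
  by rewrite expRD; ring.
rewrite lerD2l (_ : 1 - c / K = L / K); last by rewrite /L; field; exact: lt0r_neq0.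
rewrite ler_piMr ?gerBl ?expR_ge0// mulr_ge0// divr_ge0//; exact: ltW.
Qed.

Let rho_itv : 0 <= 1 - c / K < 1.
Proof.
by rewrite subr_ge0 ler_pdivrMr// mul1r (ltW cK)/= gtrBl divr_gt0.
Qed.

Lemma mild_lower F phi : unit_valued phi -> mild_eq F phi ->
  forall t x, 0 <= t -> 0 <= x -> expR (- (K * t)) * F (x + t) <= phi t x.
Proof.
move=> uphi eqphi t x t0 x0; rewrite eqphi// lerDl; apply: Rintegral_ge0.
move=> s; rewrite /= in_itv/= => hs; rewrite mulr_ge0 ?expR_ge0//.
by have /andP[] := mild_rate_itv uphi x0 hs.
Qed.

(** With probability e^{-Kt} no event occurs before time t, and the ancestor
    is then still present. This limits the decay from the other side, and is
    the reason why large groups of immigrants stay alive for a time of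
    logarithmic order. *)
Lemma mild_upper F phi : unit_valued phi -> mild_eq F phi ->
  forall t x, 0 <= t -> 0 <= x -> expR (- (K * t)) * (1 - F (x + t)) <= 1 - phi t x.
Proof.
move=> uphi eqphi t x t0 x0; rewrite eqphi//.
have : \int[mu]_(s in `[0%R, t]) (expR (- (K * s)) * mild_rate phi t x s) <=
   \int[mu]_(s in `[0%R, t]) (K * expR (- (K * s))).
  apply: le_Rintegral => //; first exact: integrable_mild.
    have := @integrable_expM t (cst K) K (measurable_cst _) _.
    have h s : 0 <= s <= t -> `|cst K s| <= K by move=> _; rewrite (ger0_norm (ltW K_gt0)).
    by move=> /(_ h); apply: eq_integrable => // s _; rewrite /= mulrC.
  move=> s; rewrite /= in_itv/= => hs; rewrite mulrC ler_wpM2r ?expR_ge0//.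
  by have /andP[] := mild_rate_itv uphi x0 hs.
have -> : \int[mu]_(s in `[0%R, t]) (K * expR (- (K * s))) = 1 - expR (- (K * t)).
  by rewrite /Rintegral integral_expR_0t.
set I := \int[mu]_(_ in _) _ => h; rewrite opprD addrA lerBrDr.
apply: (@le_trans _ _ (expR (- (K * t)) * (1 - F (x + t)) + (1 - expR (- (K * t))))).
  by rewrite lerD2l.
by rewrite le_eqVlt; apply/orP; left; apply/eqP; ring.
Qed.

(** Subcriticality enters here: the weights alpha gmean and K - alpha add up
    to at most K - c. *)
Lemma mild_rateB phi psi t x s d : unit_valued phi -> unit_valued psi ->
  0 <= t -> 0 <= x -> 0 <= s <= t -> 0 <= d ->
  `|phi (t - s) 0 - psi (t - s) 0| <= d ->
  `|phi (t - s) (x + s) - psi (t - s) (x + s)| <= d ->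
  `|mild_rate phi t x s - mild_rate psi t x s| <= (K - c) * d.
Proof.
move=> uphi upsi t0 x0 hs d0 h0 h1; have /andP[s0 st] := hs.
have xs0 : 0 <= x + s by rewrite addr_ge0.
have a0 := alpha_ge0 xs0; have aK := alphaK xs0; have sub := subcritical xs0.
have lip := genf_lip hp xs0 (phi_orig01 uphi hs) (phi_orig01 upsi hs).
rewrite /mild_rate.
set g1 := genf p _ _ in lip *; set g2 := genf p _ _ in lip *.
set f1 := phi _ (x + s) in h1 *; set f2 := psi _ (x + s) in h1 *.
rewrite (_ : _ - _ = alpha (x + s) * (g1 - g2) + (K - alpha (x + s)) * (f1 - f2)); last by ring.
apply: le_trans (ler_normD _ _) _; rewrite !normrM (ger0_norm a0).
rewrite (@ger0_norm _ (K - _)) ?subr_ge0//.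
apply: (@le_trans _ _ (alpha (x + s) * (gmean p (x + s) * d) + (K - alpha (x + s)) * d)).
  apply: lerD; last by rewrite ler_wpM2l ?subr_ge0.
  rewrite ler_wpM2l//; apply: le_trans lip _.
  by rewrite ler_wpM2l// gmean_ge0.
by rewrite mulrA -mulrDl ler_wpM2r//; lra.
Qed.

Lemma mild_unique F phi psi : unit_valued phi -> unit_valued psi ->
  mild_eq F phi -> mild_eq F psi ->
  forall t x, 0 <= t -> 0 <= x -> phi t x = psi t x.
Proof.
move=> uphi upsi ephi epsi t x t0 x0.
suff h : `|phi t x - psi t x| <= 0 by apply/eqP; rewrite -subr_eq0 -normr_le0.
apply: (@contraction_le0 R _ [set z : R * R | 0 <= z.1 /\ 0 <= z.2]
  (fun z => `|phi z.1 z.2 - psi z.1 z.2|) _ 1 rho_itv _ _ (t, x)) => //.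
- move=> [t' x'] /= [t'0 x'0].
  have /andP[h1 h2] := uphi.2 _ _ t'0 x'0; have /andP[h3 h4] := upsi.2 _ _ t'0 x'0.
  by rewrite ler_norml; apply/andP; split; lra.
- move=> {t x t0 x0} d d0 hd [t x] /= [t0 x0].
  have hd' t' x' : 0 <= t' -> 0 <= x' -> `|phi t' x' - psi t' x'| <= d.
    by move=> ? ?; exact: (hd (t', x')).
  have key (f g : R -> R -> R) : unit_valued f -> unit_valued g -> mild_eq F f -> mild_eq F g ->
      (forall t' x', 0 <= t' -> 0 <= x' -> `|f t' x' - g t' x'| <= d) ->
      f t x - g t x <= (1 - c / K) * d.
    move=> uf ug ef eg fg; rewrite ef// eg// opprD addrACA subrr add0r.
    rewrite -RintegralB//; [|exact: integrable_mild..].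
    rewrite (_ : _ * d = 0 * (expR (- (c * t)) - expR (- (K * t))) + (1 - c / K) * d); last by rewrite mul0r add0r.
    rewrite (_ : \int[_]_(_ in _) _ = \int[mu]_(s in `[0%R, t])
        (expR (- (K * s)) * (mild_rate f t x s - mild_rate g t x s))); last first.
      by apply: eq_Rintegral => s _; rewrite mulrBr.
    have b s : 0 <= s <= t -> `|mild_rate f t x s - mild_rate g t x s| <= (K - c) * d.
      move=> /[dup] hs /andP[s0 st]; apply: mild_rateB => //; apply: fg; rewrite ?subr_ge0//.
      by rewrite addr_ge0.
    apply: (@mild_integral_le _ _ _ ((K - c) * d)) => //.
      by apply: measurable_funB; exact: measurable_mild_rate.
    by move=> s hs; rewrite mul0r add0r; apply: le_trans (ler_norm _) _; exact: b.
  rewrite ler_norml lerNl opprB; apply/andP; split; apply: key => //.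
  by move=> t' x' ? ?; rewrite distrC; exact: hd'.
Qed.

(** The mean number of descendants decays like e^{-ct}: the function A e^{-ct}
    is a supersolution of the equation for 1 - phi, and the excess of 1 - phi
    over it is removed by contraction. *)
Lemma mild_decay F phi A : unit_valued phi -> mild_eq F phi -> 0 <= A ->
  (forall x, 0 <= x -> 1 - F x <= A) ->
  forall t x, 0 <= t -> 0 <= x -> 1 - phi t x <= A * expR (- (c * t)).
Proof.
move=> uphi ephi A0 FA t x t0 x0; rewrite -subr_le0.
apply: (@contraction_le0 R _ [set z : R * R | 0 <= z.1 /\ 0 <= z.2]
  (fun z => 1 - phi z.1 z.2 - A * expR (- (c * z.1))) _ 1 rho_itv _ _ (t, x)) => //.
- move=> [t' x'] /= [t'0 x'0].
  have /andP[h1 h2] := uphi.2 _ _ t'0 x'0.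
  by have : 0 <= A * expR (- (c * t')); [rewrite mulr_ge0 ?expR_ge0|lra].
- move=> {t x t0 x0} d d0 hd [t x] /= [t0 x0].
  have hd' t' x' : 0 <= t' -> 0 <= x' -> 1 - phi t' x' <= A * expR (- (c * t')) + d.
    by move=> h1 h2; have := hd (t', x') (conj h1 h2); rewrite /= lerBlDr [d + _]addrC.
  rewrite ephi//.
  have iK : mu.-integrable `[0%R, t] (EFin \o (fun s => expR (- (K * s)) * K)).
    apply: (@integrable_expM t (cst K) K); first exact: measurable_cst.
    by move=> s _; rewrite /= (ger0_norm (ltW K_gt0)).
  have e1 : 1 - expR (- (K * t)) = \int[mu]_(s in `[0%R, t]) (expR (- (K * s)) * K).
    rewrite (@eq_Rintegral _ _ _ mu _ (fun s => K * expR (- (K * s)))); last by move=> s _; rewrite mulrC.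
    by rewrite /Rintegral integral_expR_0t.
  have e2 : 1 - (expR (- (K * t)) * F (x + t) + \int[mu]_(s in `[0, t]) (expR (- (K * s)) * mild_rate phi t x s))
     = expR (- (K * t)) * (1 - F (x + t)) + \int[mu]_(s in `[0%R, t]) (expR (- (K * s)) * (K - mild_rate phi t x s)).
    have -> : \int[mu]_(s in `[0%R, t]) (expR (- (K * s)) * (K - mild_rate phi t x s)) =
       1 - expR (- (K * t)) - \int[mu]_(s in `[0, t]) (expR (- (K * s)) * mild_rate phi t x s).
      rewrite e1 -RintegralB//; last exact: integrable_mild.
      by apply: eq_Rintegral => s _; rewrite mulrBr.
    ring.
  rewrite e2.
  have e3 : expR (- (K * t)) * (1 - F (x + t)) <= A * expR (- (K * t)).
    by rewrite mulrC ler_wpM2r ?expR_ge0// FA// addr_ge0.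
  have : \int[mu]_(s in `[0%R, t]) (expR (- (K * s)) * (K - mild_rate phi t x s)) <=
     A * (expR (- (c * t)) - expR (- (K * t))) + (1 - c / K) * d.
    apply: (@mild_integral_le _ _ _ K) => //.
    - by apply: measurable_funB => //; exact: measurable_mild_rate.
    - move=> s hs; have /andP[h1 h2] := mild_rate_itv uphi x0 hs.
      by rewrite ger0_norm; lra.
    - move=> s hs; have /andP[s0 st] := hs.
      have xs0 : 0 <= x + s by rewrite addr_ge0.
      have a0 := alpha_ge0 xs0; have aK := alphaK xs0; have sub := subcritical xs0.
      have o01 := phi_orig01 uphi hs.
      have lip := genf_lip hp xs0 (_ : 0 <= 1 <= 1) o01.
      have {}lip : 1 - genf p (x + s) (phi (t - s) 0) <= gmean p (x + s) * (1 - phi (t - s) 0).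
        have := lip; rewrite ler01 lexx genf1// => /(_ isT).
        rewrite [X in _ <= _ * X]ger0_norm ?subr_ge0//; last by case/andP: o01.
        by apply: le_trans; exact: ler_norm.
      have B1 := hd' (t - s) 0 _ (lexx _); rewrite subr_ge0 in B1.
      have B2 := hd' (t - s) (x + s) _ xs0; rewrite subr_ge0 in B2.
      have {}B1 := B1 st; have {}B2 := B2 st.
      set E := A * expR (- (c * (t - s))) + d in B1 B2 *.
      have E0 : 0 <= E by rewrite /E addr_ge0 ?mulr_ge0 ?expR_ge0.
      have m0 : 0 <= gmean p (x + s) by exact: gmean_ge0.
      rewrite /mild_rate.
      set g := genf p _ _ in lip *; set f := phi _ (x + s) in B2 *.
      set f0 := phi _ 0 in lip B1 *.
      rewrite (_ : K - _ = alpha (x + s) * (1 - g) + (K - alpha (x + s)) * (1 - f)); last by ring.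
      apply: (@le_trans _ _ (alpha (x + s) * (gmean p (x + s) * E) + (K - alpha (x + s)) * E)).
        apply: lerD; last by rewrite ler_wpM2l ?subr_ge0.
        by rewrite ler_wpM2l//; apply: le_trans lip _; rewrite ler_wpM2l.
      by rewrite mulrA -mulrDl ler_wpM2r//; lra.
  rewrite lerBlDr => h; apply: (@le_trans _ _ (A * expR (- (K * t)) + (A * (expR (- (c * t)) - expR (- (K * t))) + (1 - c / K) * d))).
    exact: lerD.
  by rewrite le_eqVlt; apply/orP; left; apply/eqP; ring.
Qed.

End BranchingEquation.

(** * The cumulant semigroup *)

Section DifferencesOfIntegrals.
Context d (T : measurableType d) (R : realType) (mu : {measure set T -> \bar R}).
Implicit Types (k : nat -> T -> R) (D : set T).

Lemma fdiff_norm_le n (a : nat -> R) i M : (forall j, (i <= j <= i + n)%N -> `|a j| <= M) ->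
  `|fdiff n a i| <= 2 ^+ n * M.
Proof.
elim: n i => [|n IHn] i h /=; first by rewrite mul1r; apply: h; lia.
apply: le_trans (ler_normB _ _) _; rewrite exprS -mulrA mulr2n mulrDl !mul1r.
by apply: lerD; apply: IHn => j hj; apply: h; lia.
Qed.

Lemma measurable_fdiff n k D i :
  (forall j, (i <= j <= i + n)%N -> measurable_fun D (k j)) ->
  measurable_fun D (fun s => fdiff n (k^~ s) i).
Proof.
elim: n i => [|n IHn] i h /=; first by apply: h; lia.
by apply: measurable_funB; apply: IHn => j hj; apply: h; lia.
Qed.

Lemma integrable_fdiff n k D i : measurable D ->
  (forall j, (i <= j <= i + n)%N -> mu.-integrable D (EFin \o k j)) ->
  mu.-integrable D (EFin \o (fun s => fdiff n (k^~ s) i)).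
Proof.
move=> mD; elim: n i => [|n IHn] i h; first by apply: h; lia.
have h1 j : (i <= j <= i.+1)%N -> mu.-integrable D (EFin \o (fun s => fdiff n (k^~ s) j)).
  by move=> hj; apply: IHn => l hl; apply: h; lia.
have h2 : mu.-integrable D ((EFin \o (fun s => fdiff n (k^~ s) i.+1)) \- (EFin \o (fun s => fdiff n (k^~ s) i)))%E.
  by apply: integrableB => //; apply: h1; lia.
apply: eq_integrable h2 => //.
Qed.

Lemma fdiff_Rintegral n k D i : measurable D ->
  (forall j, (i <= j <= i + n)%N -> mu.-integrable D (EFin \o k j)) ->
  fdiff n (fun j => \int[mu]_(s in D) k j s) i =
  \int[mu]_(s in D) fdiff n (k^~ s) i.
Proof.
move=> mD; elim: n i => [|n IHn] i h //=.
rewrite fdiffS !IHn; try by move=> j hj; apply: h; lia.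
by rewrite -RintegralB//; apply: integrable_fdiff => // j hj; apply: h; lia.
Qed.

End DifferencesOfIntegrals.

Section BranchingDifferences.
Variables (R : realType) (alpha : R -> R) (p : R -> nat -> R) (K c : R).
Notation mu := (@lebesgue_measure R).
Hypothesis H : subcritical_branching alpha p K c.
Let hp := sb_offspring H.
Let c_gt0 := sb_rate_gt0 H.
Let cK := sb_rate_lt H.
Let alpha_ge0 := sb_ge0 H.
Let alphaK := sb_leK H.
Let subcritical := sb_subcritical H.

Let K_gt0 : 0 < K. Proof. exact: lt_trans cK. Qed.

(** Absolute monotonicity propagates from the initial datum, by induction on
    the order. Once the differences of order at most n are nonnegative, those
    of order n+1 satisfy the linear inequality of [fdiff_genf_lower], in which
    their negative part is multiplied by the mean offspring number; it
    therefore contracts to 0. *)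
Lemma mild_fdiff N (phi : nat -> R -> R -> R) (F : nat -> R -> R) :
  (forall j, (j <= N)%N -> unit_valued (phi j)) ->
  (forall j, (j <= N)%N -> mild_eq alpha p K (F j) (phi j)) ->
  (forall n i y, (i + n <= N)%N -> 0 <= y -> 0 <= fdiff n (F^~ y) i) ->
  forall n i t x, (i + n <= N)%N -> 0 <= t -> 0 <= x ->
  0 <= fdiff n (fun j => phi j t x) i.
Proof.
move=> uphi ephi hF.
elim/ltn_ind => -[|n] IH i t x iN t0 x0.
  have iN' : (i <= N)%N by lia.
  have [_ h] := uphi i iN'; by have /andP[] := h _ _ t0 x0.
rewrite -oppr_le0.
have rho_itv : 0 <= 1 - c / K < 1.
  by rewrite subr_ge0 ler_pdivrMr// mul1r (ltW cK)/= gtrBl divr_gt0.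
apply: (@contraction_le0 R _ [set z : nat * (R * R) | [/\ (z.1 + n.+1 <= N)%N, 0 <= z.2.1 & 0 <= z.2.2]]
  (fun z => - fdiff n.+1 (fun j => phi j z.2.1 z.2.2) z.1) _ (2 ^+ n.+1 * 1) rho_itv _ _ (i, (t, x))) => //.
  move=> [{}i [{}t {}x]] [/= {}iN {}t0 {}x0].
  apply: le_trans (ler_norm _) _; rewrite normrN; apply: (@fdiff_norm_le _ n.+1) => j hj.
  have jN : (j <= N)%N by lia.
  have [_ h] := uphi j jN; have /andP[h1 h2] := h _ _ t0 x0.
  by rewrite ger0_norm.
move=> d d0 hd [{}i [{}t {}x]] [/= {}iN {}t0 {}x0].
have hd' j t' x' : (j + n.+1 <= N)%N -> 0 <= t' -> 0 <= x' ->
    - d <= fdiff n.+1 (fun j => phi j t' x') j.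
  by move=> h1 h2 h3; rewrite lerNl; apply: (hd (j, (t', x'))).
pose E j s := expR (- (K * s)) * mild_rate alpha p K (phi j) t x s.
have -> : fdiff n.+1 (fun j => phi j t x) i = fdiff n.+1 (fun j =>
     expR (- (K * t)) * F j (x + t) + \int[mu]_(s in `[0%R, t]) E j s) i.
  by apply: eq_fdiff => j hj; apply: ephi => //; lia.
have iE j : (i <= j <= i + n.+1)%N -> mu.-integrable `[0%R, t] (EFin \o E j).
  by move=> hj; apply: (integrable_mild H) => //; apply: uphi; lia.
rewrite fdiffD fdiffZ fdiff_Rintegral// opprD.
have -> : - (\int[mu]_(s in `[0%R, t]) fdiff n.+1 (E^~ s) i) =
   \int[mu]_(s in `[0%R, t]) (expR (- (K * s)) * (- fdiff n.+1 (fun j => mild_rate alpha p K (phi j) t x s) i)).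
  rewrite -mulN1r -RintegralZl//; last exact: integrable_fdiff.
  by apply: eq_Rintegral => s _; rewrite /E fdiffZ; ring.
rewrite -[leRHS]add0r; apply: lerD.
  by rewrite oppr_le0 mulr_ge0 ?expR_ge0// hF// addr_ge0.
rewrite -[leRHS]add0r -[X in _ <= X + _](mul0r (expR (- (c * t)) - expR (- (K * t)))).
have rK j s : (j <= N)%N -> 0 <= s <= t -> `|mild_rate alpha p K (phi j) t x s| <= K.
  move=> jN hs; have /andP[h1 h2] := mild_rate_itv H (uphi j jN) x0 hs.
  by rewrite ger0_norm.
apply: (@mild_integral_le R _ _ K c H _ _ _ (2 ^+ n.+1 * K)) => //.
- apply: measurableT_comp => //; apply: measurable_fdiff => j hj.
  by apply: (measurable_mild_rate H) => //; apply: uphi; lia.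
- by move=> s hs; rewrite normrN; apply: fdiff_norm_le => j hj; apply: (rK j s _ hs); lia.
- move=> s hs; rewrite mul0r add0r lerNl.
  have /andP[s0 st] := hs; have xs0 : 0 <= x + s by rewrite addr_ge0.
  have ts0 : 0 <= t - s by rewrite subr_ge0.
  have a0 := alpha_ge0 xs0; have aK := alphaK xs0; have sub := subcritical xs0.
  rewrite /mild_rate fdiffD !fdiffZ.
  have g : - (gmean p (x + s) * d) <= fdiff n.+1 (fun j => genf p (x + s) (phi j (t - s) 0)) i.
    apply: (@fdiff_genf_lower _ _ hp (x + s) n N) => //.
    - by move=> j jN; apply: (uphi j jN).2.
    - by move=> k j kn jk; apply: IH.
    - by move=> j jn; apply: hd'.
  have h := hd' i (t - s) (x + s) iN ts0 xs0.
  apply: (@le_trans _ _ (alpha (x + s) * - (gmean p (x + s) * d) + (K - alpha (x + s)) * - d)).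
    rewrite mulrN mulrN -opprD lerN2 mulrA -mulrDl ler_wpM2r//; lra.
  by apply: lerD; [exact: ler_wpM2l|apply: ler_wpM2l => //; rewrite subr_ge0].
Qed.

Implicit Types (phi : R -> R -> R) (F f : R -> R) (r s t x z : R).

Lemma integrable_branch_rate phi t x : unit_valued phi -> 0 <= x ->
  mu.-integrable `[0%R, t] (EFin \o branch_rate alpha p phi t x).
Proof.
move=> uphi x0; apply: (bounded_integrable (M := K)) => //; first exact: mu_itv.
  exact: (measurable_branch_rate H).
by move=> s; rewrite /= in_itv/= => hs; apply: (branch_rate_bound H).
Qed.

Lemma unit_valued_shift phi r : 0 <= r -> unit_valued phi ->
  unit_valued (fun t x => phi (t + r) x).
Proof.
move=> r0 uphi; split; last by move=> t' x' t'0 x'0; apply: uphi.2 => //; rewrite addr_ge0.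
have mc : measurable_fun (Rplus R `*` Rplus R)
    ((fun tx : R * R => phi tx.1 tx.2) \o (fun tx : R * R => (tx.1 + r, tx.2))).
  apply: (measurable_comp _ _ uphi.1).
  - by apply: measurableX; exact: measurable_Rplus.
  - by move=> _ [[t' x'] [/= t'0 x'0] <-]; split => //=; rewrite /Rplus/= addr_ge0.
  - apply: measurable_fun_pair_on.
    + by apply: measurableX; exact: measurable_Rplus.
    + by apply: measurable_funD => //; apply: measurable_funTS; exact: measurable_fst.
    + by apply: measurable_funTS; exact: measurable_snd.
exact: mc.
Qed.

(** The flow started afresh at time r, with its current state as the initial
    datum; uniqueness then yields the semigroup property [cumulantD]. *)
Lemma branching_eq_shift F phi r : 0 <= r -> unit_valued phi ->
  branching_eq alpha p F phi -> branching_eq alpha p (phi r) (fun t x => phi (t + r) x).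
Proof.
move=> r0 uphi ephi t x t0 x0.
pose k := branch_rate alpha p phi (t + r) x.
have E1 : phi (t + r) x = F (x + (t + r)) + \int[mu]_(s in `[0%R, t + r]) k s.
  by apply: ephi => //; rewrite addr_ge0.
have E2 : phi r (x + t) = F (x + t + r) + \int[mu]_(s in `[0%R, r]) branch_rate alpha p phi r (x + t) s.
  by apply: ephi => //; rewrite addr_ge0.
have itvS : `[t, t + r]%classic `<=` `[0%R, t + r]%classic.
  by apply: subset_itvr; rewrite bnd_simp.
have E3 : \int[mu]_(s in `[0%R, r]) branch_rate alpha p phi r (x + t) s =
          \int[mu]_(s in `[t, t + r]) k s.
  rewrite -(@Rintegral_shift R t `[t, t + r]%classic k)//; last first.
    by apply: (measurable_funS _ itvS) => //; exact: (measurable_branch_rate H).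
  have -> : (fun s => (t + s)%R) @^-1` `[t, t + r]%classic = `[0, r]%classic.
    by apply/seteqP; split => s /=; rewrite !in_itv/= lerDl lerD2l.
  apply: eq_Rintegral => s _; rewrite /k /branch_rate !addrA.
  by rewrite (_ : t + r - (t + s) = r - s)//; ring.
have E4 : \int[mu]_(s in `[0%R, t]) k s + \int[mu]_(s in `[t, t + r]) k s =
   \int[mu]_(s in `[0%R, t + r]) k s.
  have ib := @integrable_branch_rate phi (t + r) x uphi x0.
  have := @Rintegral_itvB R k (BLeft 0) (BRight (t + r)) t ib.
  rewrite !bnd_simp lerDl => /(_ t0 r0).
  rewrite Rintegral_itv_obnd_cbnd; last first.
    apply: integrableS ib => //; apply: subset_trans itvS.
    by apply: subset_itvr; rewrite bnd_simp.
  by move=> <-; rewrite addrC subrK.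
have E5 : \int[mu]_(s in `[0%R, t]) branch_rate alpha p (fun t x => phi (t + r) x) t x s =
    \int[mu]_(s in `[0%R, t]) k s.
  apply: eq_Rintegral => s _; rewrite /k /branch_rate.
  by rewrite (_ : t + r - s = t - s + r)//; ring.
by rewrite E1 E2 E3 E5 -E4 addrA [in RHS]addrAC [x + (t + r)]addrA.
Qed.

Variable u : R -> (R -> R) -> R -> R.
Hypothesis hu : cumulant_semigroup alpha p u.

(** The Laplace functional of the population at time t issued from one
    ancestor of age x. *)
Definition laplace_flow f t x : R := expR (- u t f x).

Lemma laplace_flow_unit f : Bplus f -> unit_valued (laplace_flow f).
Proof.
move=> /hu[mu0 u0 _]; split.
  by apply: measurableT_comp => //; apply: measurableT_comp.
by move=> t x t0 x0; rewrite expR_ge0 /laplace_flow expR_le1 oppr_le0 u0.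
Qed.

Lemma laplace_flow_branching f : Bplus f ->
  branching_eq alpha p (fun y => expR (- f y)) (laplace_flow f).
Proof.
move=> Bf t x t0 x0; have uf := laplace_flow_unit Bf; have [_ _ /(_ t x t0 x0)] := hu Bf.
have ib := @integrable_branch_rate _ t x uf x0.
have -> : (\int[mu]_(s in `[0%R, t])
          ((alpha (x + s)%R)%:E *
           (gen_fun p (x + s) (expR (- u (t - s)%R f 0%R)) -
            (expR (- u (t - s)%R f (x + s)%R))%:E)) = (\int[mu]_(s in `[0%R, t]) (branch_rate alpha p (laplace_flow f) t x s))%:E)%E.
  rewrite /Rintegral fineK; last exact: integrable_fin_num.
  apply: eq_integral => s; rewrite inE/= in_itv/= => hs; have /andP[s0 st] := hs.
  rewrite gen_funE//; last exact: (phi_orig01 uf hs).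
  by rewrite addr_ge0.
by rewrite -EFinD => -[].
Qed.

Lemma laplace_flow_mild f : Bplus f -> mild_eq alpha p K (fun y => expR (- f y)) (laplace_flow f).
Proof. by move=> Bf; apply: (branching_mild H) => //; [exact: laplace_flow_unit|exact: laplace_flow_branching]. Qed.

Lemma Bplus_cumulant f r : Bplus f -> 0 <= r -> Bplus (u r f).
Proof.
move=> Bf r0; have [mf f0 [M fM]] := Bf; have [mu0 u0 _] := hu Bf; split.
- have mc : measurable_fun (Rplus R) ((fun tx : R * R => u tx.1 f tx.2) \o (fun x => (r, x))).
    apply: (measurable_comp _ _ mu0).
    - by apply: measurableX; exact: measurable_Rplus.
    - by move=> _ [x x0 <-]; split.
    - by apply: measurable_fun_pair_on => //; exact: measurable_Rplus.
  exact: mc.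
- by move=> x x0; apply: u0.
- exists (K * r + M) => x x0.
  have := mild_lower H (laplace_flow_unit Bf) (laplace_flow_mild Bf) r0 x0.
  rewrite /laplace_flow -expRD ler_expR -opprD lerN2 => h; apply: le_trans h _.
  by rewrite lerD2l fM// addr_ge0.
Qed.

Lemma cumulantD f r t x : Bplus f -> 0 <= r -> 0 <= t -> 0 <= x ->
  u (t + r) f x = u t (u r f) x.
Proof.
move=> Bf r0 t0 x0; have Bu := Bplus_cumulant Bf r0.
suff h : laplace_flow f (t + r) x = laplace_flow (u r f) t x.
  by have /expR_inj/oppr_inj := h.
have uf := laplace_flow_unit Bf.
apply: (@mild_unique R alpha p K c H (fun y => laplace_flow f r y)
  (fun t x => laplace_flow f (t + r) x) (laplace_flow (u r f))) => //.
- exact: unit_valued_shift.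
- exact: laplace_flow_unit.
- apply: (branching_mild H); first exact: unit_valued_shift.
  exact: branching_eq_shift (laplace_flow_branching Bf).
- exact: laplace_flow_mild.
Qed.

End BranchingDifferences.

(** * Integer-valued measures are finite sums of point masses *)

Section IntegerValuedMeasures.
Variable R : realType.
Implicit Types (m : {measure set R -> \bar R}) (nu : intmeas R) (x : R) (s : seq R).

Definition integer_valued m := forall A, measurable A -> exists n : nat, m A = n%:R%:E.

(** The masses of shrinking intervals around x converge to that of x, and a
    sequence of natural numbers converging to 0 reaches 0. *)
Lemma null_neighbourhood m x : integer_valued m -> m [set x] = 0%E ->
  exists ab : rat * rat, ratr ab.1 < x < ratr ab.2 /\ m `]ratr ab.1, ratr ab.2[%classic = 0%E.
Proof.
move=> im null.
pose F n : set R := `]x - n.+1%:R^-1, x + n.+1%:R^-1[%classic.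
have mF n : measurable (F n) by exact: measurable_itv.
have capF : \bigcap_n F n = [set x].
  apply/seteqP; split => [y Fy|_ -> n _ /=]; last first.
    by rewrite /F/= in_itv/= ltrBlDr !ltrDl invr_gt0 ltr0Sn.
  apply/eqP; apply/negPn/negP => yx.
  have d0 : 0 < `|y - x| by rewrite normr_gt0 subr_eq0.
  have [n hn] := ltr_add_invr d0; rewrite add0r in hn.
  have := Fy n I; rewrite /F/= in_itv/= => /andP[h1 h2].
  suff : `|y - x| < n.+1%:R^-1 by rewrite ltNge (ltW hn).
  by rewrite ltr_norml; apply/andP; split; [rewrite ltrBrDr addrC|rewrite ltrBlDr addrC].
have cF : m \o F @ \oo --> (0 : \bar R)%E.
  rewrite -null -capF; apply: nonincreasing_cvg_mu.
  - by have [n ->] := im (F 0%N) (mF 0%N); rewrite ltry.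
  - by [].
  - by rewrite capF; exact: measurable_set1.
  - move=> i j ij; apply/subsetPset; apply: subset_itvW.
      by rewrite lerD2l lerN2 lef_pV2 ?posrE// ler_nat ltnS.
    by rewrite lerD2l lef_pV2 ?posrE// ler_nat ltnS.
have [n mFn] : exists n, m (F n) = 0%E.
  have [N _ hN] := cF _ (open_ereal_lt' (lte01 : (0 < 1 :> \bar R)%E)).
  exists N; have [k hk] := im (F N) (mF N).
  by have := hN N (leqnn N); rewrite /= hk lte_fin ltrn1; case: (k).
have e0 : 0 < n.+1%:R^-1 :> R by rewrite invr_gt0.
have /rat_in_itvoo[a] : x - n.+1%:R^-1 < x by rewrite gtrBl.
rewrite in_itv/= => /andP[a1 a2].
have /rat_in_itvoo[b] : x < x + n.+1%:R^-1 by rewrite ltrDl.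
rewrite in_itv/= => /andP[b1 b2].
exists (a, b); rewrite /= a2 b1; split => //.
apply/eqP; rewrite eq_le measure_ge0 andbT -mFn; apply: le_measure; rewrite ?inE//.
by apply: subset_itvW; exact: ltW.
Qed.

(** Without atoms, countably many null intervals with rational endpoints would
    cover the line. *)
Lemma integer_valued_atom m : integer_valued m -> m setT != 0%E ->
  exists x, m [set x] != 0%E.
Proof.
move=> im; apply: contra_neqP => /forallNP noatom.
have null x : m [set x] = 0%E by apply/eqP; have /negP := noatom x; rewrite negbK.
pose F k : set R := if @unpickle (rat * rat)%type k is Some ab then
  if m `]ratr ab.1, ratr ab.2[%classic == 0%E then `]ratr ab.1, ratr ab.2[%classic else set0 else set0.
have FT : \bigcup_k F k = setT.
  apply/seteqP; split => // x _.
  have [ab [xab mab]] := null_neighbourhood im (null x).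
  exists (pickle ab); first exact: I.
  by rewrite /F pickleK mab eqxx /mkset in_itv.
apply: measure_negligible => //; rewrite -FT; apply: negligible_bigcup => k.
rewrite /F; case: unpickle => [ab|]; last exact: negligible_set0.
case: eqP => [h|_]; last exact: negligible_set0.
by apply/negligibleP => //; exact: measurable_itv.
Qed.

(** By induction on the total mass, which decreases when an atom is split off.
    *)
Lemma integer_valued_sum m : integer_valued m ->
  exists s, forall A, measurable A -> m A = (\sum_(x <- s) (\d_x A : \bar R))%E.
Proof.
move=> im; have [N] := im setT measurableT.
elim/ltn_ind: N m im => N IH m im mT.
have [N0|N0] := posnP N.
  exists [::] => A mA; rewrite big_nil; apply/eqP.
  rewrite eq_le measure_ge0 andbT; apply: (@le_trans _ _ (m setT)).
    by apply: le_measure; rewrite ?inE.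
  by rewrite mT N0.
have [x0 mx0] : exists x, m [set x] != 0%E.
  by apply: integer_valued_atom => //; rewrite mT eqe pnatr_eq0 -lt0n.
have [k mk] := im [set x0] (measurable_set1 x0).
have k0 : (0 < k)%N by move: mx0; rewrite mk eqe pnatr_eq0 -lt0n.
have mC : measurable (~` [set x0] : set R) by apply: measurableC; exact: measurable_set1.
have mE A : measurable A -> m A = (m (A `&` ~` [set x0]) + (if x0 \in A then k else 0%N)%:R%:E)%E.
  move=> mA; rewrite [LHS](measureDI _ mA (measurable_set1 x0)); congr (_ + _)%E.
  case: ifPn => [/set_mem Ax|/negP Ax].
    by rewrite -mk; congr (m _); apply/seteqP; split => [y []//|_ ->].
  rewrite (_ : _ `&` _ = set0) ?measure0//; apply/seteqP; split => // y [Ay yx].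
  by apply: Ax; rewrite -yx; exact: mem_set.
have [N' hN'] := im _ (measurableI _ _ measurableT mC).
have NE : N = (N' + k)%N.
  have := mE setT measurableT; rewrite mT hN' in_setT -EFinD -natrD => -[] /eqP.
  by rewrite eqr_nat => /eqP.
have [|A mA|s' hs'] := IH N' _ (mrestr m mC) _ hN'.
- by rewrite NE -addn1 leq_add2l.
- by apply: im; exact: measurableI.
exists (nseq k x0 ++ s') => A mA; rewrite big_cat -hs'// mE// addeC; congr (_ + _)%E.
elim: (k) => [|j IHj]; first by rewrite big_nil; case: ifP.
rewrite big_cons -IHj diracE; case: ifP => _; last by rewrite [RHS]add0e.
by rewrite -natr1 EFinD addeC.
Qed.

Lemma ge0_integral_sum_dirac m s (D : set R) (f : R -> \bar R) : measurable D ->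
  (forall A, measurable A -> m A = (\sum_(x <- s) (\d_x A : \bar R))%E) ->
  measurable_fun D f -> (forall x, D x -> (0 <= f x)%E) ->
  (\int[m]_(x in D) f x = \sum_(x <- s) \d_x D * f x)%E.
Proof.
move=> mD mE mf f0.
pose d_ (n : nat) : {measure set R -> \bar R} := \d_(nth 0 s n).
transitivity (\int[msum d_ (size s)]_(x in D) f x)%E.
  apply: eq_measure_integral => A mA _.
  by rewrite mE// /msum (big_nth 0) big_mkord.
rewrite ge0_integral_measure_sum// (big_nth 0) big_mkord.
by apply: eq_bigr => i _; rewrite integral_dirac.
Qed.

Lemma intmeas_seq nu : exists s, (forall x, x \in s -> 0 <= x) /\
  forall A, measurable A -> nu A = (\sum_(x <- s) (\d_x A : \bar R))%E.
Proof.
have [inu nuC _] := intmeasP nu.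
have [s hs] := integer_valued_sum inu; exists s; split => // x xs.
rewrite leNgt; apply/negP => x0.
have mC : measurable (~` Rplus R : set R) by apply: measurableC; exact: measurable_Rplus.
move: nuC; rewrite hs// => /eqP.
rewrite seq_psume_eq0 => [/allP/(_ _ xs)|y _]; last by rewrite diracE lee_fin.
by rewrite /= diracE mem_set/= ?eqe ?oner_eq0//; apply/negP; rewrite -ltNge.
Qed.

Definition atoms nu : seq R := projT1 (cid (intmeas_seq nu)).

Lemma atoms_ge0 nu x : x \in atoms nu -> 0 <= x.
Proof. by have [h _] := projT2 (cid (intmeas_seq nu)); exact: h. Qed.

Lemma intmeasE nu A : measurable A -> nu A = (\sum_(x <- atoms nu) (\d_x A : \bar R))%E.
Proof. by have [_] := projT2 (cid (intmeas_seq nu)); apply. Qed.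

Lemma pairingE nu (f : R -> R) : measurable_fun (Rplus R) f ->
  pairing nu f = (\sum_(x <- atoms nu) f x)%:E.
Proof.
move=> mf; rewrite /pairing integralE.
have mf' : measurable_fun (Rplus R) (EFin \o f) by exact/measurable_EFinP.
rewrite !(@ge0_integral_sum_dirac _ (atoms nu))//; try exact: measurable_Rplus; try exact: intmeasE; try exact: measurable_funeneg; try exact: measurable_funepos.
have dE x : x \in atoms nu -> (\d_x (Rplus R) = 1 :> \bar R)%E.
  by move=> xs; rewrite diracE mem_set//; exact: (atoms_ge0 xs).
rewrite -sumEFin.
transitivity (\sum_(x <- atoms nu) (Num.max (f x) 0)%:E - \sum_(x <- atoms nu) (Num.max (- f x) 0)%:E)%E.
  congr (_ - _)%E; rewrite [LHS]big_seq [RHS]big_seq; apply: eq_bigr => x xs; rewrite dE// mul1e.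
    by rewrite funeposE/= EFin_max.
  by rewrite funenegE/= EFin_max.
rewrite !sumEFin -EFinB -sumrB; congr (_%:E).
by apply: eq_bigr => x _; rewrite /Num.max; case: ifPn; case: ifPn; lra.
Qed.

Lemma intmeasT nu : nu setT = (size (atoms nu))%:R%:E.
Proof.
rewrite intmeasE//; under eq_bigr do rewrite diracE in_setT.
by rewrite sumEFin big_const_seq count_predT iter_addr_0.
Qed.

Lemma pairing_cst nu (r : R) : pairing nu (cst r) = (r *+ size (atoms nu))%:E.
Proof.
by rewrite pairingE//= big_const_seq count_predT iter_addr_0.
Qed.

End IntegerValuedMeasures.

(** * The weak topology on configurations *)

Lemma continuous_clamp (R : realType) (T : topologicalType) (f : T -> R) (k a : R) :
  continuous f -> continuous (fun x => Num.min 1 (Num.max 0 (k * (f x - a)))).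
Proof.
move=> cf x; apply: (@continuous_min _ _ (cst 1) (fun x => Num.max 0 (k * (f x - a)))).
  exact: cvg_cst.
apply: (@continuous_max _ _ (cst 0) (fun x => k * (f x - a))); first exact: cvg_cst.
by apply: cvgM; [exact: cvg_cst|apply: cvgB; [exact: cf|exact: cvg_cst]].
Qed.

Section WeakTopology.
Variable R : realType.
Implicit Types (nu mu : intmeas R) (h : Cb_Rplus R) (l : seq (Cb_Rplus R * R)) (s : seq R) (a r e : R).

(** A finite sum, equal to the pairing on measurable functions by [pairingE];
    it spares the finiteness conditions of extended real arithmetic. *)
Definition rpair nu (f : R -> R) : R := \sum_(x <- atoms nu) f x.

Lemma Cb_measurable h : measurable_fun (Rplus R) h.
Proof.
by apply: subspace_continuous_measurable_fun; [exact: measurable_Rplus|exact: Cb_cont].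
Qed.

Lemma pairing_Cb nu h : pairing nu h = (rpair nu h)%:E.
Proof. by apply: pairingE; exact: Cb_measurable. Qed.

Lemma pairing_continuous h : continuous (fun nu => pairing nu h).
Proof.
move=> nu; apply: (@cvg_trans _ ((fun nu : intmeas R => pairing nu h) @ nbhs (nu : initial_topology (fun nu : intmeas R => pairing nu h)))).
  have /cvg_sup c : nbhs nu --> (nu : sup_topology (fun h : Cb_Rplus R => Topological.class
     (initial_topology (fun nu : intmeas R => pairing nu h)))) by exact: cvg_id.
  by move=> A; exact: (c h).
exact: (@initial_continuous _ _ (fun nu : intmeas R => pairing nu h)).
Qed.

Lemma rpair_continuous h : continuous (fun nu => rpair nu h).
Proof.
have -> : (fun nu => rpair nu h) = (fun nu => fine (pairing nu h)).
  by apply/funext => nu; rewrite pairing_Cb.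
move=> nu; rewrite /continuous_at pairing_Cb; apply: fine_cvg; first exact: nbhs_filter.
by rewrite -pairing_Cb; exact: pairing_continuous.
Qed.

(** Lower bounds are enough to describe neighbourhoods, since the opposite of
    a test function is a test function. Lists make finite intersections a
    concatenation. *)
Definition basic l : set (intmeas R) :=
  [set mu | forall q, List.In q l -> q.2 < rpair mu q.1].

Lemma basic_cat l l' : basic (l ++ l') = basic l `&` basic l'.
Proof.
apply/seteqP; split => [mu h|mu [h h'] q /List.in_app_iff[]]; [|exact: h|exact: h'].
by split => q hq; apply: h; apply/List.in_app_iff; [left|right].
Qed.

Lemma basic_nil : basic [::] = setT.
Proof. by apply/seteqP; split => // mu _ q []. Qed.

Lemma open_basic l : open (basic l).
Proof.
elim: l => [|[h a] l IH]; first by rewrite basic_nil; exact: openT.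
rewrite -cat1s basic_cat; apply: openI => //.
rewrite (_ : basic _ = (fun nu => rpair nu h) @^-1` [set x | a < x]).
  by apply: open_comp; [move=> nu _; exact: rpair_continuous|exact: open_gt].
apply/seteqP; split => mu /=; first by move=> /(_ (h, a)); apply; left.
by move=> H q [<-//|[]].
Qed.

Lemma Cb_opp_subproof h : exists h' : Cb_Rplus R, forall x, h' x = - h x.
Proof.
have c : {within Rplus R, continuous (fun x => - h x)}.
  by have ch := @Cb_cont R h; move=> x; apply: cvgN; exact: ch.
have b : exists M : R, forall x : R, (0 <= x)%R -> `|- h x| <= M.
  by have [M hM] := Cb_bounded h; exists M => x x0; rewrite normrN hM.
by exists (CbRplus c b).
Qed.

Lemma nbhs_basic nu (A : set (intmeas R)) : nbhs nu A ->
  exists2 l, basic l nu & basic l `<=` A.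
Proof.
pose F := filter_from [set l | basic l nu] basic.
have FF : Filter F.
  apply: filter_from_filter; first by exists [::] => q [].
  move=> l l' bl bl'; exists (l ++ l'); last by rewrite basic_cat.
  by rewrite /= basic_cat.
suff : F --> nu by move=> /(_ A) + hA => /(_ hA) [l bl lA]; exists l.
suff c : F --> (nu : sup_topology (fun h : Cb_Rplus R => Topological.class
     (initial_topology (fun nu : intmeas R => pairing nu h)))) by exact: c.
apply/cvg_sup => h B /=.
rewrite (@nbhsE (initial_topology (fun nu : intmeas R => pairing nu h))).
move=> [C [[U oU <-] Unu] CB]; rewrite nbhs_filterE.
have UE : nbhs (rpair nu h) (fun r => U r%:E).
  by have : nbhs (pairing nu h) U; [exact: open_nbhs_nbhs|rewrite pairing_Cb].
have [e /= e0 heU] := (nbhs_ballP _ _).1 UE.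
have [h' hh'] := Cb_opp_subproof h.
have h'E mu : rpair mu h' = - rpair mu h.
  by rewrite /rpair -sumrN; apply: eq_bigr => x _; rewrite hh'.
exists [:: (h, rpair nu h - e); (h', - rpair nu h - e)].
  by move=> q [<-|[<-|[]]] /=; rewrite ?h'E gtrBl.
move=> mu hmu; apply: CB => /=; rewrite pairing_Cb.
have h1 := hmu _ (or_introl erefl); have h2 := hmu _ (or_intror (or_introl erefl)).
rewrite /= h'E in h1 h2.
apply: (heU (rpair mu h)) => /=.
rewrite /ball/= ltr_norml; apply/andP; split.
  by rewrite ltrBrDl; move: h2; rewrite -opprD ltrN2 ltrBlDl addrC.
by rewrite ltrBlDl -ltrBlDr.
Qed.

Lemma measurable_open_intmeas (A : set (intmeas R)) : open A -> measurable A.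
Proof. by move=> oA; exact: sub_sigma_algebra. Qed.

Lemma measurable_basic l : measurable (basic l).
Proof. by apply: measurable_open_intmeas; exact: open_basic. Qed.

Lemma measurable_rpair_Cb h : measurable_fun setT (fun nu => rpair nu h).
Proof.
apply: (measurability (@RGenOInfty.G R)); first exact: RGenOInfty.measurableE.
move=> _ [_ [a ->] <-].
rewrite setTI (_ : _ @^-1` _ = basic [:: (h, a)]); first exact: measurable_basic.
apply/seteqP; split => nu /=; rewrite in_itv/= andbT.
  by move=> H q [<-//|[]].
by move=> /(_ (h, a)); apply; left.
Qed.

Let one_continuous : {within Rplus R, continuous (cst (1 : R))}.
Proof. by apply: continuous_subspaceT => x; exact: cvg_cst. Qed.

Let one_bounded : exists M : R, forall x : R, (0 <= x)%R -> `|cst (1 : R) x| <= M.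
Proof. by exists 1 => x _; rewrite normr1. Qed.

Definition Cb_one : Cb_Rplus R := CbRplus one_continuous one_bounded.

Lemma ramp_subproof a (n : nat) : exists h : Cb_Rplus R,
  forall x, h x = Num.min 1 (Num.max 0 (n%:R * (x - a))).
Proof.
pose f x := Num.min 1 (Num.max 0 (n%:R * (x - a))).
have cf : continuous f by apply: continuous_clamp => x; exact: cvg_id.
have c : {within Rplus R, continuous f} by exact: continuous_subspaceT.
have b : exists M : R, forall x : R, (0 <= x)%R -> `|f x| <= M.
  exists 1 => x _; rewrite ger0_norm; first by rewrite /f ge_min lexx.
  by rewrite /f le_min ler01 le_max lexx.
by exists (CbRplus c b).
Qed.

Definition ramp a n : Cb_Rplus R := projT1 (cid (ramp_subproof a n)).

Lemma rampE a n x : ramp a n x = Num.min 1 (Num.max 0 (n%:R * (x - a))).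
Proof. exact: projT2 (cid (ramp_subproof a n)) x. Qed.

Lemma ramp_cvg a x : (fun n => ramp a n x) @ \oo --> (\1_(`]a, +oo[%classic : set R) x : R).
Proof.
rewrite indicE; have [xa|ax] := leP x a.
  rewrite memNset; last by rewrite /= in_itv/= andbT; apply/negP; rewrite -leNgt.
  apply: cvg_near_cst; apply: nearW => n; rewrite rampE.
  rewrite (max_idPl _) ?(min_idPr _)//.
  by rewrite mulr_ge0_le0// subr_le0.
rewrite mem_set; last by rewrite /= in_itv/= andbT.
apply: cvg_near_cst; near=> n; rewrite rampE.
apply/min_idPl; rewrite le_max; apply/orP; right.
rewrite -ler_pdivrMr ?subr_gt0// mul1r.
by near: n; exact: nbhs_infty_ger.
Unshelve. all: end_near. Qed.

Lemma cvg_sum_seq (I : eqType) (s : seq I) (F : nat -> I -> R) (G : I -> R) :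
  (forall x, x \in s -> F^~ x @ \oo --> G x) ->
  (fun n => \sum_(x <- s) F n x) @ \oo --> \sum_(x <- s) G x.
Proof.
elim: s => [|y s IH] h.
  rewrite big_nil; under eq_fun do rewrite big_nil; exact: cvg_cst.
rewrite big_cons; under eq_fun do rewrite big_cons.
apply: cvgD; first by apply: h; rewrite mem_head.
by apply: IH => x xs; apply: h; rewrite in_cons xs orbT.
Qed.

(** The ramps reach the indicators of rays in the limit, and the rays reach
    all Borel sets by Dynkin's theorem. *)
Lemma measurable_intmeas (A : set R) : measurable A ->
  measurable_fun setT (fun nu => nu A : \bar R).
Proof.
have mT : measurable_fun setT (fun nu => nu setT : \bar R).
  rewrite (_ : (fun nu => _) = (fun nu => (rpair nu Cb_one)%:E)).
    by apply/measurable_EFinP; exact: measurable_rpair_Cb.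
  by apply/funext => nu; rewrite intmeasT -pairing_Cb/= pairing_cst.
have mE : @measurable _ R = <<s RGenOInfty.G (R:=R) >> by exact: RGenOInfty.measurableE.
rewrite mE; move: A; apply: (dynkin_induction mE) => //.
- move=> _ _ [a ->] [b ->]; exists (Num.max a b).
  apply/seteqP; split => x /=; rewrite !in_itv/= !andbT gt_max.
    by move=> [-> ->].
  by move=> /andP[].
- move=> _ [a ->].
  apply: (@emeasurable_fun_cvg _ _ _ _ (fun n nu => (rpair nu (ramp a n))%:E)).
    by move=> n; apply/measurable_EFinP; exact: measurable_rpair_Cb.
  move=> nu _; rewrite intmeasE//.
  under eq_bigr do rewrite diracE.
  rewrite sumEFin; apply: cvg_EFin; first exact: nearW.
  apply: (@cvg_sum_seq _ _ (fun n x => ramp a n x) (fun x => (x \in `]a, +oo[%classic)%:R)) => x _.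
  by have := @ramp_cvg a x; rewrite indicE.
- move=> S mS mP.
  rewrite (_ : (fun nu => _) = (fun nu : intmeas R => (nu setT - nu S)%E)).
    exact: emeasurable_funB.
  apply/funext => nu; have f : (nu setT < +oo)%E by rewrite intmeasT ltry.
  rewrite -setTD measureD // .
  by rewrite setTI.
- move=> F mF tF mP.
  rewrite (_ : (fun nu => _) = (fun nu : intmeas R => \sum_(k <oo) nu (F k))%E).
    by apply: ge0_emeasurable_sum => // k nu _ _; exact: measure_ge0.
  apply/funext => nu; rewrite measure_semi_bigcup//; exact: bigcup_measurable.
Qed.

End WeakTopology.

(** * The Borel sets of the space of configurations *)

Lemma continuous_prod_seq (R : realType) (T : topologicalType) (I : Type) (l : seq I)
    (g : I -> T -> R) : (forall i, continuous (g i)) ->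
  continuous (fun x => \prod_(i <- l) g i x).
Proof.
move=> cg; elim: l => [|i l IH] x.
  by rewrite /continuous_at big_nil; under eq_fun do rewrite big_nil; exact: cvg_cst.
rewrite /continuous_at big_cons; under eq_fun do rewrite big_cons.
by apply: cvgM; [exact: cg|exact: IH].
Qed.

Section BorelSets.
Variable R : realType.
Implicit Types (nu mu : intmeas R) (h : Cb_Rplus R) (l : seq (Cb_Rplus R * R)) (s : seq R) (r e : R).

Definition close_seq r s s' := all2 (fun x y : R => `|y - x| < r) s s'.

Lemma close_seq_le r r' s s' : r <= r' -> close_seq r s s' -> close_seq r' s s'.
Proof.
move=> rr'; elim: s s' => [|x s IH] [|y s']//= /andP[xy /IH ->].
by rewrite (lt_le_trans xy).
Qed.

Lemma rsum_continuous h s e : 0 < e -> (forall x, x \in s -> 0 <= x) ->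
  exists2 r, 0 < r & forall s', (forall y, y \in s' -> 0 <= y) -> close_seq r s s' ->
    `|\sum_(y <- s') h y - \sum_(x <- s) h x| < e.
Proof.
elim: s e => [|x s IH] e e0 s0.
  by exists 1 => // -[|y s']// _ _; rewrite !big_nil subrr normr0.
have e20 : 0 < e / 2 by rewrite divr_gt0.
have [r r0 hr] := IH (e / 2) e20 (fun y ys => s0 y (mem_behead (s := x :: s) ys)).
have x0 : Rplus R x by apply: s0; rewrite mem_head.
have ch := (proj1 (subspace_continuousP _ _) (@Cb_cont R h)) x x0.
have [r1 /= r10 hr1] : exists2 r1 : R, 0 < r1 & forall y, 0 <= y -> `|y - x| < r1 -> `|h y - h x| < e / 2.
  have /cvgrPdist_lt/(_ _ e20) := ch; rewrite near_withinE => /nbhs_ballP[r1 /= r10 hr1].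
  exists r1 => // y y0 yx; rewrite distrC; apply: hr1 => //.
  by rewrite /ball/= distrC.
exists (Num.min r r1); first by rewrite lt_min r0.
move=> [|y s']//= s'0 /andP[xy ss']; rewrite !big_cons opprD addrACA.
apply: le_lt_trans (ler_normD _ _) _; rewrite (splitr e); apply: ltrD.
  by apply: hr1; [apply: s'0; rewrite mem_head|apply: lt_le_trans xy _; rewrite ge_min lexx orbT].
apply: hr; first by move=> z zs'; apply: s'0; rewrite in_cons zs' orbT.
by apply: close_seq_le ss'; rewrite ge_min lexx.
Qed.

Definition inbox (q : seq (rat * rat)) s :=
  all2 (fun ab x => ratr ab.1 < x < ratr ab.2) q s.

Lemma rat_box s r : 0 < r ->
  exists q, inbox q s /\ forall s', inbox q s' -> close_seq r s s'.
Proof.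
move=> r0; elim: s => [|x s [q [qs hq]]]; first by exists [::]; split => // -[].
have r20 : 0 < r / 2 by rewrite divr_gt0.
have /rat_in_itvoo[a] : x - r / 2 < x by rewrite gtrBl.
rewrite in_itv/= => /andP[a1 a2].
have /rat_in_itvoo[b] : x < x + r / 2 by rewrite ltrDl.
rewrite in_itv/= => /andP[b1 b2].
exists ((a, b) :: q); split => [|[|y s']//= /andP[/andP[ay yb] /hq ->]].
  by rewrite /= a2 b1.
by rewrite andbT ltr_norml; apply/andP; split; lra.
Qed.

(** The boxes constrain the list of atoms chosen for a configuration, so they
    need not define open sets of configurations; what matters is that they are
    countably many. *)
Lemma basic_nbhs_box l nu : basic l nu ->
  exists q, inbox q (atoms nu) /\ forall mu, inbox q (atoms mu) -> basic l mu.
Proof.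
move=> bl.
have [r r0 hr] : exists2 r, 0 < r & forall mu, close_seq r (atoms nu) (atoms mu) -> basic l mu.
  elim: l bl => [|[h a] l IH] bl; first by exists 1 => // mu _ q [].
  have [r r0 hr] := IH (fun q hq => bl q (or_intror hq)).
  have e0 : 0 < rpair nu h - a by rewrite subr_gt0; exact: (bl (h, a) (or_introl erefl)).
  have [r1 r10 hr1] := rsum_continuous h e0 (@atoms_ge0 R nu).
  exists (Num.min r r1); first by rewrite lt_min r0.
  move=> mu c q [<-|ql] /=; last first.
    by apply: (hr mu) => //; apply: close_seq_le c; rewrite ge_min lexx.
  have := hr1 (atoms mu) (@atoms_ge0 R mu) (close_seq_le _ c).
  rewrite ge_min lexx orbT => /(_ isT); rewrite -/(rpair mu h) -/(rpair nu h) ltr_norml.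
  by move=> /andP[h1 _]; move: h1; lra.
have [q [q1 q2]] := rat_box (atoms nu) r0.
by exists q; split => // mu /q2; exact: hr.
Qed.

(** An open set is a countable union of basic sets: one is selected for each
    rational box that fits into a basic subset of the open set. *)
Lemma open_sigma_basic (O : set (intmeas R)) : open O -> <<s range (@basic R) >> O.
Proof.
move=> oO.
pose good q l := basic l `<=` O /\ forall mu, inbox q (atoms mu) -> basic l mu.
pose G (k : nat) : set (intmeas R) :=
  if @unpickle (seq (rat * rat))%type k is Some q then
    if pselect (exists l, good q l) is left e then basic (projT1 (cid e)) else set0
  else set0.
have -> : O = \bigcup_k G k.
  apply/seteqP; split => [nu Onu|nu [k _]]; last first.
    rewrite /G; case: unpickle => // q; case: pselect => // e.
    by have [+ _] := projT2 (cid e); apply.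
  have [l bl lO] : exists2 l, basic l nu & basic l `<=` O.
    by apply: nbhs_basic; exact: open_nbhs_nbhs.
  have [q [q1 q2]] := basic_nbhs_box bl.
  exists (pickle q); first exact: I.
  rewrite /G pickleK; case: pselect => [e|]; last by case; exists l.
  by have [_] := projT2 (cid e); apply.
apply: sigma_algebra_bigcup => k; rewrite /G; case: unpickle => [q|]; last exact: sigma_algebra0.
case: pselect => [e|_]; last exact: sigma_algebra0.
by apply: sub_sigma_algebra; eexists.
Qed.

Lemma measurable_sigma_basic : @measurable _ (intmeas R) = <<s range (@basic R) >>.
Proof.
apply/seteqP; split.
  by apply: smallest_sub; [exact: smallest_sigma_algebra|exact: open_sigma_basic].
apply: smallest_sub; first exact: sigma_algebra_measurable.
by move=> _ [l _ <-]; exact: measurable_basic.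
Qed.

Lemma setI_closed_basic : setI_closed (range (@basic R)).
Proof. by move=> _ _ [l _ <-] [l' _ <-]; exists (l ++ l') => //; rewrite basic_cat. Qed.

Lemma measurable_continuous (F : intmeas R -> R) : continuous F -> measurable_fun setT F.
Proof.
move=> cF; apply: (measurability (@RGenOInfty.G R)); first exact: RGenOInfty.measurableE.
move=> _ [_ [a ->] <-]; rewrite setTI.
have oF : open (F @^-1` `]a, +oo[%classic).
  by apply: open_comp; [move=> nu _; exact: cF|exact: rray_open].
exact: measurable_open_intmeas.
Qed.

Definition soft_indic l n nu : R :=
  \prod_(q <- l) Num.min 1 (Num.max 0 (n%:R * (rpair nu q.1 - q.2))).

Let clamp_itv (x : R) : 0 <= Num.min 1 (Num.max 0 x) <= 1.
Proof. by rewrite le_min ler01 le_max lexx/= ge_min lexx. Qed.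

Lemma soft_indic_itv l n nu : 0 <= soft_indic l n nu <= 1.
Proof.
rewrite /soft_indic; elim: l => [|q l IH]; first by rewrite big_nil lexx ler01.
rewrite big_cons; have /andP[h1 h2] := clamp_itv (n%:R * (rpair nu q.1 - q.2)).
by move: IH => /andP[h3 h4]; rewrite mulr_ge0// mulr_ile1.
Qed.

Lemma soft_indic_continuous l n : continuous (soft_indic l n).
Proof.
apply: (@continuous_prod_seq R (intmeas R) _ l
  (fun q nu => Num.min 1 (Num.max 0 (n%:R * (rpair nu q.1 - q.2))))) => q.
by apply: continuous_clamp; exact: rpair_continuous.
Qed.

Lemma soft_indic_cvg l nu : (fun n => soft_indic l n nu) @ \oo --> (\1_(basic l) nu : R).
Proof.
elim: l => [|[h a] l IH].
  rewrite indicE basic_nil in_setT /soft_indic; under eq_fun do rewrite big_nil; exact: cvg_cst.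
rewrite /soft_indic; under eq_fun do rewrite big_cons.
have -> : (\1_(basic ((h, a) :: l)) nu : R) = (a < rpair nu h)%R%:R * \1_(basic l) nu.
  rewrite -cat1s basic_cat indicI; congr (_ * _); rewrite indicE; congr (_%:R); congr (nat_of_bool _).
  apply/idP/idP => [/set_mem/(_ (h, a) (or_introl erefl))//|ha].
  by apply/mem_set => q [<-|[]].
apply: cvgM; last exact: IH.
have [ra|ar] := leP (rpair nu h) a.
  apply: cvg_near_cst; apply: nearW => n.
  by rewrite (max_idPl _) ?(min_idPr _)//= mulr_ge0_le0// subr_le0.
apply: cvg_near_cst; near=> n.
apply/min_idPl; rewrite le_max; apply/orP; right.
rewrite -ler_pdivrMr ?subr_gt0// mul1r.
by near: n; exact: nbhs_infty_ger.
Unshelve. all: end_near. Qed.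

(** The basic sets are a generating pi-system, and their indicators are
    pointwise limits of the continuous functions [soft_indic]. *)
Lemma law_unique (P Q : probability (intmeas R) R) :
  (forall F : intmeas R -> R, continuous F -> (exists M, forall nu, `|F nu| <= M) ->
     (\int[P]_nu (F nu)%:E = \int[Q]_nu (F nu)%:E)%E) ->
  forall A, measurable A -> P A = Q A.
Proof.
move=> PQ A mA.
have mb (m : probability (intmeas R) R) l :
    (fun n => \int[m]_nu (soft_indic l n nu)%:E)%E @ \oo --> m (basic l).
  rewrite -[X in m X]setIT -integral_indic //; last exact: measurable_basic.
  apply: (@dominated_cvg _ _ _ m _ measurableT (fun n nu => (soft_indic l n nu)%:E) _ (cst 1%E)) => //.
  - by move=> n; apply/measurable_EFinP; apply: measurable_continuous; exact: soft_indic_continuous.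
  - by move=> nu _; apply: cvg_EFin; [exact: nearW|exact: soft_indic_cvg].
  - exact: finite_measure_integrable_cst.
  - move=> n nu _; have /andP[h0 h1] := soft_indic_itv l n nu.
    by rewrite /= lee_fin ger0_norm.
apply: (@g_sigma_algebra_measure_unique _ _ _ (range (@basic R)) _ (fun=> setT)) => //.
- by move=> _ [l _ <-]; exact: measurable_basic.
- by move=> _; exists [::] => //; exact: basic_nil.
- by rewrite bigcup_const.
- exact: setI_closed_basic.
- move=> _ [l _ <-]; have hP := mb P l; have hQ := mb Q l.
  have E : (fun n => \int[P]_nu (soft_indic l n nu)%:E)%E = (fun n => \int[Q]_nu (soft_indic l n nu)%:E)%E.
    apply/funext => n; apply: PQ; first exact: soft_indic_continuous.
    by exists 1 => nu; have /andP[h0 h1] := soft_indic_itv l n nu; rewrite ger0_norm.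
  rewrite E in hP; exact: cvg_unique hP hQ.
- by move=> _; rewrite (le_lt_trans (probability_le1 _ _))// ltry.
- by rewrite -measurable_sigma_basic.
Qed.

End BorelSets.

(** * Domination of laws through weighted counts *)

Section Cylinders.
Variable R : realType.
Implicit Types (nu mu : intmeas R) (w : R -> nat) (B : set nat) (f : R -> R).

Lemma pairing_measurable f : measurable_fun (Rplus R) f -> (forall x, 0 <= x -> 0 <= f x) ->
  measurable_fun setT (fun nu => pairing nu f).
Proof.
move=> mf f0.
have mF : measurable_fun setT ((EFin \o f) \_ (Rplus R)).
  by apply/(measurable_restrictT _ _).1; [exact: measurable_Rplus|exact/measurable_EFinP].
rewrite (_ : (fun nu => _) = (fun nu : intmeas R => \int[intmeas_measure nu]_x ((EFin \o f) \_ (Rplus R)) x)%E); last first.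
  by apply/funext => nu; rewrite /pairing integral_mkcond.
apply: (measurable_fun_integral_kernel (l := fun nu : intmeas R => intmeas_measure nu)) => //.
- by move=> U mU; exact: measurable_intmeas.
- move=> x; rewrite patchE; case: ifPn => [/set_mem x0|//].
  by rewrite /= lee_fin f0.
Qed.

Lemma rpair_measurable f : measurable_fun (Rplus R) f -> (forall x, 0 <= x -> 0 <= f x) ->
  measurable_fun setT (fun nu => rpair nu f).
Proof.
move=> mf f0; rewrite (_ : (fun nu => _) = (fine \o (fun nu => pairing nu f))).
  by apply: measurableT_comp => //; exact: pairing_measurable.
by apply/funext => nu; rewrite /= pairingE.
Qed.

(** Weights take natural numbers as values, so that the pairing with a
    configuration is a natural number and has a generating function. *)
Definition weight w :=
  measurable_fun setT (fun x => (w x)%:R : R) /\ exists M, forall x, (w x <= M)%N.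

Definition wcount nu w : nat := \sum_(x <- atoms nu) w x.

Lemma wcountE nu w : (wcount nu w)%:R = rpair nu (fun x => (w x)%:R).
Proof. by rewrite /wcount natr_sum. Qed.

Definition cyl w B : set (intmeas R) := [set nu | B (wcount nu w)].

Lemma measurable_cyl w B : weight w -> measurable (cyl w B).
Proof.
move=> [mw _].
have mr : measurable_fun setT (fun nu : intmeas R => rpair nu (fun x => (w x)%:R)).
  by apply: rpair_measurable => //; exact: measurable_funTS.
rewrite (_ : cyl w B = \bigcup_(n in B) ((fun nu => rpair nu (fun x => (w x)%:R)) @^-1` [set n%:R])).
  apply: bigcup_measurable => n _; rewrite -[X in measurable X]setTI.
  by apply: mr => //; exact: measurable_set1.
apply/seteqP; split => [nu Bn|nu [n Bn]] /=.
  by exists (wcount nu w) => //=; rewrite wcountE.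
by rewrite -wcountE => /eqP; rewrite eqr_nat => /eqP En; rewrite /cyl/= En.
Qed.

Lemma weight_cst n : weight (cst n).
Proof. by split; [exact: measurable_cst|exists n]. Qed.

Lemma wcount_cst nu n : wcount nu (cst n) = (size (atoms nu) * n)%N.
Proof. by rewrite /wcount big_const_seq count_predT iter_addn_0 mulnC. Qed.

Lemma weight_level w (M : nat) : (forall n, measurable [set x | (n < w x)%N]) ->
  (forall x, (w x <= M)%N) -> weight w.
Proof.
move=> mw wM; split; last by exists M.
have cnt n m : (\sum_(i < m) (i < n)%N)%N = minn n m.
  elim: m => [|m IH]; first by rewrite big_ord0 minn0.
  by rewrite big_ord_recr/= IH; lia.
rewrite (_ : (fun x => _) = (fun x => \sum_(i < M) (\1_[set x | (i < w x)%N] x : R))).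
  by apply: measurable_sum => i; exact: measurable_indic.
apply/funext => x; transitivity ((\sum_(i < M) (i < w x)%N)%N%:R : R).
  by rewrite cnt (minn_idPl _).
rewrite natr_sum; apply: eq_bigr => i _; rewrite indicE; congr (_%:R); congr (nat_of_bool _).
by apply/idP/idP => [h|/set_mem//]; exact/mem_set.
Qed.

Section Approximation.
Variable m : {measure set (intmeas R) -> \bar R}.
Hypothesis moo : (m setT < +oo)%E.

(** Approximability in measure by an event that depends on a single weighted
    count. *)
Definition cyl_approx (A : set (intmeas R)) := measurable A /\
  forall e : R, 0 < e -> exists w B, weight w /\ (m (setY A (cyl w B)) <= e%:E)%E.

Lemma measurable_setY (A C : set (intmeas R)) : measurable A -> measurable C -> measurable (setY A C).
Proof. by move=> mA mC; apply: measurableU; exact: measurableD. Qed.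

Lemma measureU_le (A C : set (intmeas R)) (a b : \bar R) : measurable A -> measurable C ->
  (m A <= a)%E -> (m C <= b)%E -> (m (A `|` C) <= a + b)%E.
Proof.
by move=> mA mC ha hb; apply: (@le_trans _ _ (m A + m C)%E); [exact: measureU2|exact: leeD].
Qed.

Lemma approx_cyl w B : weight w -> cyl_approx (cyl w B).
Proof.
move=> ww; split; first exact: measurable_cyl.
move=> e e0; exists w, B; split => //.
by rewrite setYK measure0 lee_fin ltW.
Qed.

Lemma approxC A : cyl_approx A -> cyl_approx (~` A).
Proof.
move=> [mA hA]; split; first exact: measurableC.
move=> e e0; have [w [B [ww h]]] := hA e e0; exists w, (~` B); split => //.
rewrite (_ : setY _ _ = setY A (cyl w B))//.
apply/seteqP; split => nu /=; rewrite /setY/= /cyl/=.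
  by move=> [[h1 h2]|[h1 h2]]; [right|left]; split => //; [exact: contrapT|exact: contrapT].
by move=> [[h1 h2]|[h1 h2]]; [right|left]; split => //; move=> /(_ h1).
Qed.

Lemma wcount_tail w (e : R) : weight w -> 0 < e ->
  exists2 M, (0 < M)%N & (m (cyl w [set n | (M <= n)%N]) <= e%:E)%E.
Proof.
move=> ww e0; pose F M := cyl w [set n | (M <= n)%N].
have mF M : measurable (F M) by exact: measurable_cyl.
have cF : m \o F @ \oo --> (0 : \bar R)%E.
  have cap0 : \bigcap_M F M = set0.
    apply/seteqP; split => // nu h; have := h (wcount nu w).+1 I.
    by rewrite /F /cyl/= ltnn.
  rewrite -[X in _ --> X](measure0 m) -cap0; apply: nonincreasing_cvg_mu => //.
  - by apply: le_lt_trans moo; apply: le_measure; rewrite ?inE.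
  - by rewrite cap0.
  - by move=> i j ij; apply/subsetPset => nu /=; exact: leq_trans.
have [N _ hN] := cF _ (open_ereal_lt' (e0 : (0 < e%:E :> \bar R)%E)).
exists N.+1 => //; apply: ltW; apply: (hN N.+1) => /=; exact: leqnSn.
Qed.

(** Two counts are packed into one. As long as the first is smaller than M,
    the count for the weight w + M w' has it as its remainder modulo M, and
    the second count as its quotient. *)
Lemma approxU A A' : cyl_approx A -> cyl_approx A' -> cyl_approx (A `|` A').
Proof.
move=> [mA hA] [mA' hA']; split; first exact: measurableU.
move=> e e0; have e30 : 0 < e / 3 by rewrite divr_gt0.
have [w [B [ww h]]] := hA _ e30; have [w' [B' [ww' h']]] := hA' _ e30.
have [M M0 hM] := wcount_tail ww e30.
pose v x := (w x + M * w' x)%N.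
have wv : weight v.
  split.
    under eq_fun do rewrite natrD natrM.
    apply: measurable_funD; first exact: ww.1.
    by apply: measurable_funM => //; exact: ww'.1.
  have [_ [m1 h1]] := ww; have [_ [m2 h2]] := ww'.
  by exists (m1 + M * m2)%N => x; rewrite leq_add// leq_mul.
have vE nu : wcount nu v = (wcount nu w + M * wcount nu w')%N.
  by rewrite /wcount /v big_split/= big_distrr.
exists v, [set n | B (n %% M)%N \/ B' (n %/ M)%N]; split => //.
apply: (@le_trans _ _ (m (setY A (cyl w B) `|` setY A' (cyl w' B') `|` cyl w [set n | (M <= n)%N]))).
  apply: le_measure; rewrite ?inE.
  - by apply: measurable_setY; [exact: measurableU|exact: measurable_cyl].
  - by apply: measurableU; [apply: measurableU; apply: measurable_setY => //|]; exact: measurable_cyl.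
  move=> nu; have [wM|wM] := leqP M (wcount nu w); first by right.
  have e1 : (wcount nu v %% M)%N = wcount nu w by rewrite vE addnC mulnC modnMDl modn_small.
  have e2 : (wcount nu v %/ M)%N = wcount nu w' by rewrite vE addnC mulnC divnMDl// divn_small// addn0.
  rewrite /setY /cyl/= e1 e2; tauto.
rewrite (_ : e = e / 3 + e / 3 + e / 3); last by field.
rewrite !EFinD; apply: measureU_le => //.
- by apply: measurableU; apply: measurable_setY => //; exact: measurable_cyl.
- exact: measurable_cyl.
by apply: measureU_le => //; apply: measurable_setY => //; exact: measurable_cyl.
Qed.

Lemma approxI A A' : cyl_approx A -> cyl_approx A' -> cyl_approx (A `&` A').
Proof.
by move=> aA aA'; rewrite -(setCK (_ `&` _)) setCI; apply: approxC; apply: approxU; exact: approxC.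
Qed.

Lemma approx0 : cyl_approx set0.
Proof.
rewrite (_ : set0 = cyl (cst 0%N) set0)//; exact/approx_cyl/weight_cst.
Qed.

Lemma approx_bigcup (F : nat -> set (intmeas R)) : (forall n, cyl_approx (F n)) -> cyl_approx (\bigcup_n F n).
Proof.
move=> aF; have mF n : measurable (F n) by case: (aF n).
have mU : measurable (\bigcup_n F n) by exact: bigcup_measurable.
split => // e e0; have e20 : 0 < e / 2 by rewrite divr_gt0.
pose G n := \big[setU/set0]_(i < n) F i.
have aG n : cyl_approx (G n).
  by rewrite /G; elim: n => [|n IH]; [rewrite big_ord0; exact: approx0|rewrite big_ord_recr; exact: approxU].
have mG n : measurable (G n) by case: (aG n).
pose H n := (\bigcup_n F n) `\` G n.
have mH n : measurable (H n) by exact: measurableD.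
have cH : m \o H @ \oo --> (0 : \bar R)%E.
  have cap0 : \bigcap_n H n = set0.
    apply/seteqP; split => // nu h; have [[k _ Fk] _] := h 0%N I.
    have [_] := h k.+1 I; apply; rewrite /G -bigcup_mkord.
    by exists k => //=.
  rewrite -[X in _ --> X](measure0 m) -cap0; apply: nonincreasing_cvg_mu => //.
  - by apply: le_lt_trans moo; apply: le_measure; rewrite ?inE.
  - by rewrite cap0.
  - move=> i j ij; apply/subsetPset => nu [h1 h2]; split => //; apply: contra_not h2.
    rewrite /G -!bigcup_mkord => -[k /= ki Fk]; exists k => //=; exact: leq_trans ij.
have [N _ hN] := cH _ (open_ereal_lt' (e20 : (0 < (e / 2)%:E :> \bar R)%E)).
have [_ /(_ _ e20)[w [B [ww hw]]]] := aG N.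
exists w, B; split => //.
apply: (@le_trans _ _ (m (H N `|` setY (G N) (cyl w B)))).
  apply: le_measure; rewrite ?inE.
  - by apply: measurable_setY => //; exact: measurable_cyl.
  - by apply: measurableU => //; apply: measurable_setY => //; exact: measurable_cyl.
  move=> nu; rewrite /setY /H/=.
  have GF : G N nu -> (\bigcup_n F n) nu by rewrite /G -bigcup_mkord => -[k _ Fk]; exists k.
  have [g|g] := pselect (G N nu); tauto.
rewrite (splitr e) EFinD; apply: measureU_le => //.
  by apply: measurable_setY => //; exact: measurable_cyl.
by apply: ltW; exact: (hN N (leqnn N)).
Qed.

Lemma approx_sigma : sigma_algebra setT cyl_approx.
Proof.
split; [exact: approx0|by move=> A aA; rewrite setTD; exact: approxC|exact: approx_bigcup].
Qed.

(** Rounding h + M down at scale 1/(k+1) gives a weight; the constant M makes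
    it nonnegative, and its contribution is known from the number of atoms. *)
Lemma approx_gt (h : Cb_Rplus R) (a : R) : cyl_approx [set nu | a < rpair nu h].
Proof.
have [M hM] := Cb_bounded h.
have M0 : 0 <= M by apply: le_trans (hM 0 _).
have hM0 x : 0 <= x -> 0 <= h x + M by move=> x0; have := hM x x0; rewrite ler_norml => /andP[h1 _]; lra.
have hM1 x : 0 <= x -> h x + M <= M + M by move=> x0; have := hM x x0; rewrite ler_norml => /andP[_ h1]; lra.
pose w (k : nat) (x : R) : nat := if 0 <= x then Num.truncn (k.+1%:R * (h x + M)) else 0%N.
have wE k x : 0 <= x -> (w k x)%:R <= k.+1%:R * (h x + M) < (w k x).+1%:R.
  by move=> x0; rewrite /w x0 truncn_itv// mulr_ge0// hM0.
have ww k : weight (w k).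
  apply: (@weight_level _ (Num.truncn (k.+1%:R * (M + M)))) => [n|x].
    rewrite (_ : [set x | _] = Rplus R `&`
        (fun x => k.+1%:R * (h x + M)) @^-1` `[n.+1%:R, +oo[%classic).
      have mg : measurable_fun (Rplus R) (fun x => k.+1%:R * (h x + M)).
        by apply: measurable_funM => //; apply: measurable_funD => //; exact: Cb_measurable.
      by apply: mg => //; exact: measurable_Rplus.
    apply/seteqP; split => x; rewrite /Rplus/= /w in_itv/= andbT.
      by case: ifP => // x0; rewrite truncn_gt_nat.
    by move=> [-> h1]; rewrite truncn_gt_nat.
  rewrite /w; case: ifP => // x0; apply: le_truncn.
  by rewrite ler_pM2l// hM1.
rewrite (_ : [set nu | _] = \bigcup_k \bigcup_N (cyl (cst 1%N) [set N] `&`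
    cyl (w k) [set n | k.+1%:R * (a + M * N%:R) < n%:R])).
  do 2 apply: approx_bigcup => ?; apply: approxI; apply: approx_cyl => //.
  exact: weight_cst.
apply/seteqP; split => [nu /= anu|nu [k _ [N _ []]]]; last first.
  rewrite /cyl/= wcount_cst muln1 => <- /lt_le_trans h1.
  have {}h1 := h1 _ (_ : _ <= k.+1%:R * (rpair nu h + M * (size (atoms nu))%:R)).
  have : k.+1%:R * (a + M * (size (atoms nu))%:R) < k.+1%:R * (rpair nu h + M * (size (atoms nu))%:R).
    apply: h1; rewrite wcountE /rpair.
    have -> : M * (size (atoms nu))%:R = \sum_(x <- atoms nu) M.
      by rewrite big_const_seq count_predT iter_addr_0 mulr_natr.
    rewrite -big_split/= mulr_sumr [leLHS]big_seq [leRHS]big_seq; apply: ler_sum => x xs.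
    by have /andP[] := wE k x (atoms_ge0 xs).
  by rewrite ltr_pM2l// ltrD2r.
have d0 : 0 < rpair nu h - a by rewrite subr_gt0.
pose N := size (atoms nu).
have dN : 0 < (rpair nu h - a) / N.+1%:R by rewrite divr_gt0.
have [k hk] := ltr_add_invr dN; rewrite add0r ltr_pdivlMr// ltr_pdivrMl// in hk.
exists k => //; exists N => //; split; first by rewrite /cyl/= wcount_cst muln1.
rewrite /cyl/= wcountE.
have low : k.+1%:R * (rpair nu h + M * N%:R) <= rpair nu (fun x => (w k x)%:R) + N%:R.
  rewrite /rpair.
  have -> : M * N%:R = \sum_(x <- atoms nu) M.
    by rewrite big_const_seq count_predT iter_addr_0 mulr_natr.
  have -> : N%:R = \sum_(x <- atoms nu) 1 :> R.
    by rewrite big_const_seq count_predT iter_addr_0.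
  rewrite -!big_split/= mulr_sumr [leLHS]big_seq [leRHS]big_seq; apply: ler_sum => x xs.
  by have /andP[_ /ltW] := wE k x (atoms_ge0 xs); rewrite natr1.
have NN : (N%:R : R) <= N.+1%:R by rewrite ler_nat.
move: hk low NN; set r := rpair nu h; set q := rpair nu _.
set K := k.+1%:R : R; set n := N%:R : R; set n' := N.+1%:R : R => h1 h2 h3.
have : K * (r - a) = K * r - K * a by rewrite mulrBr.
have : K * (r + M * n) = K * r + K * (M * n) by rewrite mulrDr.
by rewrite mulrDr; lra.
Qed.

Lemma approx_measurable A : measurable A -> cyl_approx A.
Proof.
rewrite measurable_sigma_basic; apply: smallest_sub; first exact: approx_sigma.
move=> _ [l _ <-]; elim: l => [|[h a] l IH].
  by rewrite basic_nil -setC0; apply: approxC; exact: approx0.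
rewrite -cat1s basic_cat; apply: approxI => //.
rewrite (_ : basic _ = [set nu | a < rpair nu h]); first exact: approx_gt.
apply/seteqP; split => nu /=; first by move=> /(_ (h, a)); apply; left.
by move=> H q [<-//|[]].
Qed.

End Approximation.

Lemma cyl_bigcup w B : cyl w B = \bigcup_(n in B) cyl w [set n].
Proof.
by apply/seteqP; split => [nu Bn|nu [n Bn]]; [exists (wcount nu w)|rewrite /cyl/= => ->].
Qed.

Lemma measure_cyl (m : {measure set (intmeas R) -> \bar R}) w B : weight w ->
  m (cyl w B) = (\sum_(n <oo | n \in B) m (cyl w [set n]))%E.
Proof.
move=> ww; rewrite [in LHS]cyl_bigcup measure_bigcup//; first by move=> n _; exact: measurable_cyl.
by move=> i j _ _ [nu []]; rewrite /cyl/= => <- <-.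
Qed.

(** The approximation is made in the sum of the two measures, so that one
    weighted count serves both of them. *)
Lemma law_dominated (P Q : {measure set (intmeas R) -> \bar R}) (k : R) :
  (P setT < +oo)%E -> (Q setT < +oo)%E -> 0 <= k ->
  (forall w n, weight w -> (k%:E * Q (cyl w [set n]) <= P (cyl w [set n]))%E) ->
  forall A, measurable A -> (k%:E * Q A <= P A)%E.
Proof.
move=> Poo Qoo k0 PQ A mA.
have PQc w B : weight w -> (k%:E * Q (cyl w B) <= P (cyl w B))%E.
  move=> ww; rewrite !measure_cyl// -nneseriesZl//.
  by apply: lee_nneseries => n _ //; [rewrite mule_ge0|exact: PQ].
have moo : (measure_add P Q setT < +oo)%E by rewrite measure_addE; exact: lte_add_pinfty.
apply/lee_addgt0Pr => e e0.
have k10 : 0 < k + 1 by rewrite ltr_wpDl.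
have [_ /(_ (e / (k + 1)))] := approx_measurable moo mA.
rewrite divr_gt0// => /(_ isT)[w [B [ww h]]].
have mC := measurable_cyl B ww; have mD := measurable_setY mA mC.
have [hP hQ] : (P (setY A (cyl w B)) <= (e / (k + 1))%:E /\ Q (setY A (cyl w B)) <= (e / (k + 1))%:E)%E.
  have h' : (P (setY A (cyl w B)) + Q (setY A (cyl w B)) <= (e / (k + 1))%:E)%E.
    by rewrite -measure_addE; exact: h.
  by split; apply: le_trans h'; [rewrite leeDl|rewrite leeDr].
have QA : (Q A <= Q (cyl w B) + (e / (k + 1))%:E)%E.
  apply: (@le_trans _ _ (Q (cyl w B `|` setY A (cyl w B)))).
    apply: le_measure; rewrite ?inE//; first exact: measurableU.
    by move=> nu; rewrite /setY/=; have [c|c] := pselect (cyl w B nu); tauto.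
  by apply: (le_trans (measureU2 _ _ _)) => //; exact: leeD.
have PC : (P (cyl w B) <= P A + (e / (k + 1))%:E)%E.
  apply: (@le_trans _ _ (P (A `|` setY A (cyl w B)))).
    apply: le_measure; rewrite ?inE//; first exact: measurableU.
    by move=> nu; rewrite /setY/=; have [c|c] := pselect (A nu); tauto.
  by apply: (le_trans (measureU2 _ _ _)) => //; exact: leeD.
apply: (@le_trans _ _ (k%:E * (Q (cyl w B) + (e / (k + 1))%:E))%E).
  by rewrite lee_wpmul2l.
rewrite ge0_muleDr//; last by rewrite lee_fin divr_ge0// ltW.
apply: (@le_trans _ _ ((P A + (e / (k + 1))%:E) + k%:E * (e / (k + 1))%:E)%E).
  by rewrite leeD2r//; apply: le_trans PC; exact: PQc.
rewrite -addeA leeD2l// -EFinM -EFinD lee_fin le_eqVlt; apply/orP; left; apply/eqP.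
by field; exact: lt0r_neq0.
Qed.

End Cylinders.

(** * Laplace functionals and the immigration exponent *)

Section Immigration.
Variable R : realType.
Notation leb := (@lebesgue_measure R).
Implicit Types (nu mu : intmeas R) (f : R -> R).

Definition natoms nu : nat := size (atoms nu).

Lemma natoms0P nu : natoms nu = 0%N <-> nu = intmeas0 R.
Proof.
split=> [/size0nil nu0|->]; last first.
  have : intmeas0 R setT = (natoms (intmeas0 R))%:R%:E by exact: intmeasT.
  by rewrite /= /mzero/= => -[] /eqP; rewrite eq_sym pnatr_eq0 => /eqP.
case: nu nu0 => m mP nu0.
have mz : m = mzero.
  apply: eq_measure; apply/funext => A.
  have [mA|mA] := pselect (measurable A).
    by have := @intmeasE R (IntMeas mP) A mA; rewrite nu0 big_nil.
  by have [_ _ h] := mP; exact: h.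
by move: mP nu0; rewrite mz => mP _; congr IntMeas; exact: Prop_irrelevance.
Qed.

Lemma measurable_natoms (B : set nat) : measurable [set nu | B (natoms nu)].
Proof.
rewrite (_ : [set nu | _] = cyl (cst 1%N) B); first by apply: measurable_cyl; exact: weight_cst.
by apply/seteqP; split => nu; rewrite /cyl/= wcount_cst muln1.
Qed.

Lemma measurable_fun_natoms (g : nat -> \bar R) : measurable_fun setT (fun nu => g (natoms nu)).
Proof.
move=> _ Y mY; rewrite setTI; exact: (measurable_natoms (g @^-1` Y)).
Qed.

Lemma rpair0 f : rpair (intmeas0 R) f = 0.
Proof. by have /size0nil := (natoms0P (intmeas0 R)).2 erefl; rewrite /rpair => ->; rewrite big_nil. Qed.

Lemma rpair_ge0 nu f : (forall x, 0 <= x -> 0 <= f x) -> 0 <= rpair nu f.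
Proof.
by move=> f0; rewrite /rpair big_seq; apply: sumr_ge0 => x xs; apply: f0; exact: atoms_ge0 xs.
Qed.

Lemma rpair_le nu f g : (forall x, 0 <= x -> f x <= g x) -> rpair nu f <= rpair nu g.
Proof.
by move=> fg; rewrite /rpair big_seq [leRHS]big_seq; apply: ler_sum => x xs; apply: fg; exact: atoms_ge0 xs.
Qed.

Lemma rpair_cst nu (r : R) : rpair nu (cst r) = (natoms nu)%:R * r.
Proof. by rewrite /rpair big_const_seq count_predT iter_addr_0 mulr_natl. Qed.

Lemma eq_rpair nu f g : (forall x, 0 <= x -> f x = g x) -> rpair nu f = rpair nu g.
Proof.
by move=> fg; rewrite /rpair big_seq [RHS]big_seq; apply: eq_bigr => x xs; apply: fg; exact: atoms_ge0 xs.
Qed.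

Lemma Bplus_cst (r : R) : 0 <= r -> Bplus (cst r).
Proof. by move=> r0; split; [exact: measurable_cst| |exists r]. Qed.

Lemma expeR_pairing nu f : Bplus f -> expeR (- pairing nu f) = (expR (- rpair nu f))%:E.
Proof. by move=> [mf _ _]; rewrite pairingE. Qed.

Lemma pairing1 nu : pairing nu (cst 1) = (natoms nu)%:R%:E.
Proof. by rewrite pairing_cst. Qed.

Lemma measurable_rpair_exp f : Bplus f -> measurable_fun setT (fun nu => expR (- rpair nu f)).
Proof.
move=> [mf f0 _]; apply: measurableT_comp; first exact: measurable_expR.
by apply: measurableT_comp => //; exact: rpair_measurable.
Qed.

Lemma expR_rpair_itv nu f : Bplus f -> 0 <= expR (- rpair nu f) <= 1.
Proof.
by move=> [_ f0 _]; rewrite expR_ge0/= expR_le1 oppr_le0 rpair_ge0.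
Qed.

Variable L : {finite_measure set (intmeas R) -> \bar R}.

Lemma psiE f : Bplus f -> psi L f = (\int[L]_nu (1 - expR (- rpair nu f))%:E)%E.
Proof.
move=> Bf; rewrite /psi integral_mkcond; apply: eq_integral => nu _.
rewrite patchE; case: ifPn => [_|]; first by rewrite expeR_pairing// EFinB.
move=> /negP h; have -> : nu = intmeas0 R by apply: contrapT => hn; apply: h; exact/mem_set.
by rewrite rpair0 oppr0 expR0 subrr.
Qed.

Lemma psi_ge0 f : Bplus f -> (0 <= psi L f)%E.
Proof.
move=> Bf; rewrite psiE//; apply: integral_ge0 => nu _.
by rewrite lee_fin subr_ge0; have /andP[] := expR_rpair_itv nu Bf.
Qed.

Lemma psi_le f : Bplus f -> (psi L f <= L setT)%E.
Proof.
move=> Bf; rewrite psiE// -[leRHS]mul1e -integral_cst//; apply: ge0_le_integral => //.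
- by move=> nu _; rewrite lee_fin subr_ge0; have /andP[] := expR_rpair_itv nu Bf.
- by apply/measurable_EFinP; apply: measurable_funB => //; exact: measurable_rpair_exp.
- by move=> nu _; rewrite lee_fin gerBl expR_ge0.
Qed.

Lemma measurable_section_intmeas d (X : measurableType d) (l : X -> intmeas R)
    (A : set (X * R)) :
  (forall U, measurable U -> measurable_fun setT (fun x => l x U : \bar R)) ->
  measurable A -> measurable_fun setT (fun x => l x (xsection A x) : \bar R).
Proof.
move=> ml.
have E := @measurable_prod_measurableType _ _ X (R : measurableType _).
rewrite E; move: A; apply: (dynkin_induction E) => //.
- by move=> _ _ [A1 mA1 [A2 mA2 <-]] [B1 mB1 [B2 mB2 <-]]; exists (A1 `&` B1);
    [exact: measurableI|exists (A2 `&` B2); [exact: measurableI|rewrite setXI]].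
- rewrite (_ : (fun x => _) = (fun x => l x setT)); first exact: ml.
  by apply/funext => x; rewrite xsectionE.
- move=> _ [A mA [B mB <-]].
  rewrite (_ : (fun x => _) = (fun x => (\1_A x)%:E * l x B)%E).
    by apply: emeasurable_funM; [apply/measurable_EFinP; exact: measurable_indic|exact: ml].
  apply/funext => x; rewrite indicE; have [xA|xA] := boolP (x \in A).
    by rewrite in_xsectionX// mul1e.
  by rewrite notin_xsectionX// measure0 mul0e.
- move=> S mS mP.
  rewrite (_ : (fun x => _) = (fun x => (l x setT - l x (xsection S x))%E)).
    by apply: emeasurable_funB => //; exact: ml.
  apply/funext => x; have f : (l x setT < +oo)%E by rewrite intmeasT ltry.
  rewrite (_ : xsection (~` S) x = setT `\` xsection S x); last first.
    by rewrite !xsectionE setTD.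
  rewrite measureD//; last exact: measurable_xsection.
  by rewrite setTI.
- move=> F mF tF mP.
  rewrite (_ : (fun x => _) = (fun x => \sum_(k <oo) l x (xsection (F k) x))%E).
    by apply: ge0_emeasurable_sum => // k x _ _; exact: measure_ge0.
  apply/funext => x; rewrite xsection_bigcup measure_semi_bigcup//.
  - by move=> k; exact: measurable_xsection.
  - exact: trivIset_xsection.
  - by apply: bigcup_measurable => k _; exact: measurable_xsection.
Qed.

Import HBNNSimple.

Lemma measurable_pairing_joint d (X : measurableType d) (l : X -> intmeas R)
    (k : X * R -> \bar R) :
  (forall U, measurable U -> measurable_fun setT (fun x => l x U : \bar R)) ->
  measurable_fun setT k -> (forall z, (0 <= k z)%E) ->
  measurable_fun setT (fun x => \int[l x]_y k (x, y))%E.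
Proof.
move=> ml mk k0; pose k_ := nnsfun_approx measurableT mk.
apply: (@measurable_fun_xsection_integral _ _ _ _ _ k (fun x => intmeas_measure (l x)) k_) => //.
- by move=> a b ab; exact/nd_nnsfun_approx.
- by move=> z; exact/cvg_nnsfun_approx.
- by move=> n r; apply: measurable_section_intmeas.
Qed.

(** Both the integral over time of psi (u_s f) and its exchange with the
    integral over immigrating configurations rest on this joint measurability.
    *)
Lemma measurable_psi (U : R -> R -> R) :
  measurable_fun (Rplus R `*` Rplus R) (fun tx : R * R => U tx.1 tx.2) ->
  (forall s, 0 <= s -> Bplus (U s)) ->
  measurable_fun (Rplus R) (fun s => psi L (U s)).
Proof.
move=> mU BU.
have mRR : measurable (Rplus R `*` Rplus R : set (R * R)).
  by apply: measurableX; exact: measurable_Rplus.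
pose V := (fun tx : R * R => U tx.1 tx.2) \_ (Rplus R `*` Rplus R).
have mV : measurable_fun setT V by apply/(measurable_restrictT _ _).1.
have V0 z : 0 <= V z.
  rewrite /V patchE; case: ifPn => [/set_mem [z1 z2]|//].
  by have [_ h _] := BU _ z1; exact: h.
pose k (z : R * intmeas R * R) : \bar R := (V (z.1.1, z.2))%:E.
have mk : measurable_fun setT k.
  apply/measurable_EFinP.
  have mg : measurable_fun setT (fun z : R * intmeas R * R => (z.1.1, z.2)).
    apply: measurable_fun_pair; last exact: measurable_snd.
    by have := measurableT_comp (@measurable_fst _ _ R (intmeas R)) (@measurable_fst _ _ (R * intmeas R)%type R); exact.
  exact: (measurableT_comp mV mg).
pose I (z : R * intmeas R) := (\int[intmeas_measure z.2]_y k (z, y))%E.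
have mI : measurable_fun setT I.
  apply: (@measurable_pairing_joint _ _ (fun z : R * intmeas R => z.2)) => //.
    by move=> A mA; have := measurableT_comp (measurable_intmeas mA) (@measurable_snd _ _ R (intmeas R)); exact.
  by move=> z; rewrite /k lee_fin.
pose H (z : R * intmeas R) : \bar R := (1 - expR (- fine (I z)))%:E.
have mH : measurable_fun setT H.
  apply/measurable_EFinP; apply: measurable_funB => //.
  apply: measurableT_comp; first exact: measurable_expR.
  by apply: measurableT_comp => //; exact: measurableT_comp.
have I0 z : (0 <= I z)%E by apply: integral_ge0 => y _; rewrite /k lee_fin.
have H0 z : (0 <= H z)%E.
  by rewrite /H lee_fin subr_ge0 expR_le1 oppr_le0 fine_ge0.
have mF : measurable_fun setT (fun s => \int[L]_nu H (s, nu))%E.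
  exact: (@measurable_fun_fubini_tonelli_F _ _ _ _ R L H mH H0).
apply: (eq_measurable_fun (fun s => \int[L]_nu H (s, nu))%E); last exact: measurable_funTS.
move=> s /set_mem s0; rewrite psiE; last exact: BU.
apply: eq_integral => nu _; rewrite /H /I /=; congr (1 - expR (- _))%:E.
have [mUs _ _] := BU _ s0.
rewrite -[RHS]/(fine (rpair nu (U s))%:E) -pairingE// /pairing [in RHS]integral_mkcond.
congr fine; apply: eq_integral => x _; rewrite /k /V /= !patchE.
case: ifPn => [/set_mem[_ x0]|hx]; first by rewrite mem_set.
by rewrite memNset// => x0; move/negP: hx; apply; exact: mem_set.
Qed.

End Immigration.

(** * Generating functions of weighted counts *)

Lemma absmono_integral d (T : measurableType d) (R : realType) (m : {measure set T -> \bar R})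
    (g : R -> T -> R) : (m setT < +oo)%E ->
  (forall z, 0 < z < 1 -> measurable_fun setT (g z)) ->
  (forall z x, 0 < z < 1 -> 0 <= g z x <= 1) ->
  (forall x, absmono (g^~ x)) -> absmono (fun z => \int[m]_x g z x).
Proof.
move=> moo mg g01 ag n h j h0 hj.
have gh i : (j <= i <= j + n)%N -> 0 < grid h i < 1.
  by move=> hi; apply: grid_itv => //; apply: le_lt_trans hj; apply: grid_le => //; lia.
have -> : fdiff n ((fun z => \int[m]_x g z x) \o grid h) j =
    fdiff n (fun i => \int[m]_x g (grid h i) x) j by [].
rewrite fdiff_Rintegral//; last first.
  move=> i /gh hi; apply: (bounded_integrable (M := 1)) => //; first exact: mg.
  by move=> x _; have /andP[h1 h2] := g01 (grid h i) x hi; rewrite ger0_norm.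
by apply: Rintegral_ge0 => x _; exact: (ag x).
Qed.

Section GeneratingFunctionals.
Variable R : realType.
Implicit Types (P Q : {measure set (intmeas R) -> \bar R}) (w : R -> nat) (z : R) (f : R -> R).

Lemma measurable_wcount_fun w (g : nat -> R) : weight w -> measurable_fun setT (fun nu => g (wcount nu w)).
Proof.
move=> ww _ Y mY; rewrite setTI.
exact: (measurable_cyl (g @^-1` Y) ww).
Qed.

Definition count_gf P w z : R := \int[P]_nu (z ^+ wcount nu w).

Lemma count_gf_series P w z : (P setT < +oo)%E -> weight w -> 0 <= z <= 1 ->
  series (fun n => fine (P (cyl w [set n])) * z ^+ n) @ \oo --> count_gf P w z.
Proof.
move=> Poo ww /andP[z0 z1].
have Pfin A : measurable A -> P A \is a fin_num.
  move=> mA; rewrite ge0_fin_numE//; apply: le_lt_trans Poo.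
  by apply: le_measure; rewrite ?inE.
have mz := @measurable_wcount_fun w (fun n => z ^+ n) ww.
apply: cvg_nneseries_EFin; first by move=> n; rewrite mulr_ge0 ?exprn_ge0// fine_ge0.
rewrite /count_gf /Rintegral fineK; last first.
  apply: integrable_fin_num => //; apply: (bounded_integrable (M := 1)) => // nu _.
  by rewrite ger0_norm ?exprn_ge0// exprn_ile1.
have E : \bigcup_n cyl w [set n] = [set: intmeas R].
  by apply/seteqP; split => // nu _; exists (wcount nu w).
rewrite -[in RHS]E ge0_integral_bigcup//; first last.
- by move=> i j _ _ [nu []]; rewrite /cyl/= => <- <-.
- by move=> nu _; rewrite lee_fin exprn_ge0.
- by rewrite E; exact/measurable_EFinP.
- by move=> n; exact: measurable_cyl.
apply: eq_eseriesr => n _.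
rewrite (@eq_integral _ _ _ P _ (cst (z ^+ n)%:E)); last by move=> nu /set_mem/= ->.
rewrite integral_cst; last exact: measurable_cyl.
have fP : P (cyl w [set n]) \is a fin_num by apply: Pfin; exact: measurable_cyl.
by rewrite EFinM (fineK fP) muleC.
Qed.

Lemma absmono_count_gf P w : (P setT < +oo)%E -> weight w -> absmono (count_gf P w).
Proof.
move=> Poo ww; apply: absmono_integral => //.
- by move=> z _; exact: (@measurable_wcount_fun w (fun n => z ^+ n)).
- by move=> z nu /andP[z0 z1]; rewrite exprn_ge0 ?exprn_ile1 // ltW.
- by move=> nu; exact: absmono_exp.
Qed.

(** The difference is a power series whose coefficients compare the
    probabilities of the values of the count, and absolute monotonicity makes
    them nonnegative. *)
Lemma law_dominated_gf P Q (k : R) : P setT = 1%E -> Q setT = 1%E -> 0 <= k <= 1 ->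
  (forall w, weight w -> absmono (fun z => count_gf P w z - k * count_gf Q w z)) ->
  forall A, measurable A -> (k%:E * Q A <= P A)%E.
Proof.
move=> P1 Q1 /andP[k0 k1] aD.
have Poo : (P setT < +oo)%E by rewrite P1 ltry.
have Qoo : (Q setT < +oo)%E by rewrite Q1 ltry.
apply: (law_dominated Poo Qoo k0) => w n ww.
have mC i := measurable_cyl [set i] ww.
have fin_cyl (m : {measure set (intmeas R) -> \bar R}) i : m setT = 1%E ->
    m (cyl w [set i]) \is a fin_num /\ 0 <= fine (m (cyl w [set i])) <= 1.
  move=> m1; have le1 : (m (cyl w [set i]) <= 1)%E by rewrite -m1; apply: le_measure; rewrite ?inE.
  have fm : m (cyl w [set i]) \is a fin_num by rewrite ge0_fin_numE// (le_lt_trans le1)// ltry.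
  split=> //; rewrite fine_ge0//= -lee_fin fineK//.
pose d_ i := fine (P (cyl w [set i])) - k * fine (Q (cyl w [set i])).
have d0 : 0 <= d_ n.
  apply: (@coef_ge0 R d_ _ _ _ (aD w ww)).
    move=> i; rewrite /d_; have [_ /andP[p0 p1]] := fin_cyl P i P1; have [_ /andP[q0 q1]] := fin_cyl Q i Q1.
    by rewrite ler_norml; apply/andP; split; nra.
  move=> z /andP[z0 z1].
  have z01 : 0 <= z <= 1 by rewrite !ltW.
  have hP := count_gf_series Poo ww z01; have hQ := count_gf_series Qoo ww z01.
  rewrite (_ : series _ = (fun n => series (fun n => fine (P (cyl w [set n])) * z ^+ n) n
      - k * series (fun n => fine (Q (cyl w [set n])) * z ^+ n) n)).
    by apply: cvgB => //; apply: cvgM => //; exact: cvg_cst.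
  apply/funext => N; rewrite /series/= mulr_sumr -sumrB; apply: eq_bigr => i _.
  by rewrite /d_ mulrBl mulrA.
have [fP _] := fin_cyl P n P1.
have [fQ _] := fin_cyl Q n Q1.
have H : (k%:E * Q (cyl w [set n]) <= P (cyl w [set n]))%E.
  by rewrite -(fineK fP) -(fineK fQ) -EFinM lee_fin -subr_ge0.
exact: H.
Qed.

(** The test functions at which Laplace functionals are generating functions,
    by [expR_rpair_log_weight]. *)
Definition log_weight w z : R -> R := fun x => - ln z * (w x)%:R.

Lemma Bplus_log_weight w z : weight w -> 0 < z < 1 -> Bplus (log_weight w z).
Proof.
move=> [mw [M wM]] /andP[z0 z1].
have lz : 0 <= - ln z by rewrite oppr_ge0 ln_le0// ltW.
split.
- by apply: measurable_funTS; exact: measurable_funM.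
- by move=> x _; rewrite mulr_ge0.
- by exists (- ln z * M%:R) => x _; rewrite ler_wpM2l// ler_nat.
Qed.

Lemma expR_log_weight w z x : 0 < z -> expR (- log_weight w z x) = z ^+ w x.
Proof. by move=> z0; rewrite /log_weight mulNr opprK mulrC expRM_natl lnK. Qed.

Lemma expR_rpair_log_weight w z nu : 0 < z -> expR (- rpair nu (log_weight w z)) = z ^+ wcount nu w.
Proof.
move=> z0; have -> : rpair nu (log_weight w z) = - ln z * (wcount nu w)%:R.
  by rewrite wcountE /rpair mulr_sumr.
by rewrite mulNr opprK mulrC expRM_natl lnK.
Qed.

Lemma expR_rpair nu f : expR (- rpair nu f) = \prod_(x <- atoms nu) expR (- f x).
Proof. by rewrite /rpair -sumrN expR_sum. Qed.

End GeneratingFunctionals.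

(** * How long a group of immigrants stays alive *)

Section TimeIntegrals.
Variables (R : realType).
Notation leb := (@lebesgue_measure R).
Implicit Types (c r s t A : R) (N : nat).

Lemma Rplus_itv : `[0%R, +oo[%classic = Rplus R.
Proof. by apply/seteqP; split => x; rewrite /Rplus/= in_itv/= andbT. Qed.

Lemma integral_0y_cvg (f : R -> \bar R) : measurable_fun (Rplus R) f ->
  (forall s, 0 <= s -> (0 <= f s)%E) ->
  (fun n : nat => \int[leb]_(s in `[0%R, n%:R]) f s)%E @ \oo --> (\int[leb]_(s in `[0%R, +oo[) f s)%E.
Proof.
move=> mf f0.
have E : `[0%R, +oo[%classic = \bigcup_n `[0%R, n%:R]%classic :> set R.
  by rewrite itv_bndy_bigcup_BRight; apply: eq_bigcupr => n _; rewrite add0r.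
rewrite E; apply: ge0_nondecreasing_set_cvg_integral => //.
- move=> m n mn; apply/subsetPset; apply: subset_itvl.
  by rewrite bnd_simp ler_nat.
- move=> n; apply: measurable_funS mf => //; first exact: measurable_Rplus.
  by rewrite -Rplus_itv; apply: subset_itvl; rewrite bnd_simp.
- by move=> n x; rewrite /= in_itv/= => /andP[x0 _]; exact: f0.
Qed.

Lemma integral_expR_0y c : 0 < c ->
  (\int[leb]_(s in `[0%R, +oo[) (expR (- (c * s)))%:E = (c^-1)%:E)%E.
Proof.
move=> c0; have h := integral_exponential_pdf c0.
have E : (\int[leb]_(s in `[0%R, +oo[) (c * expR (- (c * s)))%:E = 1)%E.
  rewrite -h [LHS]integral_mkcond; apply: eq_integral => s _.
  rewrite /exponential_pdf !patchE; case: ifPn => // _.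
  by rewrite mulNr.
have mE : measurable_fun (`[0%R, +oo[ : set R) (fun s : R => (c * expR (- (c * s)))%:E).
  by apply/measurable_EFinP; apply: measurable_funM => //; exact: measurable_expN.
have -> : (\int[leb]_(s in `[0%R, +oo[) (expR (- (c * s)))%:E =
    \int[leb]_(s in `[0%R, +oo[) ((c^-1)%:E * (c * expR (- (c * s)))%:E))%E.
  by apply: eq_integral => s _; rewrite -EFinM mulrA mulVf ?mul1r// lt0r_neq0.
rewrite ge0_integralZl//; first by rewrite E mule1.
- by move=> s _; rewrite lee_fin mulr_ge0 ?expR_ge0// ltW.
- by rewrite lee_fin invr_ge0 ltW.
Qed.

(** A bound of the probability that N particles have descendants at time s, if
    it is at most A e^{-cs} for each of them. *)
Definition alive_bound c A N s : R := Num.min 1 (N%:R * (A * expR (- (c * s)))).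

Definition alive_time c A N : \bar R := (\int[leb]_(s in `[0%R, +oo[) (alive_bound c A N s)%:E)%E.

Lemma measurable_alive_bound c A N (D : set R) : measurable_fun D (alive_bound c A N).
Proof.
apply: measurable_minr => //; apply: measurable_funM => //; apply: measurable_funM => //.
exact: measurable_expN.
Qed.

Lemma alive_bound_ge0 c A N s : 0 <= A -> 0 <= alive_bound c A N s.
Proof. by move=> A0; rewrite le_min ler01 !mulr_ge0// expR_ge0. Qed.

Lemma alive_time_ge0 c A N : 0 <= A -> (0 <= alive_time c A N)%E.
Proof. by move=> A0; apply: integral_ge0 => s _; rewrite lee_fin alive_bound_ge0. Qed.

Lemma alive_time_le_linear c A N : 0 < c -> 0 <= A -> (alive_time c A N <= (N%:R * A / c)%:E)%E.
Proof.
move=> c0 A0.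
have NA0 : 0 <= N%:R * A by rewrite mulr_ge0.
apply: (@le_trans _ _ (\int[leb]_(s in `[0%R, +oo[) ((N%:R * A)%:E * (expR (- (c * s)))%:E))%E).
  apply: ge0_le_integral => //.
  - by move=> s _; rewrite lee_fin alive_bound_ge0.
  - by apply/measurable_EFinP; exact: measurable_alive_bound.
  - by apply/measurable_EFinP; apply: measurable_funM => //; exact: measurable_expN.
  - by move=> s _; rewrite -EFinM lee_fin ge_min mulrA lexx orbT.
rewrite ge0_integralZl//.
- by rewrite integral_expR_0y// -EFinM.
- by apply/measurable_EFinP; exact: measurable_expN.
Qed.

(** The bound 1 is used up to time (ln N)/c and the exponential bound
    afterwards. *)
Lemma alive_time_le_log c A N : 0 < c -> 0 <= A <= 1 -> (alive_time c A N <= ((1 + ln N%:R) / c)%:E)%E.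
Proof.
move=> c0 /andP[A0 A1]; case: N => [|N].
  apply: le_trans (alive_time_le_linear _ c0 A0) _.
  by rewrite mul0r mul0r lee_fin ln0// addr0 divr_ge0// ltW.
set M : R := N.+1%:R; have M1 : 1 <= M by rewrite ler1n.
have M0 : 0 < M by rewrite ltr0n.
pose T := ln M / c; have T0 : 0 <= T by rewrite divr_ge0 ?ln_ge0// ltW.
have cT : expR (c * T) = M by rewrite /T mulrC divfK ?lnK// lt0r_neq0.
have E : `[0%R, +oo[%classic = `[0%R, T[%classic `|` `[T, +oo[%classic :> set R.
  by rewrite -itv_bndbnd_setU// bnd_simp.
rewrite /alive_time E ge0_integral_setU//; first last.
- apply/disj_setPS => x [/=]; rewrite !in_itv/= andbT => /andP[_ h1] h2.
  by move: (lt_le_trans h1 h2); rewrite ltxx.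
- by move=> s _; rewrite lee_fin alive_bound_ge0.
- by apply/measurable_EFinP; exact: measurable_alive_bound.
rewrite mulrDl EFinD addeC; apply: leeD.
  apply: (@le_trans _ _ (\int[leb]_(s in `[T, +oo[) (expR (- (c * (s - T))))%:E)%E).
    apply: ge0_le_integral => //.
    - by move=> s _; rewrite lee_fin alive_bound_ge0.
    - by apply/measurable_EFinP; exact: measurable_alive_bound.
    - apply/measurable_EFinP; apply: measurable_funTS; apply: measurableT_comp; first exact: measurable_expR.
      by apply: measurableT_comp => //; apply: measurable_funM => //; exact: measurable_funB.
    - move=> s _; rewrite lee_fin ge_min; apply/orP; right.
      rewrite mulrBr opprB expRD cT; apply: ler_wpM2l; first exact: ltW.
      by rewrite ler_piMl ?expR_ge0.
  rewrite -(@integral_shift R T `[T, +oo[%classic)//; last first.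
    apply/measurable_EFinP; apply: measurable_funTS; apply: measurableT_comp; first exact: measurable_expR.
    by apply: measurableT_comp => //; apply: measurable_funM => //; exact: measurable_funB.
  have -> : (fun s => (T + s)%R) @^-1` `[T, +oo[%classic = `[0, +oo[%classic.
    by apply/seteqP; split => s /=; rewrite !in_itv/= !andbT lerDl.
  rewrite mul1r -integral_expR_0y//; apply: ge0_le_integral => //.
  - apply/measurable_EFinP; apply: measurable_funTS; apply: measurableT_comp; first exact: measurable_expR.
    apply: measurableT_comp => //; apply: measurable_funM => //; apply: measurable_funB => //.
    exact: measurable_funD.
  - by apply/measurable_EFinP; exact: measurable_expN.
  - by move=> s _; rewrite (addrC T) addrK.
apply: (@le_trans _ _ (\int[leb]_(s in `[0%R, T[) cst 1%E s)%E).
  apply: ge0_le_integral => //.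
  - by move=> s _; rewrite lee_fin alive_bound_ge0.
  - by apply/measurable_EFinP; exact: measurable_alive_bound.
  - by move=> s _; rewrite lee_fin ge_min lexx.
rewrite integral_cst// mul1e.
have h : leb `[0%R, T[%classic = (if (0%:E < T%:E)%E then T%:E - 0%:E else 0)%E.
  by rewrite lebesgue_measure_itv.
apply: (@le_trans _ _ (leb `[0%R, T[%classic)) => //; rewrite h.
by case: ifP => _; rewrite ?sube0 lee_fin.
Qed.

Variable L : {finite_measure set (intmeas R) -> \bar R}.

Lemma measurable_joint_natoms (g : R -> nat -> R) : (forall N, measurable_fun setT (g^~ N)) ->
  measurable_fun setT (fun z : R * intmeas R => g z.1 (natoms z.2)).
Proof.
move=> mg _ Y mY; rewrite setTI.
rewrite (_ : _ @^-1` _ = \bigcup_N (((g^~ N) @^-1` Y) `*` [set nu | [set N] (natoms nu)])).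
  apply: bigcupT_measurable => N; apply: measurableX; last exact: measurable_natoms.
  by rewrite -[X in measurable X]setTI; exact: mg.
apply/seteqP; split => [[s nu] /= h|[s nu] [N _ [/= h hN]]].
  by exists (natoms nu).
by rewrite /= hN.
Qed.

Lemma tonelli_natoms (g : R -> nat -> R) : (forall N, measurable_fun setT (g^~ N)) ->
  (forall s N, 0 <= s -> 0 <= g s N) ->
  (\int[leb]_(s in `[0%R, +oo[) \int[L]_nu (g s (natoms nu))%:E =
   \int[L]_nu \int[leb]_(s in `[0%R, +oo[) (g s (natoms nu))%:E)%E.
Proof.
move=> mg g0.
pose G s N := if 0 <= s then g s N else 0.
have mG N : measurable_fun setT (G^~ N).
  rewrite (_ : G^~ N = (g^~ N) \_ (Rplus R)).
    by apply/(measurable_restrictT _ _).1; [exact: measurable_Rplus|exact: measurable_funTS].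
  apply/funext => s; rewrite patchE /G; case: ifPn => h; first by rewrite mem_set.
  by rewrite memNset //; exact/negP.
have mJ := measurable_joint_natoms mG.
have F := @fubini_tonelli _ _ _ _ R leb L (fun z : R * intmeas R => (G z.1 (natoms z.2))%:E).
rewrite integral_mkcond.
transitivity (\int[leb]_s \int[L]_nu (G s (natoms nu))%:E)%E.
  apply: eq_integral => s _; rewrite patchE; case: ifPn => h.
    apply: eq_integral => nu _; rewrite /G.
    by move: h; rewrite inE/= in_itv/= andbT => ->.
  rewrite integral0_eq// => nu _; rewrite /G.
  by move: h; rewrite notin_setE/= in_itv/= andbT => /negP/negbTE ->.
rewrite F//; first last.
- by move=> z; rewrite lee_fin /G; case: ifP => // h; exact: g0.
- exact/measurable_EFinP.
apply: eq_integral => nu _; rewrite [RHS]integral_mkcond; apply: eq_integral => s _.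
rewrite patchE /G; case: ifPn => h; first by rewrite mem_set//= in_itv/= andbT.
by rewrite memNset//= in_itv/= andbT; exact/negP.
Qed.

Lemma measurable_integral_natoms (g : R -> nat -> R) : (forall N, measurable_fun setT (g^~ N)) ->
  (forall s N, 0 <= g s N) ->
  measurable_fun setT (fun s => \int[L]_nu (g s (natoms nu))%:E)%E.
Proof.
move=> mg g0; have mJ := measurable_joint_natoms mg.
apply: (@measurable_fun_fubini_tonelli_F _ _ _ _ R L (fun z : R * intmeas R => (g z.1 (natoms z.2))%:E)).
  exact/measurable_EFinP.
by move=> z; rewrite lee_fin.
Qed.

End TimeIntegrals.

(** * Immigration and the logarithmic moment *)

Section ImmigrationBounds.
Variables (R : realType) (L : {finite_measure set (intmeas R) -> \bar R}).
Notation leb := (@lebesgue_measure R).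
Implicit Types (c r s t A a : R) (N : nat) (nu : intmeas R) (f : R -> R) (U : R -> R -> R).

(** The union bound over the atoms. *)
Lemma one_sub_rpair_le nu f a : Bplus f -> 0 <= a ->
  (forall x : R, 0 <= x -> 1 - expR (- f x) <= a) ->
  1 - expR (- rpair nu f) <= Num.min 1 ((natoms nu)%:R * a).
Proof.
move=> Bf a0 h; rewrite le_min; apply/andP; split; first by rewrite gerBl expR_ge0.
rewrite expR_rpair /natoms.
have : forall x, x \in atoms nu -> 0 <= x by move=> x; exact: atoms_ge0.
elim: (atoms nu) => [|y l IH] hl; first by rewrite big_nil/= subrr mul0r.
have y0 : 0 <= y by apply: hl; rewrite mem_head.
have {}IH := IH (fun x xl => hl x (@mem_behead _ (y :: l) x xl)).
have [_ f0 _] := Bf.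
rewrite big_cons/= -natr1 mulrDl mul1r.
have p1 : \prod_(j <- l) expR (- f j) <= 1.
  rewrite big_seq; apply: prodr_ile1 => x xl; rewrite expR_ge0/= expR_le1 oppr_le0.
  by apply/f0/hl; rewrite inE xl orbT.
have := h _ y0; have e1 : expR (- f y) <= 1 by rewrite expR_le1 oppr_le0 f0.
have e0 := expR_ge0 (- f y).
by move: (expR _) e0 e1 (\prod_(j <- l) _) p1 IH => e e0 e1 q q1 IH he; nra.
Qed.

Definition mean_alive_time c A : \bar R := (\int[L]_nu alive_time c A (natoms nu))%E.

Lemma mean_alive_time_ge0 c A : 0 <= A -> (0 <= mean_alive_time c A)%E.
Proof. by move=> A0; apply: integral_ge0 => nu _; exact: alive_time_ge0. Qed.

Lemma psi_integral_le U c A : 0 <= A ->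
  measurable_fun (Rplus R `*` Rplus R) (fun tx : R * R => U tx.1 tx.2) ->
  (forall s : R, 0 <= s -> Bplus (U s)) ->
  (forall s x : R, 0 <= s -> 0 <= x -> 1 - expR (- U s x) <= A * expR (- (c * s))) ->
  (\int[leb]_(s in `[0%R, +oo[) psi L (U s) <= mean_alive_time c A)%E.
Proof.
move=> A0 mU BU hU; rewrite /mean_alive_time /alive_time.
have E := @tonelli_natoms R L (fun s N => alive_bound c A N s)
  (fun N => @measurable_alive_bound R c A N setT) (fun s N _ => @alive_bound_ge0 R c A N s A0).
rewrite -E {E}.
apply: ge0_le_integral => //.
- by move=> s; rewrite /= in_itv/= andbT => s0; apply: psi_ge0; exact: BU.
- by rewrite Rplus_itv; exact: measurable_psi.
- apply: measurable_funTS; exact: (@measurable_integral_natoms R L (fun s N => alive_bound c A N s)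
    (fun N => @measurable_alive_bound R c A N setT) (fun s N => @alive_bound_ge0 R c A N s A0)).
- move=> s; rewrite /= in_itv/= andbT => s0; rewrite psiE; last exact: BU.
  apply: ge0_le_integral => //.
  + by move=> nu _; rewrite lee_fin subr_ge0; have /andP[] := expR_rpair_itv nu (BU s s0).
  + by apply/measurable_EFinP; apply: measurable_funB => //; apply: measurable_rpair_exp; exact: BU.
  + exact: (measurable_fun_natoms (fun N => (alive_bound c A N s)%:E)).
  + move=> nu _; rewrite lee_fin; apply: one_sub_rpair_le; [exact: BU| |].
      by rewrite mulr_ge0 ?expR_ge0.
    by move=> x x0; exact: hU.
Qed.

Definition log_moment : \bar R := (\int[L]_nu (ln (natoms nu)%:R)%:E)%E.

Lemma ln_natr_ge0 N : 0 <= ln (N%:R : R).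
Proof. by case: N => [|N]; [rewrite ln0|apply: ln_ge0; rewrite ler1n]. Qed.

Lemma log_momentE :
  (\int[L]_(nu in [set nu | 1 <= pairing nu (cst 1%R)]) lne (pairing nu (cst 1%R)) = log_moment)%E.
Proof.
rewrite integral_mkcond; apply: eq_integral => nu _; rewrite patchE pairing1.
case: ifPn => [|].
  move=> /set_mem; rewrite /mkset pairing1 lee_fin => h; rewrite lne_EFin//.
  by rewrite (lt_le_trans _ h).
rewrite notin_setE /mkset pairing1 lee_fin ler1n => /negP; rewrite -eqn0Ngt => /eqP ->.
by rewrite ln0.
Qed.

Lemma measurable_log_natoms : measurable_fun setT (fun nu => (ln (natoms nu)%:R : R)%:E).
Proof. exact: (measurable_fun_natoms (fun N => (ln (N%:R : R))%:E)). Qed.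

Section FiniteLogMoment.
Hypothesis hlog : (log_moment < +oo)%E.

Let integrable_dom c : 0 < c -> L.-integrable setT (fun nu => ((1 + ln (natoms nu)%:R) / c)%:E).
Proof.
move=> c0.
have i1 : L.-integrable setT (EFin \o cst (1 : R)) by exact: finite_measure_integrable_cst.
have i2 : L.-integrable setT (fun nu => (ln (natoms nu)%:R : R)%:E).
  apply/integrableP; split; first exact: measurable_log_natoms.
  rewrite (eq_integral (fun nu => (ln (natoms nu)%:R : R)%:E))//.
  by move=> nu _; rewrite abse_EFin ger0_norm// ln_natr_ge0.
have i3 := integrableZl measurableT (c^-1) (integrableD measurableT i1 i2).
apply: eq_integrable i3 => // nu _ /=.
by rewrite -EFinD -EFinM mulrC.
Qed.

Lemma mean_alive_time_lty c A : 0 < c -> 0 <= A <= 1 -> (mean_alive_time c A < +oo)%E.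
Proof.
move=> c0 A01; have /andP[A0 _] := A01.
have /integrableP[mi] := integrable_dom c0.
apply: le_lt_trans; apply: ge0_le_integral => //.
- by move=> nu _; exact: alive_time_ge0.
- exact: (measurable_fun_natoms (alive_time c A)).
- by apply: measurableT_comp mi.
- move=> nu _; apply: le_trans (alive_time_le_log (natoms nu) c0 A01) _.
  by rewrite abse_EFin lee_fin ler_norm.
Qed.

(** Dominated convergence: the linear bound gives the pointwise limit, the
    logarithmic one the integrable majorant. *)
Lemma mean_alive_time_cvg0 c : 0 < c -> mean_alive_time c (expR (- (c * n%:R))) @[n --> \oo] --> 0%E.
Proof.
move=> c0.
have e01 n : 0 <= expR (- (c * n%:R)) <= 1.
  by rewrite expR_ge0/= expR_le1 oppr_le0 mulr_ge0// ltW.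
have [] := @dominated_convergence _ _ _ L setT measurableT
  (fun n nu => alive_time c (expR (- (c * n%:R))) (natoms nu)) (cst 0%E)
  (fun nu => ((1 + ln (natoms nu)%:R) / c)%:E).
- by move=> n; exact: (measurable_fun_natoms (alive_time c _)).
- exact: measurable_cst.
- apply: aeW => nu _.
  have ub n : (0 <= alive_time c (expR (- (c * n%:R))) (natoms nu) <= ((natoms nu)%:R * expR (- (c * n%:R)) / c)%:E)%E.
    by rewrite alive_time_ge0 ?expR_ge0//= alive_time_le_linear ?expR_ge0.
  apply: (@squeeze_cvge _ _ _ _ (cst 0%E) _ (fun n => ((natoms nu)%:R * expR (- (c * n%:R)) / c)%:E)).
  + by apply: nearW => n; exact: ub.
  + exact: cvg_cst.
  + apply: cvg_EFin; first exact: nearW.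
    have -> : (0 : R) = (natoms nu)%:R * 0 / c by rewrite mulr0 mul0r.
    apply: cvgMl; apply: cvgMr.
    have h : (fun n => (expR (- c)) ^+ n) @ \oo --> (0 : R).
      by apply: cvg_expr; rewrite ger0_norm ?expR_ge0// expR_lt1 oppr_lt0.
    apply: cvg_trans h; apply: near_eq_cvg; apply: nearW => n.
    by rewrite -expRM_natr mulNr.
- exact: integrable_dom.
- apply: aeW => nu n _; rewrite gee0_abs ?alive_time_ge0 ?expR_ge0//.
  exact: alive_time_le_log.
- by move=> _ _; rewrite integral0.
Qed.

End FiniteLogMoment.

(** Up to time (ln N)/K the exponent N k e^{-Ks} is at least k. *)
Lemma log_le_integral K (k : R) N : 0 < K -> 0 <= k ->
  ((ln N%:R * ((1 - expR (- k)) / K))%:E <=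
   \int[leb]_(s in `[0%R, +oo[) (1 - expR (- (N%:R * (k * expR (- (K * s))))))%:E)%E.
Proof.
move=> K0 k0.
pose T := ln (N%:R : R) / K.
have T0 : 0 <= T by rewrite divr_ge0 ?ln_natr_ge0// ltW.
have g0 s : 0 <= 1 - expR (- (N%:R * (k * expR (- (K * s))))).
  by rewrite subr_ge0 expR_le1 oppr_le0 !mulr_ge0 ?expR_ge0.
have mg (D : set R) : measurable_fun D (fun s => (1 - expR (- (N%:R * (k * expR (- (K * s))))))%:E).
  apply/measurable_EFinP; apply: measurable_funB => //.
  apply: measurableT_comp; first exact: measurable_expR.
  apply: measurableT_comp => //; apply: measurable_funM => //; apply: measurable_funM => //.
  exact: measurable_expN.
apply: (@le_trans _ _ (\int[leb]_(s in `[0%R, T]) (1 - expR (- (N%:R * (k * expR (- (K * s))))))%:E)%E); last first.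
  apply: ge0_subset_integral => //.
  - exact: mg.
  - by move=> s _; rewrite lee_fin g0.
  - by apply: subset_itvl; rewrite bnd_simp.
have [Nz|Npos] := posnP N.
  apply: (@le_trans _ _ 0%E); last by apply: integral_ge0 => s _; rewrite lee_fin g0.
  by rewrite Nz ln0// mul0r.
have N0 : 0 < (N%:R : R) by rewrite ltr0n.
have KT : expR (K * T) = N%:R by rewrite /T mulrC divfK ?lnK// lt0r_neq0.
apply: (@le_trans _ _ (\int[leb]_(s in `[0%R, T]) cst (1 - expR (- k))%:E s)%E).
  have h : leb `[0%R, T]%classic = (if (0%:E < T%:E)%E then T%:E - 0%:E else 0)%E.
    by rewrite lebesgue_measure_itv.
  rewrite integral_cst//.
  apply: (@le_trans _ _ ((1 - expR (- k))%:E * leb `[0%R, T]%classic)%E) => //; rewrite h.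
  have -> : ln N%:R * ((1 - expR (- k)) / K) = (1 - expR (- k)) * T :> R.
    by rewrite /T mulrCA !mulrA.
  case: ifPn => [_|]; first by rewrite sube0 -EFinM.
  rewrite lte_fin -leNgt => T0'; rewrite mule0 lee_fin mulr_ge0_le0//.
  by rewrite subr_ge0 expR_le1 oppr_le0.
apply: ge0_le_integral => //.
- by move=> s _; rewrite lee_fin subr_ge0 expR_le1 oppr_le0.
- exact: mg.
- move=> s; rewrite /= in_itv/= => /andP[s0 sT]; rewrite lee_fin lerB// ler_expR lerN2.
  rewrite mulrCA; apply: ler_peMr => //.
  rewrite -KT -expRD -expR0 ler_expR -mulrN -mulrDr mulr_ge0 ?(ltW K0)//.
  by rewrite subr_ge0.
Qed.

Lemma log_moment_le U K (k : R) : 0 < K -> 0 <= k ->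
  measurable_fun (Rplus R `*` Rplus R) (fun tx : R * R => U tx.1 tx.2) ->
  (forall s : R, 0 <= s -> Bplus (U s)) ->
  (forall s x : R, 0 <= s -> 0 <= x -> k * expR (- (K * s)) <= 1 - expR (- U s x)) ->
  (((1 - expR (- k)) / K)%:E * log_moment <= \int[leb]_(s in `[0%R, +oo[) psi L (U s))%E.
Proof.
move=> K0 k0 mU BU hU.
have e0 : 0 <= (1 - expR (- k)) / K.
  by rewrite divr_ge0 ?(ltW K0)// subr_ge0 expR_le1 oppr_le0.
pose g s N := 1 - expR (- (N%:R * (k * expR (- (K * s))))).
have g0 s N : 0 <= g s N.
  by rewrite subr_ge0 expR_le1 oppr_le0 !mulr_ge0 ?expR_ge0.
have mg N (D : set R) : measurable_fun D (g^~ N).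
  apply: measurable_funB => //.
  apply: measurableT_comp; first exact: measurable_expR.
  apply: measurableT_comp => //; apply: measurable_funM => //; apply: measurable_funM => //.
  exact: measurable_expN.
rewrite /log_moment -ge0_integralZl//; last 2 first.
- exact: measurable_log_natoms.
- by move=> nu _; rewrite lee_fin ln_natr_ge0.
apply: (@le_trans _ _ (\int[L]_nu \int[leb]_(s in `[0%R, +oo[) (g s (natoms nu))%:E)%E).
  apply: ge0_le_integral => //.
  - by move=> nu _; rewrite -EFinM lee_fin mulr_ge0// ln_natr_ge0.
  - exact: (measurable_fun_natoms (fun N => (((1 - expR (- k)) / K)%:E * (ln (N%:R : R))%:E)%E)).
  - exact: (measurable_fun_natoms (fun N => \int[leb]_(s in `[0%R, +oo[) (g s N)%:E)%E).
  - by move=> nu _; rewrite -EFinM mulrC; exact: log_le_integral.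
rewrite -(tonelli_natoms L (fun N => mg N setT) (fun s N _ => g0 s N)).
apply: ge0_le_integral => //.
- by move=> s _; apply: integral_ge0 => nu _; rewrite lee_fin g0.
- by apply: measurable_funTS; apply: measurable_integral_natoms => // N; exact: mg.
- by rewrite Rplus_itv; exact: measurable_psi.
- move=> s; rewrite /= in_itv/= andbT => s0; rewrite psiE; last exact: BU.
  apply: ge0_le_integral => //.
  + by move=> nu _; rewrite lee_fin g0.
  + exact: (measurable_fun_natoms (fun N => (g s N)%:E)).
  + by apply/measurable_EFinP; apply: measurable_funB => //; apply: measurable_rpair_exp; exact: BU.
  + move=> nu _; rewrite lee_fin lerB// ler_expR lerN2 -rpair_cst; apply: rpair_le => x x0.
    rewrite /cst -lerN2 -ler_expR; have := hU s x s0 x0; rewrite lerBrDl -lerBrDr => h.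
    by apply: le_trans h _; exact: expR_ge1Dx.
Qed.

End ImmigrationBounds.

(** * Minorization of the transition kernels *)

Section Semigroup.
Variables (R : realType) (alpha : R -> R) (p : R -> nat -> R)
  (L : {finite_measure set (intmeas R) -> \bar R})
  (u : R -> (R -> R) -> R -> R)
  (P : R -> R.-pker (intmeas R) ~> (intmeas R)) (K c : R).
Hypothesis H : subcritical_branching alpha p K c.
Hypothesis hu : cumulant_semigroup alpha p u.
Hypothesis hP : immigration_semigroup L u P.
Notation leb := (@lebesgue_measure R).
Implicit Types (r s t A : R) (nu sigma : intmeas R) (f : R -> R).

Lemma trans1 t sigma : P t sigma setT = 1%E.
Proof. exact: prob_kernel. Qed.

Lemma measurable_cumulant f : Bplus f ->
  measurable_fun (Rplus R `*` Rplus R) (fun tx : R * R => u tx.1 f tx.2).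
Proof. by case/hu. Qed.

Lemma measurable_psi_cumulant f : Bplus f -> measurable_fun (Rplus R) (fun s => psi L (u s f)).
Proof.
move=> Bf; apply: measurable_psi; first exact: measurable_cumulant.
by move=> s s0; exact: (Bplus_cumulant H hu).
Qed.

Definition immigration f t : R := fine (\int[leb]_(s in `[0%R, t]) psi L (u s f))%E.

Lemma psi_cumulant_ge0 f s : Bplus f -> 0 <= s -> (0 <= psi L (u s f))%E.
Proof. by move=> Bf s0; apply: psi_ge0; exact: (Bplus_cumulant H hu). Qed.

Lemma immigrationE f t : Bplus f ->
  (\int[leb]_(s in `[0%R, t]) psi L (u s f) = (immigration f t)%:E)%E.
Proof.
move=> Bf; rewrite /immigration fineK//.
have s0t s : `[0%R, t]%classic s -> 0 <= s by rewrite /= in_itv/= => /andP[].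
rewrite ge0_fin_numE; last by apply: integral_ge0 => s /s0t s0; exact: psi_cumulant_ge0.
apply: (@le_lt_trans _ _ (\int[leb]_(s in `[0%R, t]) cst (L setT) s)%E).
  apply: ge0_le_integral => //.
  - by move=> s /s0t s0; exact: psi_cumulant_ge0.
  - apply: measurable_funS (measurable_psi_cumulant Bf) => //; exact: measurable_Rplus.
  - by move=> s /s0t s0; apply: psi_le; exact: (Bplus_cumulant H hu).
rewrite integral_cst//; apply: lte_mul_pinfty => //; last exact: mu_itv.
exact: fin_num_measure.
Qed.

Definition laplace t sigma f : R := expR (- rpair sigma (u t f) - immigration f t).

Lemma laplaceE t sigma f : 0 <= t -> Bplus f ->
  (\int[P t sigma]_nu (expR (- rpair nu f))%:E = (laplace t sigma f)%:E)%E.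
Proof.
move=> t0 Bf; have := hP sigma t0 Bf.
rewrite immigrationE//.
rewrite (@eq_integral _ _ _ (P t sigma) setT (fun nu => (expR (- rpair nu f))%:E)); last first.
  by move=> nu _; rewrite expeR_pairing.
move=> ->; rewrite pairingE; last by have [] := Bplus_cumulant H hu Bf t0.
by rewrite -EFinN -EFinB.
Qed.

Lemma immigrationD f t r : Bplus f -> 0 <= t -> 0 <= r ->
  immigration f (t + r) = immigration f t + immigration (u t f) r.
Proof.
move=> Bf t0 r0.
have Bt := Bplus_cumulant H hu Bf t0.
have mpsi : measurable_fun (Rplus R) (fun s => psi L (u s f)) by exact: measurable_psi_cumulant.
have m1 (D : set R) : measurable D -> D `<=` Rplus R -> measurable_fun D (fun s => psi L (u s f)).
  by move=> mD DR; apply: measurable_funS mpsi => //; exact: measurable_Rplus.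
have s1 : `[0%R, t[%classic `<=` Rplus R by move=> s; rewrite /Rplus/= in_itv/= => /andP[].
have s2 : `[t, t + r]%classic `<=` Rplus R.
  by move=> s; rewrite /Rplus/= in_itv/= => /andP[ts _]; exact: le_trans ts.
suff h : (\int[leb]_(s in `[0%R, (t + r)%R]) psi L (u s f) = \int[leb]_(s in `[0%R, t]) psi L (u s f) +
    \int[leb]_(s in `[0%R, r]) psi L (u s (u t f)))%E.
  apply: EFin_inj; exact: (etrans (esym (immigrationE (t + r) Bf))
    (etrans h (congr2 adde (immigrationE t Bf) (immigrationE r Bt)))).
have E : `[0%R, t + r]%classic = `[0%R, t[%classic `|` `[t, t + r]%classic :> set R.
  by rewrite -itv_bndbnd_setU// bnd_simp// lerDl.
rewrite E.
rewrite ge0_integral_setU; first last.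
- apply/disj_setPS => x [/=]; rewrite !in_itv/= => /andP[_ h1] /andP[h2 _].
  by move: (lt_le_trans h1 h2); rewrite ltxx.
- by move=> s [/s1|/s2] s0; exact: psi_cumulant_ge0.
- by apply: m1; [exact: measurableU|move=> s [/s1|/s2]].
- exact: measurable_itv.
- exact: measurable_itv.
apply: (congr2 adde).
  by apply: integral_itv_bndo_bndc; apply: m1; first exact: measurable_itv.
rewrite -(@integral_shift R t `[t, t + r]%classic); first last.
- by move=> s /s2 s0; exact: psi_cumulant_ge0.
- by apply: m1; first exact: measurable_itv.
- exact: measurable_itv.
have -> : (fun s => (t + s)%R) @^-1` `[t, t + r] = `[0, r]%classic.
  by apply/seteqP; split => s /=; rewrite !in_itv/= lerDl lerD2l.
apply: eq_integral => s; rewrite inE/= in_itv/= => /andP[s0 _].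
have ts0 : 0 <= t + s by rewrite addr_ge0.
rewrite !psiE; [|exact: (Bplus_cumulant H hu)|exact: (Bplus_cumulant H hu)].
apply: eq_integral => nu _; congr (1 - expR (- _))%:E; apply: eq_rpair => x x0.
by rewrite addrC (cumulantD H hu).
Qed.

(** The population at time t + r is an independent superposition of the
    immigrants of the last t units of time, with their offspring, and of the
    descendants of the population at time r. *)
Lemma laplaceD t r sigma f : Bplus f -> 0 <= t -> 0 <= r ->
  laplace (t + r) sigma f = laplace t (intmeas0 R) f * laplace r sigma (u t f).
Proof.
move=> Bf t0 r0; rewrite /laplace rpair0 oppr0 add0r -expRD; congr expR.
rewrite immigrationD// opprD addrCA; congr (_ + (- _ + _)).
by apply: eq_rpair => x x0; rewrite addrC (cumulantD H hu).
Qed.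

Lemma count_gf_laplace t sigma w z : 0 <= t -> weight w -> 0 < z < 1 ->
  count_gf (P t sigma) w z = laplace t sigma (log_weight w z).
Proof.
move=> t0 ww z01; have Bw := Bplus_log_weight ww z01; have /andP[z0 _] := z01.
have h := laplaceE sigma t0 Bw.
rewrite /count_gf /Rintegral.
rewrite (@eq_integral _ _ _ (P t sigma) setT (fun nu => (expR (- rpair nu (log_weight w z)))%:E)).
  by rewrite h.
by move=> nu _; rewrite expR_rpair_log_weight.
Qed.

Lemma absmono_laplace_flow t x w : 0 <= t -> 0 <= x -> weight w ->
  absmono (fun z => laplace_flow u (log_weight w z) t x).
Proof.
move=> t0 x0 ww n h j h0 hj.
have g01 i : (i <= j + n)%N -> 0 < grid h i < 1.
  by move=> ij; apply: grid_itv => //; apply: le_lt_trans hj; exact: grid_le.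
apply: (@mild_fdiff R alpha p K c H (j + n) (fun i => laplace_flow u (log_weight w (grid h i)))
  (fun i y => expR (- log_weight w (grid h i) y))) => //.
- by move=> i ij; apply: (laplace_flow_unit hu); apply: Bplus_log_weight => //; exact: g01.
- by move=> i ij; apply: (laplace_flow_mild H hu); apply: Bplus_log_weight => //; exact: g01.
move=> m i y iN y0.
rewrite (@eq_fdiff _ _ _ ((fun z => z ^+ w y) \o grid h)).
  by apply: absmono_exp => //; have /andP[] := g01 _ iN.
move=> l /andP[_ lh] /=; rewrite expR_log_weight//.
by have /andP[] := g01 l (leq_trans lh iN).
Qed.

Lemma absmono_laplace t r sigma w : 0 <= t -> 0 <= r -> weight w ->
  absmono (fun z => laplace r sigma (u t (log_weight w z))).
Proof.
move=> t0 r0 ww.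
have Bu z : 0 < z < 1 -> Bplus (u t (log_weight w z)).
  by move=> z01; apply: (Bplus_cumulant H hu) => //; exact: Bplus_log_weight.
apply: (@absmono_ext _ (fun z => \int[P r sigma]_nu expR (- rpair nu (u t (log_weight w z))))).
  by move=> z z01; rewrite /Rintegral laplaceE//; exact: Bu.
apply: absmono_integral.
- by rewrite trans1 ltry.
- by move=> z z01; apply: measurable_rpair_exp; exact: Bu.
- by move=> z nu z01; apply: expR_rpair_itv; exact: Bu.
move=> nu; apply: (@absmono_ext _ (fun z => \prod_(x <- atoms nu) laplace_flow u (log_weight w z) t x)).
  by move=> z _; rewrite expR_rpair.
apply: absmono_prod => x xl; apply: absmono_laplace_flow => //.
apply: (@atoms_ge0 _ nu); elim: (atoms nu) xl => //= y l IH [->|/IH]; first exact: mem_head.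
by rewrite inE => ->; rewrite orbT.
Qed.

Hypothesis hlog : (log_moment L < +oo)%E.

Let c_gt0 : 0 < c := sb_rate_gt0 H.

(** A lower bound for the probability that, at time t + r, nothing is left of
    N initial particles nor of the immigrants that arrived before time r. *)
Definition retention t (r : R) (N : nat) : R :=
  (1 - expR (- (c * (t + r)))) ^+ N * expR (- fine (mean_alive_time L c (expR (- (c * t))))).

Lemma expR_decay t : 0 <= t -> 0 <= expR (- (c * t)) <= 1.
Proof. by move=> t0; rewrite expR_ge0/= expR_le1 oppr_le0 mulr_ge0// ltW. Qed.

Lemma retention_itv t r N : 0 <= t -> 0 <= r -> 0 <= retention t r N <= 1.
Proof.
move=> t0 r0; have /andP[e0 e1] := expR_decay (addr_ge0 t0 r0).
have j0 : 0 <= fine (mean_alive_time L c (expR (- (c * t)))) by rewrite fine_ge0// mean_alive_time_ge0// expR_ge0.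
rewrite /retention mulr_ge0 ?expR_ge0 ?exprn_ge0 ?subr_ge0//=.
apply: mulr_ile1; rewrite ?expR_ge0 ?exprn_ge0 ?subr_ge0//.
  by apply: exprn_ile1; rewrite ?subr_ge0// gerBl.
by rewrite expR_le1 oppr_le0.
Qed.

(** The descendants of each particle present at time r die out within t with
    probability at least 1 - e^{-ct}, whatever z. The constant th with e^{-th}
    equal to this bound can therefore replace the test function at time r, and
    decays in turn. *)
Lemma retention_le_laplace t r sigma w z : 0 < t -> 0 <= r -> weight w -> 0 < z < 1 ->
  retention t r (natoms sigma) <= laplace r sigma (u t (log_weight w z)).
Proof.
move=> t0 r0 ww z01; have t0' := ltW t0.
have Bw := Bplus_log_weight ww z01.
have Bu : Bplus (u t (log_weight w z)) by exact: (Bplus_cumulant H hu).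
set a := expR (- (c * t)).
have /andP[a0 a1] : 0 <= a <= 1 by exact: expR_decay.
have a_lt1 : 0 < 1 - a by rewrite subr_gt0 /a expR_lt1 oppr_lt0 mulr_gt0.
pose th := - ln (1 - a).
have th0 : 0 <= th by rewrite oppr_ge0 ln_le0// gerBl.
have eth : expR (- th) = 1 - a by rewrite /th opprK lnK.
have Bth : Bplus (cst th) by exact: Bplus_cst.
have uth x : 0 <= x -> u t (log_weight w z) x <= th.
  move=> x0; rewrite -lerN2 -ler_expR eth lerBlDr -lerBlDl.
  have := @mild_decay R alpha p K c H _ _ 1 (laplace_flow_unit hu Bw) (laplace_flow_mild H hu Bw) ler01 _ t x t0' x0.
  by rewrite mul1r; apply => y y0; rewrite gerBl expR_ge0.
have dec s x : 0 <= s -> 0 <= x -> 1 - expR (- u s (cst th) x) <= a * expR (- (c * s)).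
  move=> s0 x0.
  apply: (@mild_decay R alpha p K c H _ _ a (laplace_flow_unit hu Bth) (laplace_flow_mild H hu Bth) a0) => // y y0.
  by rewrite eth opprB addrCA subrr addr0.
apply: (@le_trans _ _ (laplace r sigma (cst th))); last first.
  have h : (\int[P r sigma]_nu (expR (- rpair nu (cst th)))%:E <=
      \int[P r sigma]_nu (expR (- rpair nu (u t (log_weight w z))))%:E)%E.
    apply: ge0_le_integral; first exact: measurableT.
    - by move=> nu _; rewrite lee_fin expR_ge0.
    - by apply/measurable_EFinP; exact: measurable_rpair_exp.
    - by apply/measurable_EFinP; exact: measurable_rpair_exp.
    - by move=> nu _; rewrite lee_fin ler_expR lerN2; exact: rpair_le.
  by move: h; rewrite (laplaceE sigma r0 Bth) (laplaceE sigma r0 Bu) lee_fin.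
rewrite /retention /laplace expRD; apply: ler_pM; rewrite ?expR_ge0 ?exprn_ge0//.
- by rewrite subr_ge0; have /andP[] := expR_decay (addr_ge0 t0' r0).
- rewrite expR_rpair /natoms.
  have : forall x, x \in atoms sigma -> 0 <= x by move=> x; exact: atoms_ge0.
  have /andP[_ b1] := expR_decay (addr_ge0 t0' r0).
  elim: (atoms sigma) => [|y l IH] hl; first by rewrite big_nil expr0.
  rewrite big_cons exprS; apply: ler_pM; rewrite ?exprn_ge0 ?subr_ge0//.
    rewrite lerBlDr -lerBlDl; apply: le_trans (dec r y r0 _) _; first by apply: hl; rewrite mem_head.
    by rewrite /a -expRD -opprD -mulrDr.
  by apply: IH => x xl; apply: hl; rewrite inE xl orbT.
- rewrite ler_expR lerN2 /immigration; apply: fine_le.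
  + by rewrite immigrationE.
  + rewrite ge0_fin_numE ?mean_alive_time_ge0//; apply: mean_alive_time_lty => //.
    by rewrite a0.
  apply: le_trans (psi_integral_le L a0 (measurable_cumulant Bth) _ dec); last first.
    by move=> s s0; exact: (Bplus_cumulant H hu).
  apply: ge0_subset_integral => //.
  + by rewrite Rplus_itv; exact: measurable_psi_cumulant.
  + by move=> s; rewrite /= in_itv/= andbT => s0; exact: psi_cumulant_ge0.
  + by apply: subset_itvl; rewrite bnd_simp.
Qed.

(** By [laplaceD] the difference of the generating functions is that of P t 0
    times the second factor reduced by its lower bound, a product of
    absolutely monotone functions. *)
Lemma minorization t r sigma : 0 < t -> 0 <= r -> forall A : set (intmeas R), measurable A ->
  ((retention t r (natoms sigma))%:E * P t (intmeas0 R) A <= P (t + r) sigma A)%E.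
Proof.
move=> t0 r0; have t0' := ltW t0.
apply: law_dominated_gf; [exact: trans1|exact: trans1|exact: retention_itv|].
move=> w ww.
apply: (@absmono_ext _ (fun z => count_gf (P t (intmeas0 R)) w z *
   (laplace r sigma (u t (log_weight w z)) - retention t r (natoms sigma)))).
  move=> z z01; rewrite !count_gf_laplace//; last by rewrite addr_ge0.
  by rewrite laplaceD ?mulrBr; [rewrite [retention _ _ _ * _]mulrC|exact: Bplus_log_weight| |].
apply: absmonoM; first by apply: absmono_count_gf => //; rewrite trans1 ltry.
apply: absmonoBc; first exact: absmono_laplace.
by move=> z z01; exact: retention_le_laplace.
Qed.

End Semigroup.

(** * Laws that nearly dominate one another *)

Section DominatedLaws.
Context d (T : measurableType d) (R : realType).
Implicit Types (k M : R) (F : T -> R).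

(** Domination is applied to the nonnegative functions M + F and M - F. *)
Lemma dominated_integral (m1 m2 : {measure set T -> \bar R}) k F M : m1 setT = 1%E -> m2 setT = 1%E -> 0 <= k <= 1 ->
  (forall A, measurable A -> (k%:E * m2 A <= m1 A)%E) ->
  measurable_fun setT F -> (forall x, `|F x| <= M) ->
  `|\int[m1]_x F x - \int[m2]_x F x| <= 2 * M * (1 - k).
Proof.
move=> m11 m21 /andP[k0 k1] dom mF FM.
have int (m : {measure set T -> \bar R}) (G : T -> R) : m setT = 1%E -> measurable_fun setT G ->
    (exists C, forall x, `|G x| <= C) -> m.-integrable setT (EFin \o G).
  by move=> mm mG [C GC]; apply: (bounded_integrable (M := C)); rewrite ?mm ?ltry.
pose k' : {nonneg R} := NngNum k0.
have one_sided (G : T -> R) : measurable_fun setT G -> (forall x, 0 <= G x <= 2 * M) ->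
    \int[m2]_x G x - \int[m1]_x G x <= 2 * M * (1 - k).
  move=> mG GM.
  have bG : exists C, forall x, `|G x| <= C.
    by exists (2 * M) => x; have /andP[G0 G1] := GM x; rewrite ger0_norm.
  have i1 := int m1 G m11 mG bG; have i2 := int m2 G m21 mG bG.
  have e1 : (\int[m1]_x (G x)%:E = (\int[m1]_x G x)%:E)%E.
    by rewrite /Rintegral fineK//; exact: integrable_fin_num.
  have e2 : (\int[m2]_x (G x)%:E = (\int[m2]_x G x)%:E)%E.
    by rewrite /Rintegral fineK//; exact: integrable_fin_num.
  have : (\int[mscale k' m2]_x (G x)%:E <= \int[m1]_x (G x)%:E)%E.
    apply: ge0_le_measure_integral => //; first by move=> x; rewrite lee_fin; have /andP[] := GM x.
    exact/measurable_EFinP.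
  rewrite ge0_integral_mscale//; first last.
  - by move=> x _; rewrite lee_fin; have /andP[] := GM x.
  - exact/measurable_EFinP.
  rewrite e1 e2 -EFinM lee_fin /= => le12.
  have le2 : \int[m2]_x G x <= 2 * M.
    rewrite -lee_fin -e2 -[leRHS]mule1 -m21 -integral_cst//.
    apply: ge0_le_integral => //.
    - by move=> x _; rewrite lee_fin; have /andP[] := GM x.
    - exact/measurable_EFinP.
    - by move=> x _; rewrite lee_fin; have /andP[] := GM x.
  by have : (1 - k) * \int[m2]_x G x <= (1 - k) * (2 * M); [rewrite ler_wpM2l// subr_ge0|lra].
have iF (m : {measure set T -> \bar R}) : m setT = 1%E -> m.-integrable setT (EFin \o F).
  by move=> mm; apply: int => //; exists M.
have ic (m : {measure set T -> \bar R}) : m setT = 1%E -> m.-integrable setT (EFin \o cst M).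
  by move=> mm; apply: int => //; exists `|M|.
have cM (m : {measure set T -> \bar R}) : m setT = 1%E -> \int[m]_x (cst M) x = M.
  by move=> mm; rewrite Rintegral_cst// mm mulr1.
have hF x : - M <= F x <= M by rewrite -ler_norml.
have iD (m : {measure set T -> \bar R}) : m setT = 1%E -> \int[m]_x (F x + cst M x) = \int[m]_x F x + M.
  by move=> mm; rewrite RintegralD ?cM//; [exact: iF|exact: ic].
have iB (m : {measure set T -> \bar R}) : m setT = 1%E -> \int[m]_x (cst M x - F x) = M - \int[m]_x F x.
  by move=> mm; rewrite RintegralB ?cM//; [exact: ic|exact: iF].
have h1 : \int[m2]_x (F x + cst M x) - \int[m1]_x (F x + cst M x) <= 2 * M * (1 - k).
  apply: one_sided; first exact: measurable_funD.
  by move=> x; have /andP[] := hF x; rewrite /cst => a b; apply/andP; split; lra.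
have h2 : \int[m2]_x (cst M x - F x) - \int[m1]_x (cst M x - F x) <= 2 * M * (1 - k).
  apply: one_sided; first exact: measurable_funB.
  by move=> x; have /andP[] := hF x; rewrite /cst => a b; apply/andP; split; lra.
rewrite !iD// in h1; rewrite !iB// in h2.
by rewrite ler_norml; apply/andP; split; lra.
Qed.

Section UniformLimit.
Variables (Q : nat -> {measure set T -> \bar R}) (k : nat -> R).
Hypothesis Q1 : forall n, Q n setT = 1%E.
Hypothesis k01 : forall n, 0 <= k n <= 1.
Hypothesis k_cvg : k @ \oo --> (1 : R).
Hypothesis Qk : forall n m A, (n <= m)%N -> measurable A -> ((k n)%:E * Q n A <= Q m A)%E.

Let q n (A : set T) : R := fine (Q n A).

Let QE n A : measurable A -> Q n A = (q n A)%:E.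
Proof.
move=> mA; rewrite /q fineK// ge0_fin_numE//; apply: (@le_lt_trans _ _ 1%E); last exact: ltry.
by rewrite -(Q1 n); apply: le_measure; rewrite ?inE.
Qed.

Let q_ge0 n A : 0 <= q n A. Proof. exact: fine_ge0. Qed.

Let qC n A : measurable A -> q n (~` A) = 1 - q n A.
Proof.
move=> mA; apply: EFin_inj; rewrite EFinB -!QE//; last exact: measurableC.
have fA : Q n A \is a fin_num by rewrite QE.
by rewrite -(Q1 n) -(setvU A) measureU ?addeK// ?setICl//; exact: measurableC.
Qed.

Let q_lower n m A : (n <= m)%N -> measurable A -> k n * q n A <= q m A.
Proof. by move=> nm mA; rewrite -lee_fin EFinM -!QE//; exact: Qk. Qed.

Let q_le1 n A : measurable A -> q n A <= 1.
Proof. by move=> mA; have := q_ge0 n (~` A); rewrite qC// subr_ge0. Qed.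

Let q_dist n m A : (n <= m)%N -> measurable A -> `|q m A - q n A| <= 1 - k n.
Proof.
move=> nm mA; have h1 := q_lower nm mA; have h2 := q_lower nm (measurableC mA).
rewrite !qC// in h2; have g0 := q_ge0 n A; have g1 := q_le1 n mA; have /andP[k0 k1] := k01 n.
by rewrite ler_norml; apply/andP; split; nra.
Qed.

Let k_near (e : R) : 0 < e -> exists N, 1 - k N < e.
Proof.
move=> e0; have /cvgrPdist_lt/(_ e e0) [N _ hN] := k_cvg; exists N.
by apply: le_lt_trans (hN N (leqnn N)); exact: ler_norm.
Qed.

Let q_cvg A : measurable A -> cvgn (q^~ A).
Proof.
move=> mA; apply/cauchy_cvgP; apply: cauchy_exP => e e0.
have [N hN] := k_near e0; exists (q N A); exists N => // m /= Nm.
by rewrite /ball/= distrC; apply: le_lt_trans hN; exact: q_dist.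
Qed.

Let l (A : set T) : R := limn (q^~ A).

Let sum_dist N n (F : nat -> set T) : (forall i, measurable (F i)) -> trivIset setT F ->
  `|\sum_(0 <= i < n) l (F i) - \sum_(0 <= i < n) q N (F i)| <= 1 - k N.
Proof.
move=> mF tF.
have qU m : \sum_(0 <= i < n) q m (F i) = q m (\big[setU/set0]_(i < n) F i).
  apply: EFin_inj; rewrite -QE; last by apply: bigsetU_measurable => i _.
  by rewrite measure_bigsetU// -sumEFin big_mkord; apply: eq_bigr => i _; apply/esym; exact: QE.
have cv : (fun m => `|\sum_(0 <= i < n) q m (F i) - \sum_(0 <= i < n) q N (F i)|) @ \oo -->
    `|\sum_(0 <= i < n) l (F i) - \sum_(0 <= i < n) q N (F i)|.
  apply: cvg_norm; apply: cvgB; last exact: cvg_cst.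
  by apply: (@cvg_sum_seq R _ _ (fun m i => q m (F i)) (fun i => l (F i))) => i _; exact: q_cvg.
rewrite -(cvg_lim _ cv)//; apply: limr_le; first by apply/cvg_ex; eexists; exact: cv.
exists N => // m /= Nm; rewrite !qU; apply: q_dist => //.
by apply: bigsetU_measurable => i _.
Qed.

Let l_dist N A : measurable A -> `|l A - q N A| <= 1 - k N.
Proof.
move=> mA; pose F i := if i == 0%N then A else set0 : set T.
have mF i : measurable (F i) by rewrite /F; case: ifP.
have tF : trivIset setT F.
  by move=> [|i] [|j] _ _ // [x []]; rewrite /F/=.
by have := @sum_dist N 1%N F mF tF; rewrite !big_nat1.
Qed.

(** The value 0 on non-measurable sets keeps the function nonnegative there,
    where the limit may fail to exist. *)
Let eta (A : set T) : \bar R := if `[< measurable A >] then (l A)%:E else 0%E.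

Let etaE A : measurable A -> eta A = (l A)%:E.
Proof. by move=> mA; rewrite /eta asboolT. Qed.

Let l_ge0 A : measurable A -> 0 <= l A.
Proof. by move=> mA; apply: limr_ge; [exact: q_cvg|apply: nearW => n; exact: q_ge0]. Qed.

Let eta_ge0 A : (0 <= eta A)%E.
Proof. by rewrite /eta; case: asboolP => // mA; rewrite lee_fin l_ge0. Qed.

Let l_cst A (x : R) : (forall n, q n A = x) -> l A = x.
Proof.
move=> qx; rewrite /l (_ : q^~ A = cst x); last exact/funext.
exact: lim_cst.
Qed.

Let eta0 : eta set0 = 0%E.
Proof. by rewrite etaE// (l_cst (x := 0))// => n; rewrite /q measure0. Qed.

Let eta_sigma_additive : semi_sigma_additive eta.
Proof.
move=> F mF tF mU; rewrite etaE//.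
rewrite (_ : (fun n => _) = (fun n => (\sum_(0 <= i < n) l (F i))%:E)); last first.
  by apply/funext => n; rewrite -sumEFin; apply: eq_bigr => i _; rewrite etaE.
apply: cvg_EFin; first exact: nearW.
apply/cvgrPdist_lt => e e0.
have e3 : 0 < e / 3 by rewrite divr_gt0.
have [N hN] := k_near e3.
have := @measure_semi_sigma_additive _ _ _ (Q N) F mF tF mU.
rewrite QE// (_ : (fun n => _) = (fun n => (\sum_(0 <= i < n) q N (F i))%:E)); last first.
  by apply/funext => n; rewrite -sumEFin; apply: eq_bigr => i _; rewrite QE.
move=> /fine_cvg /cvgrPdist_lt/(_ _ e3) [n0 _ hn0].
exists n0 => // n /hn0 /= h.
have d1 := @sum_dist N n F mF tF; have d2 := l_dist N mU.
rewrite distrC in d1.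
have E : l (\bigcup_n F n) - \sum_(0 <= i < n) l (F i) =
  (l (\bigcup_n F n) - q N (\bigcup_n F n)) + (q N (\bigcup_n F n) - \sum_(0 <= i < n) q N (F i)) +
  (\sum_(0 <= i < n) q N (F i) - \sum_(0 <= i < n) l (F i)) by ring.
rewrite E; apply: le_lt_trans (ler_normD _ _) _.
apply: le_lt_trans (lerD (ler_normD _ _) (lexx _)) _.
move: d1 d2 h; move: `|_| `|_| `|_| => a b c' d1 d2 h; lra.
Qed.

HB.instance Definition _ := isMeasure.Build _ _ _ eta eta0 eta_ge0 eta_sigma_additive.

Let eta_setT : eta setT = 1%E.
Proof. by rewrite etaE// (l_cst (x := 1))// => n; rewrite /q Q1. Qed.

HB.instance Definition _ := Measure_isProbability.Build _ _ _ eta eta_setT.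

(** Domination for a set and for its complement makes the sequence Cauchy
    uniformly over all measurable sets, and a uniform limit of measures is
    countably additive. *)
Lemma dominating_limit : exists mu : probability T R,
  forall n A, measurable A -> ((k n)%:E * Q n A <= mu A)%E.
Proof.
exists eta => n A mA; suff h : ((k n)%:E * Q n A <= eta A)%E by exact: h.
rewrite etaE// QE// -EFinM lee_fin; apply: limr_ge; first exact: q_cvg.
by exists n => // m /= nm; exact: q_lower.
Qed.

End UniformLimit.
End DominatedLaws.

(** * Convergence in law *)

Section Ergodicity.
Variables (R : realType) (alpha : R -> R) (p : R -> nat -> R)
  (L : {finite_measure set (intmeas R) -> \bar R})
  (u : R -> (R -> R) -> R -> R)
  (P : R -> R.-pker (intmeas R) ~> (intmeas R)) (K c : R).
Hypothesis H : subcritical_branching alpha p K c.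
Hypothesis hu : cumulant_semigroup alpha p u.
Hypothesis hP : immigration_semigroup L u P.
Notation leb := (@lebesgue_measure R).
Notation zero := (intmeas0 R).
Implicit Types (r s t : R) (nu sigma : intmeas R) (f : R -> R) (F : intmeas R -> R).

Let c_gt0 : 0 < c := sb_rate_gt0 H.

Lemma bernoulli_le (x : R) N : 0 <= x <= 1 -> 1 - N%:R * x <= (1 - x) ^+ N.
Proof.
move=> /andP[x0 x1]; elim: N => [|N IH]; first by rewrite mul0r subr0 expr0.
have q1 : (1 - x) ^+ N <= 1 by apply: exprn_ile1; rewrite ?subr_ge0// gerBl.
rewrite exprS -natr1 mulrDl mul1r; move: ((1 - x) ^+ N) (N%:R : R) IH q1 => q n IH q1; nra.
Qed.

Lemma natoms_zero : natoms zero = 0%N.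
Proof. exact/natoms0P. Qed.

Lemma bounded_law_integral (m : {measure set (intmeas R) -> \bar R}) F M : m setT = 1%E ->
  measurable_fun setT F -> (forall nu, `|F nu| <= M) ->
  (\int[m]_nu (F nu)%:E = (\int[m]_nu F nu)%:E)%E.
Proof.
move=> m1 mF FM; rewrite /Rintegral fineK//; apply: integrable_fin_num => //.
by apply: (bounded_integrable (M := M)); rewrite ?m1 ?ltry.
Qed.

Section LogMoment.
Hypothesis hlog : (log_moment L < +oo)%E.

Lemma retention0 n r : retention L c n r 0 = expR (- fine (mean_alive_time L c (expR (- (c * n))))).
Proof. by rewrite /retention expr0 mul1r. Qed.

Lemma retention_cvg : (fun n => retention L c n.+1%:R 0 0) @ \oo --> (1 : R).
Proof.
have := mean_alive_time_cvg0 hlog c_gt0; rewrite -(cvg_shiftS (fun n => mean_alive_time L c (expR (- (c * n%:R))))) => /fine_cvg h.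
have -> : (fun n => retention L c n.+1%:R 0 0) =
    (fun n => expR (- fine (mean_alive_time L c (expR (- (c * n.+1%:R)))))).
  by apply/funext => n; rewrite retention0.
rewrite -[X in _ --> X]expR0 -[X in expR X]oppr0.
by apply: continuous_cvg; [exact: continuous_expR|exact: cvgN].
Qed.

(** Both the limit law and P t sigma, for large t, dominate nearly all of P n
    0 with n fixed; hence they are close to it in total variation, and to each
    other. *)
Lemma limit_law : exists eta : probability (intmeas R) R,
  forall sigma F M, measurable_fun setT F -> (forall nu, `|F nu| <= M) ->
    \int[P t sigma]_nu F nu @[t --> +oo] --> \int[eta]_nu F nu.
Proof.
pose Q n : {measure set (intmeas R) -> \bar R} := P n.+1%:R zero.
pose k n := retention L c n.+1%:R 0 0.
have Q1 n : Q n setT = 1%E by exact: trans1.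
have k01 n : 0 <= k n <= 1 by exact: (retention_itv L H).
have kE n r : k n = retention L c n.+1%:R r 0 by rewrite /k !retention0.
have Qk n m A : (n <= m)%N -> measurable A -> ((k n)%:E * Q n A <= Q m A)%E.
  move=> nm mA; have n0 : 0 < (n.+1%:R : R) by rewrite ltr0n.
  have r0 : 0 <= ((m - n)%:R : R) by [].
  have := minorization H hu hP hlog zero n0 r0 mA.
  rewrite natoms_zero -kE.
  by have -> : n.+1%:R + (m - n)%:R = m.+1%:R :> R by rewrite -natrD addSn subnKC.
have [eta eta_dom] := dominating_limit Q1 k01 retention_cvg Qk.
exists eta => sigma F M mF FM.
have eta1 : eta setT = 1%E by exact: probability_setT.
have M0 : 0 <= M := le_trans (normr_ge0 _) (FM zero).
apply/cvgrPdist_lt => e e0.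
have e8 : 0 < e / (8 * (M + 1)) by rewrite divr_gt0// mulr_gt0// ltr_wpDl.
have [n kn] : exists n, 1 - k n < e / (8 * (M + 1)).
  have /cvgrPdist_lt/(_ _ e8) [n _ hn] := retention_cvg; exists n.
  by apply: le_lt_trans (hn n (leqnn n)); exact: ler_norm.
have e8N : 0 < e / (8 * (M + 1)) / (natoms sigma).+1%:R by rewrite divr_gt0.
have /cvgrPdist_lt/(_ _ e8N) [x0 [_ hx0]] := @cvgr_expR R.
exists (Num.max n.+1%:R (x0 / c)); split; first exact: num_real.
move=> t; rewrite gt_max => /andP[nt x0t].
have r0 : 0 <= t - n.+1%:R by rewrite subr_ge0 ltW.
have n0 : 0 < (n.+1%:R : R) by rewrite ltr0n.
have tE : n.+1%:R + (t - n.+1%:R) = t by rewrite addrC subrK.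
have t0 : 0 <= t by rewrite (le_trans _ (ltW nt)).
have dt : expR (- (c * t)) < e / (8 * (M + 1)) / (natoms sigma).+1%:R.
  have := hx0 (c * t); rewrite ltr_pdivrMr// mulrC in x0t => /(_ x0t).
  by rewrite sub0r normrN ger0_norm ?expR_ge0.
have dom A : measurable A ->
    ((retention L c n.+1%:R (t - n.+1%:R) (natoms sigma))%:E * Q n A <= P t sigma A)%E.
  by move=> mA; rewrite -[t in leRHS]tE; exact: (minorization H hu hP hlog).
have kap := @retention_itv R alpha p L K c H n.+1%:R (t - n.+1%:R) (natoms sigma) (ltW n0) r0.
have d1 := dominated_integral (trans1 P t sigma) (Q1 n) kap dom mF FM.
have d2 := dominated_integral eta1 (Q1 n) (k01 n) (eta_dom n) mF FM.
have low : 1 - retention L c n.+1%:R (t - n.+1%:R) (natoms sigma) <= (1 - k n) + e / (8 * (M + 1)).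
  have := bernoulli_le (natoms sigma) (expR_decay H t0).
  have : (natoms sigma)%:R * expR (- (c * t)) <= e / (8 * (M + 1)).
    apply: (@le_trans _ _ ((natoms sigma).+1%:R * expR (- (c * t)))).
      by rewrite ler_wpM2r ?expR_ge0// ler_nat.
    by move: (ltW dt); rewrite ler_pdivlMr// mulrC.
  have -> : retention L c n.+1%:R (t - n.+1%:R) (natoms sigma) = (1 - expR (- (c * t))) ^+ natoms sigma * k n.
    by rewrite /k retention0 /retention tE.
  have /andP[] := k01 n; have : (1 - expR (- (c * t))) ^+ natoms sigma <= 1.
    by have /andP[a0 a1] := expR_decay H t0; apply: exprn_ile1; rewrite ?subr_ge0// gerBl.
  by move: (_ ^+ _) (_ * expR _) (k n) => q y kk; nra.
have eM : e / (8 * (M + 1)) * (8 * (M + 1)) = e by rewrite divfK// lt0r_neq0// mulr_gt0// ltr_wpDl.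
rewrite -(subrK (\int[Q n]_nu F nu) (\int[eta]_nu F nu)) -addrA.
apply: le_lt_trans (ler_normD _ _) _; rewrite [`|_ - \int[P t sigma]_nu F nu|]distrC.
apply: le_lt_trans (lerD d2 d1) _.
by move: kn low eM; move: (e / _) (1 - k n) (1 - retention _ _ _ _ _) => d a b; nra.
Qed.

Lemma limit_law_weak : exists eta : probability (intmeas R) R,
  (forall sigma, weakly_converges (fun t => P t sigma) eta) /\
  (forall f, Bplus f -> (\int[eta]_nu (expR (- rpair nu f))%:E =
    expeR (- \int[leb]_(s in `[0%R, +oo[) psi L (u s f)))%E).
Proof.
have [eta heta] := limit_law.
have eta1 : eta setT = 1%E by exact: probability_setT.
exists eta; split.
  move=> sigma F cF [M FM]; have mF := measurable_continuous cF.
  rewrite (bounded_law_integral eta1 mF FM).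
  have -> : (fun t => \int[P t sigma]_nu (F nu)%:E)%E = (fun t => (\int[P t sigma]_nu F nu)%:E).
    by apply/funext => t; rewrite (bounded_law_integral (trans1 P t sigma) mF FM).
  by apply: cvg_EFin; [exact: nearW|exact: heta].
move=> f Bf.
have mF := measurable_rpair_exp Bf.
have FM nu : `|expR (- rpair nu f)| <= 1.
  by have /andP[a b] := expR_rpair_itv nu Bf; rewrite ger0_norm.
have psi0 s : 0 <= s -> (0 <= psi L (u s f))%E by move=> s0; exact: (psi_cumulant_ge0 L H hu).
have mpsi : measurable_fun (Rplus R) (fun s => psi L (u s f)) by exact: (measurable_psi_cumulant L H hu).
have fin : (\int[leb]_(s in `[0%R, +oo[) psi L (u s f))%E \is a fin_num.
  rewrite ge0_fin_numE; last by apply: integral_ge0 => s; rewrite /= in_itv/= andbT; exact: psi0.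
  apply: (@le_lt_trans _ _ (mean_alive_time L c 1)); last by apply: mean_alive_time_lty => //; rewrite ler01 lexx.
  apply: (psi_integral_le L ler01 (measurable_cumulant hu Bf)).
    by move=> s s0; exact: (Bplus_cumulant H hu).
  move=> s x s0 x0.
  by apply: (@mild_decay R alpha p K c H _ _ 1 (laplace_flow_unit hu Bf) (laplace_flow_mild H hu Bf) ler01) => // y y0; rewrite gerBl expR_ge0.
have cvI := integral_0y_cvg mpsi psi0.
rewrite -(fineK fin) in cvI *.
set I := fine _ in cvI *.
have EI : (fun n : nat => \int[leb]_(s in `[0%R, n%:R]) psi L (u s f))%E = (fun n : nat => (immigration L u f n%:R)%:E).
  by apply/funext => n; exact: (immigrationE L H hu).
rewrite EI in cvI.
have {}cvI : (fun n : nat => immigration L u f n%:R) @ \oo --> I by exact: fine_cvg cvI.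
have cv1 : (fun n : nat => expR (- immigration L u f n%:R)) @ \oo --> expR (- I).
  by apply: continuous_cvg; [exact: continuous_expR|exact: cvgN].
have cv2 : (fun n : nat => \int[P n%:R zero]_nu expR (- rpair nu f)) @ \oo --> \int[eta]_nu expR (- rpair nu f).
  exact: (cvg_comp _ _ (@cvgr_idn R) (heta zero _ _ mF FM)).
have E n : \int[P n%:R zero]_nu expR (- rpair nu f) = expR (- immigration L u f n%:R).
  have := laplaceE H hu hP zero (ler0n R n) Bf.
  rewrite (bounded_law_integral (trans1 P n%:R zero) mF FM) => -[->].
  by rewrite /laplace rpair0 oppr0 add0r.
have {}cv2 : (fun n : nat => expR (- immigration L u f n%:R)) @ \oo --> \int[eta]_nu expR (- rpair nu f).
  by apply: cvg_trans cv2; apply: near_eq_cvg; apply: nearW => n; rewrite E.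
rewrite (bounded_law_integral eta1 mF FM) -EFinN /=; congr EFin.
exact: (cvg_unique _ cv2 cv1).
Qed.

End LogMoment.

(** The Laplace functional of P t 0 at the constant 1 is the exponential of
    minus the integral of psi (u_s 1) over [0, t]. Its limit is positive since
    the limit law has no infinite configurations; so the integral over the
    half-line is finite, and it bounds the logarithmic moment. *)
Lemma weak_limit_log_moment (eta : probability (intmeas R) R) :
  weakly_converges (fun t => P t zero) eta -> (log_moment L < +oo)%E.
Proof.
move=> weta; have eta1 : eta setT = 1%E by exact: probability_setT.
have B1 : Bplus (cst (1 : R)) by apply: Bplus_cst.
pose F nu := expR (- rpair nu (cst 1)).
have cF : continuous F.
  move=> nu; apply: continuous_comp; last exact: continuous_expR.
  by apply: continuousN; exact: (@rpair_continuous R (Cb_one R)).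
have mF : measurable_fun setT F by exact: measurable_continuous.
have FM nu : `|F nu| <= 1.
  by have /andP[a b] := expR_rpair_itv nu B1; rewrite ger0_norm.
have wF := weta F cF (ex_intro _ 1 FM).
set l := \int[eta]_nu F nu.
have lE : (\int[eta]_nu (F nu)%:E)%E = l%:E by exact: (bounded_law_integral eta1 mF FM).
have l0 : 0 < l.
  have l0 : 0 <= l by apply: Rintegral_ge0 => nu _; exact: expR_ge0.
  rewrite lt_neqAle l0 andbT; apply/negP => /eqP lz.
  have : (\int[eta]_nu `|(F nu)%:E| = 0)%E.
    transitivity (\int[eta]_nu (F nu)%:E)%E; last by rewrite lE -lz.
    by apply: eq_integral => nu _; rewrite abse_EFin ger0_norm// expR_ge0.
  move/ae_eq_integral_abs => /(_ measurableT); case; first exact/measurable_EFinP.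
  move=> N [mN N0 hN].
  have NT : N = setT.
    apply/seteqP; split => // nu _; apply: hN => /= /(_ I) [] /eqP.
    by rewrite gt_eqF// expR_gt0.
  have : 1%E = 0%E :> \bar R by apply: etrans (esym eta1) _; rewrite -NT; exact: N0.
  by move/eqP; rewrite onee_eq0.
have psi0 s : 0 <= s -> (0 <= psi L (u s (cst 1%R)))%E by move=> s0; exact: (psi_cumulant_ge0 L H hu).
have mpsi : measurable_fun (Rplus R) (fun s => psi L (u s (cst 1%R))) by exact: (measurable_psi_cumulant L H hu).
pose a (n : nat) := immigration L u (cst 1%R) n%:R.
have aE n : (\int[leb]_(s in `[0%R, n%:R]) psi L (u s (cst 1%R)))%E = (a n)%:E by exact: (immigrationE L H hu).
have a_mono n m : (n <= m)%N -> a n <= a m.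
  move=> nm; rewrite -lee_fin -!aE; apply: ge0_subset_integral => //.
  - by apply: measurable_funS mpsi; [exact: measurable_Rplus|move=> s; rewrite /Rplus/= in_itv/= => /andP[]].
  - by move=> s; rewrite /= in_itv/= => /andP[s0 _]; exact: psi0.
  - by apply: subset_itvl; rewrite bnd_simp ler_nat.
have cva : (fun n => expR (- a n)) @ \oo --> l.
  have := cvg_comp _ _ (@cvgr_idn R) wF; rewrite lE => /fine_cvgP[_].
  apply: cvg_trans; apply: near_eq_cvg; apply: nearW => n /=.
  have -> := laplaceE H hu hP zero (ler0n R n) B1.
  by rewrite /= /laplace rpair0 oppr0 add0r.
have a_le n : a n <= - ln l.
  rewrite -lerN2 opprK -ler_expR lnK//.
  rewrite -(cvg_lim _ cva)//; apply: limr_le; first by apply/cvg_ex; eexists; exact: cva.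
  exists n; first by [].
  by move=> m /= nm; rewrite ler_expR lerN2; exact: a_mono.
have fin : (\int[leb]_(s in `[0%R, +oo[) psi L (u s (cst 1%R)) <= (- ln l)%:E)%E.
  have cvI := integral_0y_cvg mpsi psi0.
  rewrite -(cvg_lim _ cvI)//; apply: lime_le; first by apply/cvg_ex; eexists; exact: cvI.
  by apply: nearW => n; rewrite aE lee_fin.
have K0 : 0 < K := lt_trans c_gt0 (sb_rate_lt H).
have e1 : 0 < 1 - expR (- 1 : R) by rewrite subr_gt0 expR_lt1 oppr_lt0.
have BU : forall s : R, 0 <= s -> Bplus (u s (cst 1%R)) by move=> s; exact: (Bplus_cumulant H hu B1).
have low := log_moment_le L K0 (ltW e1) (measurable_cumulant hu B1) BU.
have {low} : ((((1 - expR (- (1 - expR (- 1)))) / K)%:E) * log_moment L <= (- ln l)%:E)%E.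
  apply: le_trans (low _) fin => s x s0 x0; rewrite mulrC.
  exact: (@mild_upper R alpha p K c H _ _ (laplace_flow_unit hu B1) (laplace_flow_mild H hu B1)).
have q0 : 0 < (1 - expR (- (1 - expR (- 1)))) / K.
  by rewrite divr_gt0// subr_gt0 expR_lt1 oppr_lt0.
move: (log_moment L) => [r||] //; first by rewrite ltry.
by rewrite gt0_muley ?lte_fin// leye_eq.
Qed.

End Ergodicity.

Lemma subcritical_rate (R : realType) (alpha : R -> R) (p : R -> nat -> R) :
  Bplus alpha -> offspring_law p ->
  (ereal_sup [set (alpha y)%:E * (gen_mean p y - 1) | y in Rplus R] < 0)%E ->
  exists K c : R, subcritical_branching alpha p K c.
Proof.
move=> [malpha a0 [M aM]] hp hc0.
have ub y : 0 <= y -> ((alpha y * (gmean p y - 1))%:E <=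
    ereal_sup [set (alpha y)%:E * (gen_mean p y - 1) | y in Rplus R])%E.
  by move=> y0; apply: ereal_sup_ubound; exists y => //; rewrite (gmeanE hp)// -EFinB -EFinM.
have [c c0 hc] : exists2 c : R, 0 < c & forall y, 0 <= y -> alpha y * (gmean p y - 1) <= - c.
  case: (ereal_sup _) hc0 ub => [s| |] // s0 ub.
    exists (- s) => [|y y0]; first by rewrite oppr_gt0 -lte_fin.
    by rewrite opprK -lee_fin; exact: ub.
  by have := ub 0 (lexx _); rewrite leeNy_eq.
exists (Num.max M c + 1), c; split => //.
- by rewrite ltr_pwDr// le_max lexx orbT.
- move=> y y0; apply: le_trans (aM y y0) _.
  by rewrite (@le_trans _ _ (Num.max M c))// ?le_max ?lexx// lerDl.
- by move=> y y0; have := hc y y0; lra.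
Qed.

Local Open Scope ereal_scope.

Theorem theorem3p5 (R : realType) (alpha : R -> R) (p : R -> nat -> R)
    (L : {finite_measure set (intmeas R) -> \bar R})
    (u : R -> (R -> R) -> R -> R)
    (P : R -> R.-pker (intmeas R) ~> (intmeas R))
    (halpha : Bplus alpha) (halpha0 : bounded_away_from_zero alpha)
    (hp : offspring_law p)
    (hL : L [set intmeas0 R] = 0)
    (hu : cumulant_semigroup alpha p u)
    (hP : immigration_semigroup L u P)
    (hc0 : ereal_sup [set (alpha y)%:E * (gen_mean p y - 1) | y in Rplus R] < 0) :
  ((exists eta : probability (intmeas R) R, forall sigma : intmeas R,
       weakly_converges (fun t => P t sigma) eta)
   <->
   \int[L]_(nu in [set nu | 1 <= pairing nu (cst 1%R)])
      lne (pairing nu (cst 1%R)) < +oo)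
  /\
  (forall eta : probability (intmeas R) R,
     (forall sigma : intmeas R, weakly_converges (fun t => P t sigma) eta) ->
     forall f : R -> R, Bplus f ->
       \int[eta]_nu expeR (- pairing nu f) =
       expeR (- \int[lebesgue_measure]_(s in `[0%R, +oo[) psi L (u s f))).
Proof.
have [K [c H]] := subcritical_rate halpha hp hc0.
rewrite log_momentE.
have only_if (eta : probability (intmeas R) R) :
    (forall sigma, weakly_converges (fun t => P t sigma) eta) -> log_moment L < +oo.
  by move=> weta; exact: (weak_limit_log_moment H hu hP (weta (intmeas0 R))).
split.
  split=> [[eta]|hlog]; first exact: only_if.
  by have [eta [weta _]] := limit_law_weak H hu hP hlog; exists eta.
move=> eta weta f Bf.
have [eta' [weta' laplace_eta']] := limit_law_weak H hu hP (only_if eta weta).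
rewrite -(laplace_eta' f Bf).
have eta_eq A : measurable A -> eta A = eta' A.
  apply: law_unique => F cF bF.
  exact: (cvg_unique _ (weta (intmeas0 R) F cF bF) (weta' (intmeas0 R) F cF bF)).
transitivity (\int[eta]_nu (expR (- rpair nu f))%:E).
  by apply: eq_integral => nu _; rewrite expeR_pairing.
by apply: eq_measure_integral => A mA _; exact: eta_eq.
Qed.
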